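(* Let $f \in W^{1,1}(\mathbb{R}^n) \cap W^{1,\infty}(\mathbb{R}^n)$ be nonzero and let $K\subset\mathbb{R}^n$ be a bounded star body. Then the following limits hold: (i) for any fixed $s\in(0,1)$, $\lim_{p\to\infty}\widetilde{\mathrm V}_{-sp}(K,\Pi^{\ast,s}_p f)^{1/p}=d_s(K,\Pi^{\ast,s}_\infty f)$; (ii) $\lim_{p\to\infty}\widetilde{\mathrm V}_{-p}(K,\Pi^{\ast}_p f)^{1/p}=d(K,\Pi^{\ast}_\infty f)$; (iii) $\lim_{s\to1^-}d_s(K,\Pi^{\ast,s}_\infty f)=d(K,\Pi^{\ast}_\infty f)$.
   Context: Functions are real valued; $W^{1,p}(\mathbb{R}^n)=\{f\in L^p: |\nabla f|\in L^p\}$, $p\in[1,\infty]$; elements of $W^{1,\infty}(\mathbb{R}^n)$ are identified with their Lipschitz representatives. For a set $K\subset\mathbb{R}^n$ star-shaped with respect to the origin, the gauge function is $\|x\|_K=\inf\{\lambda>0: x\in\lambda K\}\in[0,\infty]$ and the radial function is $\rho_K(x)=\sup\{\lambda>0:\lambda x\in K\}=\|x\|_K^{-1}\in[0,\infty]$, $x\neq0$. $K$ is a star body if $\rho_K$ is strictly positive and continuous on $\mathbb{R}^n\setminus\{0\}$. For $q\in\mathbb{R}\setminus\{0,n\}$ the dual mixed volume is $\widetilde{\mathrm V}_q(K,L)=\frac1n\int_{\mathbb{S}^{n-1}}\|\xi\|_K^{-n+q}\|\xi\|_L^{-q}\,d\xi$. For $s\in(0,1]$ the $s$-scaled dilation factor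 of $K$ relative to $L$ is $d_s(K,L)=\sup_{\xi\in\mathbb{S}^{n-1}}\|\xi\|_K^{-s}\|\xi\|_L^{s}$, and $d(K,L):=d_1(K,L)$. The following sets star-shaped with respect to the origin are defined through their gauge functions (a set with prescribed gauge $\|\cdot\|$ being $\{\xi:\|\xi\|\le 1\}$), for $\xi\in\mathbb{R}^n$, $s\in(0,1)$, $p\in[1,\infty)$: - $\Pi^{\ast,s}_p f$: $\|\xi\|_{\Pi^{\ast,s}_p f}^{ps}=p(1-s)\int_0^\infty t^{-ps-1}\int_{\mathbb{R}^n}|f(x+t\xi)-f(x)|^p\,dx\,dt$; - $\Pi^{\ast}_p f$: $\|\xi\|_{\Pi^\ast_p f}^p=\int_{\mathbb{R}^n}|\langle\nabla f(x),\xi\rangle|^p\,dx$; - $\Pi^{\ast,s}_\infty f$: $\|\xi\|_{\Pi^{\ast,s}_\infty f}^{s}=\sup_{(x,t)\in\mathbb{R}^n\times(0,\infty)}t^{-s}|f(x+t\xi)-f(x)|$; - $\Pi^{\ast}_\infty f$: $\|\xi\|_{\Pi^\ast_\infty f}=\operatorname{ess\,sup}_{x\in\mathbb{R}^n}|\langle\nabla f(x),\xi\rangle|$. *)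

(* Defs.v *)
From HB Require Import structures.
From mathcomp Require Import all_boot all_order all_algebra.
From mathcomp Require Import all_classical all_reals all_analysis.
From mathcomp Require Import measurable_realfun ess_sup_inf.

Set Implicit Arguments.
Unset Strict Implicit.
Unset Printing Implicit Defensive.

Import Order.TTheory GRing.Theory Num.Theory.
Import numFieldNormedType.Exports.

Local Open Scope classical_set_scope.
Local Open Scope ring_scope.

(* R^n is 'rV[R]_n.  The norm the library puts on 'rV[R]_n is the sup norm; it
   is used only for notions that do not depend on the choice of a norm
   (topology, boundedness, Lipschitz continuity).  The Euclidean structure is
   given by [dot] and [enorm]. *)

Section Euclidean.
Context {R : realType} {n : nat}.
Implicit Types x y : 'rV[R]_n.

Definition dot x y : R := \sum_(i < n) x 0 i * y 0 i.

Definition enorm x : R := Num.sqrt (dot x x).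

Definition sphere : set 'rV[R]_n := [set x | enorm x = 1].

Definition normalize x : 'rV[R]_n := (enorm x)^-1 *: x.

End Euclidean.
Arguments sphere {R} n.

(* The sigma-algebra generated by the coordinates, that is, the Borel sets. *)
Definition rV_display : measure_display. Proof. exact: default_measure_display. Qed.

Section rV_measurable.
Context {R : realType} {n : nat}.

Let coords : 'I_n -> 'rV[R]_n -> R := fun i x => x 0 i.

Let rV_set0 : g_sigma_preimage coords set0.
Proof. exact: sigma_algebra0. Qed.

Let rV_setC A : g_sigma_preimage coords A -> g_sigma_preimage coords (~` A).
Proof. exact: sigma_algebraC. Qed.

Let rV_bigcup (F : (set 'rV[R]_n)^nat) :
  (forall i, g_sigma_preimage coords (F i)) ->
  g_sigma_preimage coords (\bigcup_i (F i)).
Proof. exact: sigma_algebra_bigcup. Qed.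

HB.instance Definition _ := @isMeasurable.Build rV_display
  'rV[R]_n (g_sigma_preimage coords) rV_set0 rV_setC rV_bigcup.

End rV_measurable.

Section rV_measurable_fun.
Context {R : realType}.

Lemma measurable_coord n (i : 'I_n) :
  measurable_fun [set: 'rV[R]_n] (fun x : 'rV[R]_n => x 0 i).
Proof.
move=> _ Y mY; rewrite setTI; apply: sub_sigma_algebra => /=.
rewrite -bigcup_seq/=; exists i => /=; first by rewrite mem_index_enum.
by exists Y => //; rewrite setTI.
Qed.

Lemma measurable_fun_rVP d (T : measurableType d) n (f : T -> 'rV[R]_n) :
  (forall i, measurable_fun [set: T] (fun t => f t 0 i)) ->
  measurable_fun [set: T] f.
Proof.
move=> mf _ A mA; rewrite setTI.
suff : g_sigma_preimage (fun i (t : T) => f t 0 i) `<=` measurable.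
  apply; rewrite (_ : (fun i t => f t 0 i) =
    (fun i => (fun x : 'rV[R]_n => x 0 i) \o f))//.
  by rewrite (@g_sigma_preimage_comp _ _ n _ (fun i (x : 'rV[R]_n) => x 0 i));
     exists A => //; rewrite setTI.
apply: smallest_sub; first exact: sigma_algebra_measurable.
rewrite -bigcup_seq; apply: bigcup_sub => i _ B [C mC <-].
exact: mf.
Qed.

Lemma measurable_enorm n : measurable_fun [set: 'rV[R]_n] (@enorm R n).
Proof.
apply: measurableT_comp => //.
  by apply: continuous_measurable_fun; exact: sqrt_continuous.
rewrite /dot; apply: measurable_sum => i.
by apply: measurable_funM; exact: measurable_coord.
Qed.

Lemma measurable_normalize n :
  measurable_fun [set: 'rV[R]_n] (@normalize R n).
Proof.
apply: measurable_fun_rVP => i.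
rewrite (_ : (fun _ => _) = fun x : 'rV[R]_n => enorm x `^ (-1) * x 0 i).
  apply: measurable_funM; last exact: measurable_coord.
  apply: (@measurableT_comp _ _ _ _ _ _ (fun r : R => r `^ (-1))).
    exact: measurable_powR.
  exact: measurable_enorm.
by apply/funext => x; rewrite mxE powR_inv1 ?sqrtr_ge0.
Qed.

(* Prepends a coordinate; identifies R * R^n with R^(n+1). *)
Definition rV_cons n (p : R * 'rV[R]_n) : 'rV[R]_n.+1 :=
  \row_i (if unlift ord0 i is Some j then p.2 0 j else p.1).

Definition rV_uncons n (x : 'rV[R]_n.+1) : R * 'rV[R]_n :=
  (x 0 ord0, \row_j x 0 (lift ord0 j)).

Lemma rV_consK n : cancel (@rV_cons n) (@rV_uncons n).
Proof.
case=> a x; rewrite /rV_uncons mxE unlift_none; congr pair.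
by apply/rowP => j; rewrite !mxE liftK.
Qed.

Lemma measurable_rV_cons n : measurable_fun setT (@rV_cons n).
Proof.
apply: measurable_fun_rVP => i.
case: (unliftP ord0 i) => [j|] ->.
  rewrite (_ : (fun _ => _) = (fun x : 'rV[R]_n => x 0 j) \o snd).
    by apply: measurableT_comp => //; exact: measurable_coord.
  by apply/funext => p; rewrite mxE liftK.
rewrite (_ : (fun _ => _) = fst) //.
by apply/funext => p; rewrite mxE unlift_none.
Qed.

Lemma measurable_rV_uncons n : measurable_fun setT (@rV_uncons n).
Proof.
apply/measurable_fun_pairP; split; first exact: measurable_coord.
apply: measurable_fun_rVP => j.
rewrite (_ : (fun _ => _) = (fun x : 'rV[R]_n.+1 => x 0 (lift ord0 j))).
  exact: measurable_coord.
by apply/funext => x; rewrite mxE.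
Qed.

End rV_measurable_fun.

Section lebesgue_rV.
Context {R : realType}.
Local Open Scope ereal_scope.

Section step.
Context {n : nat} (mu : {sigma_finite_measure set 'rV[R]_n -> \bar R}).

Definition lebesgue_rV_step : set 'rV[R]_n.+1 -> \bar R :=
  pushforward (@lebesgue_measure R \x mu) (@rV_cons R n).

Let step0 : lebesgue_rV_step set0 = 0.
Proof. by apply: measure0; exact: measurable_rV_cons. Qed.

Let step_ge0 A : 0 <= lebesgue_rV_step A.
Proof. by apply: measure_ge0; exact: measurable_rV_cons. Qed.

Let step_sigma_additive : semi_sigma_additive lebesgue_rV_step.
Proof.
by apply: measure_semi_sigma_additive; exact: measurable_rV_cons.
Qed.

HB.instance Definition _ := isMeasure.Build _ _ _ lebesgue_rV_step
  step0 step_ge0 step_sigma_additive.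

Let step_sigma_finite : sigma_finite setT lebesgue_rV_step.
Proof.
have /sigma_finiteP[F [TF ndF Foo]] := sigma_finiteT (@lebesgue_measure R).
have /sigma_finiteP[G [TG ndG Goo]] := sigma_finiteT mu.
exists (fun k => (@rV_uncons R n) @^-1` (F k `*` G k)).
  rewrite -preimage_bigcup predeqE => x; split=> // _.
  have [k _ Fk] : (\bigcup_k F k) (rV_uncons x).1 by rewrite -TF.
  have [l _ Gl] : (\bigcup_k G k) (rV_uncons x).2 by rewrite -TG.
  exists (maxn k l) => //; split => /=.
    by move: Fk; exact/subsetPset/ndF/leq_maxl.
  by move: Gl; exact/subsetPset/ndG/leq_maxr.
move=> k; have [mF Fk] := Foo k; have [mG Gk] := Goo k; split.
  rewrite -[X in measurable X]setTI; apply: measurable_rV_uncons => //.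
  exact: measurableX.
rewrite /lebesgue_rV_step /pushforward -comp_preimage.
rewrite (_ : _ \o _ = id); last by apply/funext => p; exact: rV_consK.
rewrite preimage_id product_measure1E//.
by rewrite lte_mul_pinfty// ge0_fin_numE.
Qed.

HB.instance Definition _ :=
  Measure_isSigmaFinite.Build _ _ _ lebesgue_rV_step step_sigma_finite.

End step.

Fixpoint lebesgue_rV n : {sigma_finite_measure set 'rV[R]_n -> \bar R} :=
  match n with
  | 0%N => \d_(0%R : 'rV[R]_0)
  | m.+1 => lebesgue_rV_step (lebesgue_rV m)
  end.

End lebesgue_rV.
Arguments lebesgue_rV R n : clear implicits.

Section lebesgue_rV_box.
Context {R : realType}.
Local Open Scope ereal_scope.

Lemma lebesgue_rV_box n (A : 'I_n -> set (measurableTypeR R)) :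
  (forall i, measurable (A i)) ->
  lebesgue_rV R n [set x | forall i, A i (x 0%R i)] =
  \big[mule/1]_(i < n) lebesgue_measure (A i).
Proof.
elim: n A => [|n IH] A mA.
  by rewrite big_ord0 /= diracE mem_set// => -[].
rewrite big_ord_recl -IH//= /lebesgue_rV_step /pushforward.
rewrite (_ : _ @^-1` _ =
  A ord0 `*` [set x : 'rV[R]_n | forall i, A (lift ord0 i) (x 0%R i)]).
  rewrite product_measure1E//.
  rewrite (_ : mkset _ = \bigcap_(i in [set: 'I_n])
    ((fun x : 'rV[R]_n => x 0%R i) @^-1` A (lift ord0 i))).
    apply: fin_bigcap_measurable => // i _.
    rewrite -[X in measurable X]setTI.
    by apply: measurable_coord => //; exact: mA.
  by apply/seteqP; split=> x h i; [move=> _; exact: h|exact: (h i)].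
apply/seteqP; split=> -[a x] /=.
  move=> h; split; first by have := h ord0; rewrite mxE unlift_none.
  by move=> i; have := h (lift ord0 i); rewrite mxE liftK.
case=> Aa h i; rewrite mxE; case: unliftP => [j|] -> //; exact: h.
Qed.

End lebesgue_rV_box.

Section surface_measure.
Context {R : realType} (n : nat).
Local Open Scope ereal_scope.

Definition punctured_ball : set 'rV[R]_n := [set x | (0 < enorm x <= 1)%R].

Lemma measurable_punctured_ball : measurable punctured_ball.
Proof.
rewrite (_ : punctured_ball = @enorm R n @^-1` `]0%R, 1%R]%classic).
  rewrite -[X in measurable X]setTI.
  by apply: measurable_enorm => //; exact: measurable_itv.
by apply/seteqP; split=> x /=; rewrite in_itv/=.
Qed.

Definition cone_measure : set 'rV[R]_n -> \bar R :=
  pushforward (mrestr (lebesgue_rV R n) measurable_punctured_ball)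
    (@normalize R n).

Let cone_measure0 : cone_measure set0 = 0.
Proof. by apply: measure0; exact: measurable_normalize. Qed.

Let cone_measure_ge0 A : 0 <= cone_measure A.
Proof. by apply: measure_ge0; exact: measurable_normalize. Qed.

Let cone_measure_sigma_additive : semi_sigma_additive cone_measure.
Proof.
by apply: measure_semi_sigma_additive; exact: measurable_normalize.
Qed.

HB.instance Definition _ := isMeasure.Build _ _ _ cone_measure
  cone_measure0 cone_measure_ge0 cone_measure_sigma_additive.

(* The surface measure on the unit sphere, as given by polar coordinates:
   sigma(A) = n * |{x : 0 < |x| <= 1, x / |x| in A}|. *)
Definition surface_measure : set 'rV[R]_n -> \bar R :=
  mscale (n%:R%:nng : {nonneg R})%R cone_measure.

HB.instance Definition _ := Measure.on surface_measure.

End surface_measure.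
Arguments surface_measure R n : clear implicits.

Section sobolev.
Context {R : realType} {n : nat}.
Implicit Types (f phi : 'rV[R]_n -> R) (g : 'rV[R]_n -> 'rV[R]_n).

Fixpoint Ck k phi : Prop :=
  continuous phi /\
  if k is k'.+1 then
    forall i, (forall x, derivable phi x (delta_mx 0 i)) /\
      Ck k' (fun x => 'D_(delta_mx 0 i) phi x)
  else True.

Definition test_function phi :=
  (forall k, Ck k phi) /\ compact (closure [set x | phi x != 0]).

Definition loc_integrable f :=
  forall A, compact A -> (lebesgue_rV R n).-integrable A (EFin \o f).

Definition weak_gradient f g :=
  [/\ loc_integrable f,
      forall i, loc_integrable (fun x => g x 0 i) &
      forall phi i, test_function phi ->
        \int[lebesgue_rV R n]_x (f x * 'D_(delta_mx 0 i) phi x) =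
        - \int[lebesgue_rV R n]_x (g x 0 i * phi x)].

(* The weak gradient, determined up to a null set when it exists. *)
Definition grad f : 'rV[R]_n -> 'rV[R]_n := get [set g | weak_gradient f g].

Definition sobolev (p : \bar R) f :=
  [/\ f \in Lfun (lebesgue_rV R n) p,
      exists g, weak_gradient f g &
      (fun x => enorm (grad f x)) \in Lfun (lebesgue_rV R n) p].

End sobolev.

Section star_shaped.
Context {R : realType} {n : nat}.
Local Open Scope ereal_scope.
Implicit Types (K L : set 'rV[R]_n) (x : 'rV[R]_n) (q s : R).

Definition star_shaped K :=
  forall x (t : R), K x -> (0 <= t <= 1)%R -> K (t *: x)%R.

Definition gauge K x : \bar R :=
  ereal_inf [set l%:E | l in
    [set l : R | (0 < l)%R /\ [set (l *: y)%R | y in K] x]].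

(* The supremum is taken in [0, +oo], hence the element 0. *)
Definition radial K x : \bar R :=
  ereal_sup (0 |` [set l%:E | l in [set l : R | (0 < l)%R /\ K (l *: x)%R]]).

Definition star_body K :=
  [/\ star_shaped K,
      forall x, x != 0%R -> 0 < radial K x &
      {within [set x | x != 0%R], continuous (radial K)}].

(* Powers on [0, +oo]; for a negative exponent, 0 and +oo are exchanged
   (whereas poweR maps 0 to 0 and +oo to +oo). *)
Definition epow (x : \bar R) (a : R) : \bar R :=
  if (0 <= a)%R then x `^ a else (x `^ (- a))^-1.

Definition dual_mixed_volume q K L : \bar R :=
  (n%:R^-1)%:E * \int[surface_measure R n]_(x in sphere n)
    (epow (gauge K x) (- n%:R + q) * epow (gauge L x) (- q)).

Definition dilation_factor s K L : \bar R :=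
  ereal_sup [set epow (gauge K x) (- s) * epow (gauge L x) s | x in sphere n].

End star_shaped.

(* The polar projection bodies are the sets {N <= 1} where N is the prescribed
   gauge; N is 1-homogeneous. *)
Section polar_projection_bodies.
Context {R : realType} {n : nat}.
Local Open Scope ereal_scope.
Implicit Types (f : 'rV[R]_n -> R) (x xi : 'rV[R]_n) (s p : R).
Local Notation leb := (lebesgue_rV R n).

Definition frac_polar_gauge s p f xi : \bar R :=
  ((p * (1 - s))%:E *
   \int[lebesgue_measure]_(t in `]0%R, +oo[)
     ((t `^ (- p * s - 1))%:E *
      \int[leb]_x (`|f (x + t *: xi) - f x| `^ p)%:E)) `^ (p * s)^-1.

Definition frac_polar_projection s p f := [set xi | frac_polar_gauge s p f xi <= 1].

Definition polar_gauge p f xi : \bar R :=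
  (\int[leb]_x (`|dot (grad f x) xi| `^ p)%:E) `^ p^-1.

Definition polar_projection p f := [set xi | polar_gauge p f xi <= 1].

Definition frac_polar_gauge_oo s f xi : \bar R :=
  (ereal_sup [set (z.2 `^ (- s) * `|f (z.1 + z.2 *: xi) - f z.1|)%:E |
              z in [set: 'rV[R]_n] `*` `]0%R, +oo[]) `^ s^-1.

Definition frac_polar_projection_oo s f :=
  [set xi | frac_polar_gauge_oo s f xi <= 1].

Definition polar_gauge_oo f xi : \bar R :=
  ess_sup leb (fun x => `|dot (grad f x) xi|%:E).

Definition polar_projection_oo f := [set xi | polar_gauge_oo f xi <= 1].

End polar_projection_bodies.

(* Main.v *)
(* A set {N <= 1} with N nonnegative and 1-homogeneous has gauge N, so the
   three statements concern integrals and suprema over the sphere of powers of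
   the gauges.  With rho the radial function of K, write the s-scaled dilation
   factor as M_s, the supremum of q_s = (rho(xi)/t)^s |f(x + t xi) - f(x)| over
   all (xi, x, t).

   (i) For a > M_s, splitting |f(x + t xi) - f(x)|^p with a fixed exponent p0
   gives a bound C p a^p of the dual mixed volume, as the remaining integral
   converges because f is bounded, Lipschitz and integrable.  For a < M_s,
   q_s > a on a product of neighbourhoods, which gives a lower bound c a^p.
   Then take p-th roots.

   (ii) The key fact is that |<grad f, xi>| <= c almost everywhere if and only if
   |f(x + t xi) - f(x)| <= c t for all x and t > 0.  It is obtained by testing
   the weak gradient against smooth bumps, which approximate the indicators of
   boxes: derivatives in s of the integral of f(x) phi(x + s xi) are controlled
   by the mean value theorem, and almost everywhere bounds are read on dyadic
   cubes.  Hence d(K, Pi^*_oo f) = M_1, and the bounds of (i) carry over.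

   (iii) Since |f(x) - f(y)| <= B, one has q_s <= q_1^s B^(1-s), whence
   limsup M_s <= M_1; and s |-> q_s(xi, x, t) is continuous for fixed
   (xi, x, t), whence liminf M_s >= M_1. *)

Require Import Defs.
From HB Require Import structures.
From mathcomp Require Import all_boot all_order all_algebra.
From mathcomp Require Import all_classical all_reals all_analysis.
From mathcomp Require Import ring lra measurable_realfun ess_sup_inf.

Set Implicit Arguments.
Unset Strict Implicit.
Unset Printing Implicit Defensive.

Import Order.TTheory GRing.Theory Num.Theory.
Import numFieldNormedType.Exports.

Local Open Scope classical_set_scope.
Local Open Scope ring_scope.

(** The gradient is known only through integrals against test functions. Pointwise information is
    recovered from dyadic sets: they approximate every measurable set in measure, so a function with
    nonnegative integral over every cube is nonnegative almost everywhere. In (i) one exponent p0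
    has to serve both ends of the integral in t. With p0 - 1 factors of the increment, the Lipschitz
    bound gives the order t^(p0 (1 - s) - 2) near 0 and the bound on f gives t^(-p0 s - 1) at
    infinity; p0 = 2/(1 - s) + 1/s suits both. One more factor |f(x + t xi) - f(x)| is kept for the
    integral in x, and the other p - p0 factors produce a^p. In (ii) the null set where |<grad f,
    xi>| <= c fails depends on xi. A lower bound in one direction is spread to the nearby ones by
    restricting to points where the gradient is bounded by some k, since <grad f, xi> is k-Lipschitz
    in xi there. Over the sphere, the energies are only compared with constants, by monotonicity of
    the integral of nonnegative functions, so their measurability in xi is never at stake. *)

(** * Comparison of integrals with constants *)

Section integral_monotone.
Local Open Scope ereal_scope.
Context d (T : measurableType d) (R : realType) (mu : {measure set T -> \bar R}).

(* No measurability is needed: the integral of a nonnegative function is the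
   supremum of the integrals of the simple functions below it. *)
Lemma ge0_le_integral_nomeas (D : set T) (f g : T -> \bar R) :
  (forall x, D x -> 0 <= f x) -> (forall x, D x -> f x <= g x) ->
  \int[mu]_(x in D) f x <= \int[mu]_(x in D) g x.
Proof.
move=> f0 fg.
have g0 x : D x -> 0 <= g x by move=> Dx; exact: le_trans (f0 _ Dx) (fg _ Dx).
rewrite ge0_integralE// ge0_integralE//.
apply: le_ereal_sup => _ /= [h hf <-]; exists h => //= x.
apply: le_trans (hf x) _; rewrite /patch; case: ifPn => // /set_mem; exact: fg.
Qed.

Lemma ge0_integral_lb (D E : set T) (f : T -> \bar R) (c : R) :
  measurable E -> E `<=` D -> (0 <= c)%R ->
  (forall x, D x -> 0 <= f x) -> (forall x, E x -> c%:E <= f x) ->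
  c%:E * mu E <= \int[mu]_(x in D) f x.
Proof.
move=> mE ED c0 f0 cf.
rewrite -integral_cst// [leLHS]integral_mkcond [leRHS]integral_mkcond.
apply: ge0_le_integral_nomeas => x _; rewrite /patch.
  by case: ifPn => //; rewrite lee_fin.
case: ifPn => [/set_mem xE|_]; first by rewrite mem_set ?cf//; exact: ED.
by case: ifPn => // /set_mem /f0.
Qed.

Lemma ge0_integral_ub (D : set T) (f : T -> \bar R) (c : R) :
  measurable D ->
  (forall x, D x -> 0 <= f x) -> (forall x, D x -> f x <= c%:E) ->
  \int[mu]_(x in D) f x <= c%:E * mu D.
Proof.
by move=> mD f0 fc; rewrite -integral_cst//; exact: ge0_le_integral_nomeas.
Qed.

End integral_monotone.

(** * Dyadic cubes and measurability of continuous functions *)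

Section dyadic.
Context {R : realType} {n : nat}.
Implicit Types x y : 'rV[R]_n.

Definition dyadic (k : nat) x : 'rV[int]_n := \row_i Num.floor (2 ^+ k * x 0 i).

(** The labels of cubes form a countable type, so the preimage is a countable union of cubes, each a
    finite intersection of coordinate slabs. *)
Lemma measurable_dyadic_preimage k (S : set 'rV[int]_n) :
  measurable (dyadic k @^-1` S).
Proof.
have -> : dyadic k @^-1` S = \bigcup_(z in S) (dyadic k @^-1` [set z]).
  by apply/seteqP; split=> [x Sx|x [z Sz /= ->]//]; exists (dyadic k x).
rewrite bigcup_mkcond; apply: countable_bigcupT_measurable => [|z].
  exact: countableP.
case: ifPn => // _.
rewrite (_ : _ @^-1` _ = \bigcap_(i in [set: 'I_n])
   ((fun x : 'rV[R]_n => x 0 i) @^-1` ((fun t : R => 2 ^+ k * t) @^-1`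
     `[(z 0 i)%:~R, (z 0 i + 1)%:~R[%classic))).
  apply: fin_bigcap_measurable => // i _.
  rewrite -[X in measurable X]setTI; apply: measurable_coord => //.
  rewrite -[X in measurable X]setTI.
  have /(_ measurableT) : measurable_fun setT (fun t : R => 2 ^+ k * t).
    exact: measurable_funM.
  by apply; exact: measurable_itv.
apply/seteqP; split=> x /=.
  move=> <- i _ /=; rewrite in_itv/= mxE -floor_eq//.
move=> h; apply/rowP => i; rewrite mxE; apply/eqP.
by rewrite floor_eq; have := h i I; rewrite /= in_itv.
Qed.

Lemma dyadicS k x y : dyadic k.+1 x = dyadic k.+1 y -> dyadic k x = dyadic k y.
Proof.
move=> /rowP xy; apply/rowP => i; have := xy i; rewrite !mxE => {}xy.
(* A floor is determined by the integers below it, and [m] lies below at level [k] exactly when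
   [2 * m] does at level [k.+1]. *)
have E (u : R) m : (m <= Num.floor (2 ^+ k * u)) =
    (2 * m <= Num.floor (2 ^+ k.+1 * u)).
  rewrite !floor_ge_int exprS -mulrA intrM ler_pM2l//.
by apply/eqP; rewrite eq_le !E -xy -E lexx/= xy -E lexx.
Qed.

Lemma dyadicW k l x y : (k <= l)%N ->
  dyadic l x = dyadic l y -> dyadic k x = dyadic k y.
Proof.
move=> /subnK <-; elim: (l - k)%N => [//|j IH].
by rewrite addSn => /dyadicS.
Qed.

Definition round (k : nat) x : 'rV[R]_n :=
  \row_i ((dyadic k x 0 i)%:~R / 2 ^+ k).

Lemma round_itv k x i : round k x 0 i <= x 0 i < round k x 0 i + (2 ^+ k)^-1.
Proof.
rewrite !mxE -[X in _ / _ + X]mul1r -mulrDl ler_pdivrMr ?exprn_gt0//.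
rewrite ltr_pdivlMr ?exprn_gt0// mulrC floor_le/=.
by have := floorD1_gt (x 0 i * 2 ^+ k); rewrite intrD mulr1z.
Qed.

Lemma cvg_round x : round k x @[k --> \oo] --> x.
Proof.
apply/cvg_ballP => e e0.
have : ((2 ^+ k)^-1 : R) @[k --> \oo] --> 0.
  by rewrite (_ : (fun _ => _) = GRing.exp 2^-1);
    [apply: cvg_expr; rewrite ger0_norm ?invf_lt1 ?ltr1n|
     apply/funext => k; rewrite exprVn].
move=> /cvgrPdist_lt/(_ _ e0); apply: filterS => k; rewrite sub0r normrN.
rewrite ger0_norm ?invr_ge0 ?exprn_ge0// => ke.
split=> // i j; rewrite ord1; have /andP[h1 h2] := round_itv k x j.
rewrite /ball/= ltr_norml; apply/andP; split; lra.
Qed.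

(** The sigma-algebra is given by the coordinates and not by the open sets. Measurability comes from
    writing [f] as the pointwise limit of [f (round k x)], which factors through the countable set
    of labels. *)
Lemma continuous_measurable_rV (f : 'rV[R]_n -> R) :
  continuous f -> measurable_fun setT f.
Proof.
move=> cf; apply: (@measurable_fun_cvg _ _ _ _ (fun k x => f (round k x))).
  move=> k _ Y mY; rewrite setTI.
  pose g (z : 'rV[int]_n) : 'rV[R]_n := \row_i ((z 0 i)%:~R / 2 ^+ k).
  rewrite (_ : _ @^-1` _ = dyadic k @^-1` ((f \o g) @^-1` Y)) //.
  exact: measurable_dyadic_preimage.
by move=> x _; apply: continuous_cvg; [exact: cf|exact: cvg_round].
Qed.

End dyadic.

(** * Lebesgue measure: balls, null sets, translations *)

Section lebesgue_rV_properties.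
Context {R : realType}.
Local Open Scope ereal_scope.

Lemma ball_rVE n (x : 'rV[R]_n) (e : R) : (0 < e)%R ->
  ball x e = [set y | forall i, `](x 0%R i - e)%R, (x 0%R i + e)%R[%classic (y 0%R i)].
Proof.
move=> e0; apply/seteqP; split=> y /=.
  by move=> [_ h] i; have := h ord0 i; rewrite /ball/= in_itv/= ltr_distlC.
move=> h; split=> // i j; rewrite ord1 /ball/=.
by have := h j; rewrite /= in_itv/= ltr_distlC.
Qed.

(** [ball] refers to the sup norm, so it is a cube of side 2e. *)
Lemma lebesgue_rV_ball n (x : 'rV[R]_n) (e : R) : (0 < e)%R ->
  lebesgue_rV R n (ball x e) = ((e *+ 2) ^+ n)%:E.
Proof.
move=> e0; rewrite ball_rVE//.
rewrite (lebesgue_rV_box (A := fun i => `](x 0%R i - e)%R, (x 0%R i + e)%R[%classic)); last first.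
  by move=> i; exact: measurable_itv.
rewrite (eq_bigr (fun=> (e *+ 2)%:E)) => [|i _].
  by rewrite prodEFin prodr_const card_ord.
rewrite lebesgue_measure_itv/= lte_fin.
rewrite (_ : (_ < _)%R = true); last by lra.
by rewrite -EFinB; congr EFin; rewrite mulr2n; ring.
Qed.

Lemma measurable_ball_rV n (x : 'rV[R]_n) (e : R) : measurable (ball x e : set 'rV[R]_n).
Proof.
have [e0|e0] := ltP 0%R e; last first.
  rewrite (_ : ball x e = set0)//; apply/seteqP; split=> y //= -[].
  by rewrite ltNge e0.
rewrite ball_rVE//.
rewrite (_ : (fun _ => _) = \bigcap_(i in [set: 'I_n])
    ((fun y : 'rV[R]_n => y 0%R i) @^-1` `](x 0%R i - e)%R, (x 0%R i + e)%R[)).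
  apply: fin_bigcap_measurable => // i _.
  rewrite -[X in measurable X]setTI.
  by apply: measurable_coord => //; exact: measurable_itv.
by apply/seteqP; split=> y h i; [move=> _; exact: h|exact: (h i)].
Qed.

Lemma lebesgue_rV_nbhs n (x : 'rV[R]_n) (A : set 'rV[R]_n) : measurable A ->
  nbhs x A -> 0 < lebesgue_rV R n A.
Proof.
move=> mA /nbhs_ballP[e /= e0 eA].
apply: (@lt_le_trans _ _ (lebesgue_rV R n (ball x e))).
  by rewrite lebesgue_rV_ball// lte_fin exprn_gt0// mulrn_wgt0.
by apply: le_measure; rewrite ?inE//; exact: measurable_ball_rV.
Qed.

(** A null set contains no ball, since balls have positive measure. This is how almost everywhere
    bounds on a continuous function become bounds everywhere. *)
Lemma ae_nbhs n (x : 'rV[R]_n) (P : set 'rV[R]_n) (A : set 'rV[R]_n) :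
  {ae lebesgue_rV R n, forall y, P y} -> nbhs x A -> exists2 y, A y & P y.
Proof.
move=> [N [mN N0 PN]] xA; apply: contrapT => h.
move: xA => /nbhs_ballP[e /= e0 eA].
have : 0 < lebesgue_rV R n (ball x e).
  by apply: (@lebesgue_rV_nbhs _ x); [exact: measurable_ball_rV|exact: nbhsx_ballx].
rewrite -[ltLHS]N0 ltNge le_measure ?inE//; first exact: measurable_ball_rV.
by move=> y /eA Ay; apply: PN => /= Py; apply: h; exists y.
Qed.

(** The translated measure has the right values on half-open intervals, and these determine Lebesgue
    measure. *)
Lemma lebesgue_measure_translate (c : R) (A : set R) : measurable A ->
  pushforward lebesgue_measure (fun t : measurableTypeR R => t + c : measurableTypeR R)%R A = lebesgue_measure A.
Proof.
move=> mA; have mf : measurable_fun setT (fun t : measurableTypeR R => t + c : measurableTypeR R)%R.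
  exact: measurable_funD.
pose F : {mfun measurableTypeR R >-> measurableTypeR R} := HB.pack (fun t : measurableTypeR R => t + c : measurableTypeR R)%R (isMeasurableFun.Build _ _ _ _ _ mf).
apply/esym/(lebesgue_measure_unique (mu := pushforward lebesgue_measure F)) => //.
move=> _ [[a b]] _ <-.
transitivity (lebesgue_measure `](a - c)%R, (b - c)%R]%classic).
  rewrite !lebesgue_measure_itv/= !lte_fin ltrD2r.
  by rewrite -!EFinB opprB addrA subrK.
congr (lebesgue_measure _).
by apply/seteqP; split=> t /=; rewrite !in_itv/= ltrBlDr lerBrDr.
Qed.

Lemma measurable_translate n (v : 'rV[R]_n) :
  measurable_fun setT (fun x : 'rV[R]_n => x + v)%R.
Proof.
apply: measurable_fun_rVP => i; under eq_fun do rewrite mxE.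
by apply: measurable_funD => //; exact: measurable_coord.
Qed.

(** By induction on the dimension: the section over [t] of the translated set is a translate of the
    section of [A] over [t + v 0 ord0], and the outer integral is translation invariant in one
    variable. *)
Lemma lebesgue_rV_translate n (v : 'rV[R]_n) (A : set 'rV[R]_n) : measurable A ->
  lebesgue_rV R n ((fun x => x + v)%R @^-1` A) = lebesgue_rV R n A.
Proof.
elim: n v A => [|n IH] v A mA.
  congr (_ _); apply/seteqP; split=> x /=; first by rewrite [(x + v)%R](thinmx0 _) [x]thinmx0.
  by rewrite [(x + v)%R](thinmx0 _) [x]thinmx0.
have mB : measurable (@rV_cons R n @^-1` A).
  by rewrite -[X in measurable X]setTI; exact: measurable_rV_cons.
rewrite /= /lebesgue_rV_step /pushforward /product_measure1 /=.
set B := _ @^-1` A in mB *.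
pose v' : 'rV[R]_n := (\row_j v 0 (lift ord0 j))%R.
have E t x : (rV_cons (t, x) + v = rV_cons ((t + v 0 ord0)%R, (x + v')%R))%R.
  apply/rowP => i; rewrite !mxE; case: (unliftP ord0 i) => [j|] -> /=;
    by rewrite ?liftK ?unlift_none ?mxE.
transitivity (\int[lebesgue_measure]_t (lebesgue_rV R n (xsection B (t + v 0 ord0)%R))).
  apply: eq_integral => t _; rewrite /= -[RHS](IH v').
    by congr (_ _); apply/seteqP; split=> x; rewrite /xsection/= !inE /B/= E.
  exact: measurable_xsection.
pose g t := lebesgue_rV R n (xsection B t).
pose sh (t : measurableTypeR R) : measurableTypeR R := (t + v 0 ord0)%R.
have msh : measurable_fun setT sh by exact: measurable_funD.
have mg : measurable_fun setT g by exact: measurable_fun_xsection.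
have /= <- := ge0_integral_pushforward msh lebesgue_measure measurableT mg.
  by apply: eq_measure_integral => C mC _; exact: lebesgue_measure_translate.
by move=> t _; exact: measure_ge0.
Qed.

Lemma ge0_integral_translate n (v : 'rV[R]_n) (f : 'rV[R]_n -> \bar R) :
  measurable_fun setT f -> (forall x, 0 <= f x) ->
  \int[lebesgue_rV R n]_x f (x + v)%R = \int[lebesgue_rV R n]_x f x.
Proof.
move=> mf f0.
have /= <- := ge0_integral_pushforward (measurable_translate v)
  (lebesgue_rV R n) measurableT mf; last by move=> x _.
apply: eq_measure_integral => [|mt C mC _]; first exact: measurable_translate.
exact: lebesgue_rV_translate.
Qed.

Lemma integrable_translate n (v : 'rV[R]_n) (f : 'rV[R]_n -> \bar R) :
  (lebesgue_rV R n).-integrable setT f ->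
  (lebesgue_rV R n).-integrable setT (fun x => f (x + v)%R).
Proof.
move=> /integrableP[mf f_fin]; apply/integrableP; split.
  by apply: measurableT_comp => //; exact: measurable_translate.
rewrite (ge0_integral_translate v (f := fun x => `|f x|))//.
exact: measurableT_comp.
Qed.

Lemma integral_translate n (v : 'rV[R]_n) (f : 'rV[R]_n -> \bar R) :
  measurable_fun setT f ->
  \int[lebesgue_rV R n]_x f (x + v)%R = \int[lebesgue_rV R n]_x f x.
Proof.
move=> mf; rewrite integralE [RHS]integralE; congr (_ - _).
  rewrite -(ge0_integral_translate v (f := f^\+)%E) //; last exact: measurable_funepos.
  by apply: eq_integral => x _; rewrite !funeposE.
rewrite -(ge0_integral_translate v (f := f^\-)%E) //; last exact: measurable_funeneg.
by apply: eq_integral => x _; rewrite !funenegE.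
Qed.

End lebesgue_rV_properties.

(* Membership in a preimage under [dyadic k] only depends on the dyadic cube of
   side [2 ^- k], so these sets form an algebra. *)
Definition dyadic_set {R : realType} {n : nat} (D : set 'rV[R]_n) :=
  exists k, forall x y, dyadic k x = dyadic k y -> D x -> D y.

(** * Approximation of measurable sets by dyadic sets *)

Section dyadic_approximation.
Context {R : realType} {n : nat}.
Local Open Scope ereal_scope.
Local Notation mu := (lebesgue_rV R n).
Implicit Types A C D : set 'rV[R]_n.

Lemma dyadic_setE k D : (forall x y, dyadic k x = dyadic k y -> D x -> D y) ->
  D = dyadic k @^-1` (dyadic k @` D).
Proof.
by move=> h; apply/seteqP; split=> [x Dx|x [y Dy /esym]]; [exists x|move=> /esym/h; exact].
Qed.

Lemma measurable_dyadic_set D : dyadic_set D -> measurable D.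
Proof. by move=> [k /dyadic_setE ->]; exact: measurable_dyadic_preimage. Qed.

Lemma dyadic_setC D : dyadic_set D -> dyadic_set (~` D).
Proof. by move=> [k h]; exists k => x y xy /= nDx Dy; apply: nDx; exact: h Dy. Qed.

Lemma dyadic_setU D D' : dyadic_set D -> dyadic_set D' -> dyadic_set (D `|` D').
Proof.
move=> [k h] [k' h']; exists (maxn k k') => x y xy /= [Dx|Dx].
  by left; apply: h Dx; apply: dyadicW xy; exact: leq_maxl.
by right; apply: h' Dx; apply: dyadicW xy; exact: leq_maxr.
Qed.

(** Approximation in the measure of the symmetric difference, localized to [C]. Measurability is
    carried along so that the closure properties below can manipulate these measures. *)
Definition dyadic_approx C A := measurable A /\ forall e : R, (0 < e)%R ->
  exists2 D, dyadic_set D & mu (C `&` (A `+` D)) < e%:E.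

Variable C : set 'rV[R]_n.
Hypotheses (mC : measurable C) (Cfin : mu C < +oo).

Let mY A D : measurable A -> measurable D -> measurable (C `&` (A `+` D)).
Proof.
by move=> mA mD; apply: measurableI => //; apply: measurableU; exact: measurableD.
Qed.

Lemma dyadic_approx_set D : dyadic_set D -> dyadic_approx C D.
Proof.
move=> hD; split; first exact: measurable_dyadic_set.
by move=> e e0; exists D => //; rewrite setYK setI0 measure0 lte_fin.
Qed.

Lemma dyadic_approxC A : dyadic_approx C A -> dyadic_approx C (~` A).
Proof.
move=> [mA h]; split; first exact: measurableC.
move=> e /h[D hD De]; exists (~` D); first exact: dyadic_setC.
rewrite (_ : ~` A `+` ~` D = A `+` D)//; apply/seteqP; split=> x /=.
  by move=> [[nA /contrapT Dx]|[nD /contrapT Ax]]; [right|left].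
by move=> [[Ax nD]|[Dx nA]]; [right|left]; split=> // /(_ _); exact.
Qed.

Lemma dyadic_approxU A B : dyadic_approx C A -> dyadic_approx C B ->
  dyadic_approx C (A `|` B).
Proof.
move=> [mA hA] [mB hB]; split; first exact: measurableU.
move=> e e0; have e2 : (0 < e / 2)%R by rewrite divr_gt0.
have [D hD De] := hA _ e2; have [D' hD' De'] := hB _ e2.
exists (D `|` D'); first exact: dyadic_setU.
rewrite [e]splitr EFinD; apply: le_lt_trans (lteD De De').
have mD := measurable_dyadic_set hD; have mD' := measurable_dyadic_set hD'.
apply: (@le_trans _ _ (mu ((C `&` (A `+` D)) `|` (C `&` (B `+` D'))))).
  apply: le_measure; rewrite ?inE.
  - by apply: mY; exact: measurableU.
  - by apply: measurableU; exact: mY.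
  - by move=> x /=; tauto.
by apply: measureU2; exact: mY.
Qed.

(** Finite unions are approximable, and since [C] has finite measure, the part of the union missed
    by the first N sets has measure tending to 0. *)
Lemma dyadic_approx_bigcup (F : (set 'rV[R]_n)^nat) :
  (forall i, dyadic_approx C (F i)) -> dyadic_approx C (\bigcup_i F i).
Proof.
move=> hF; have mF i : measurable (F i) by have [] := hF i.
have mFF : measurable (\bigcup_i F i) by exact: bigcupT_measurable.
split=> // e e0; have e2 : (0 < e / 2)%R by rewrite divr_gt0.
pose U N := \bigcup_(i in [set i | (i < N)%N]) F i.
have hU N : dyadic_approx C (U N).
  rewrite /U; elim: N => [|N IH].
    rewrite (_ : \bigcup_(i in _) _ = set0); last by apply/seteqP; split=> x // [].
    by apply: dyadic_approx_set; exists 0%N => x y _ [].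
  rewrite (_ : \bigcup_(i in _) _ = (\bigcup_(i in [set i | (i < N)%N]) F i) `|` F N).
    exact: dyadic_approxU.
  apply/seteqP; split=> x /=.
    by move=> [i /=]; rewrite ltnS leq_eqVlt => /orP[/eqP->|iN] Fx; [right|left; exists i].
  by move=> [[i /= iN] Fx|Fx]; [exists i => //=; exact: ltnW|exists N => /=].
have mU N : measurable (U N) by have [] := hU N.
pose V N := C `&` (\bigcup_i F i `\` U N).
have mV N : measurable (V N).
  by apply: measurableI => //; apply: measurableD.
have V0 : \bigcap_N V N = set0.
  apply/seteqP; split=> x // h; have [_ [[i _ Fx] _]] := h 0%N I.
  by have [_ [_]] := h i.+1 I; apply; exists i => /=.
have : mu (V N) @[N --> \oo] --> mu (\bigcap_N V N).
  apply: nonincreasing_cvg_mu => //.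
  - by apply: le_lt_trans Cfin; apply: le_measure; rewrite ?inE// => x [].
  - by rewrite V0; exact: measurable0.
  - move=> i j ij; apply/subsetPset => x [Cx [Fx nU]]; split => //; split => //.
    by move=> [m /= mi Fm]; apply: nU; exists m => //=; exact: leq_trans ij.
rewrite V0 measure0 => /fine_cvgP[fV /cvgrPdist_lt/(_ _ e2) lV].
near \oo => N.
have VN : mu (V N) < (e / 2)%:E.
  have fVN : mu (V N) \is a fin_num by near: N; exact: fV.
  rewrite -(fineK fVN) lte_fin.
  rewrite -[ltLHS]ger0_norm ?fine_ge0// -normrN -sub0r.
  by near: N.
have [D hD De] := (hU N).2 _ e2; have mD := measurable_dyadic_set hD.
exists D => //; rewrite [e]splitr EFinD; apply: le_lt_trans (lteD VN De).
apply: (@le_trans _ _ (mu (V N `|` (C `&` (U N `+` D))))).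
  apply: le_measure; rewrite ?inE.
  - exact: mY.
  - by apply: measurableU => //; exact: mY.
  - move=> x /= [Cx [[Fx nD]|[Dx nF]]].
      by have [Ux|nU] := pselect (U N x); [right; split => //; left|left].
    right; split => //; right; split => //.
    by move=> [i _ Fi]; apply: nF; exists i.
by apply: measureU2 => //; exact: mY.
Unshelve. all: by end_near. Qed.

Lemma measurable_dyadic_approx A : measurable A -> dyadic_approx C A.
Proof.
move: A; apply: smallest_sub; first split.
- by apply: dyadic_approx_set; exists 0%N.
- by move=> A hA; rewrite setTD; exact: dyadic_approxC.
- exact: dyadic_approx_bigcup.
rewrite -bigcup_seq; apply: bigcup_sub => i _ _ [Y mY' <-]; rewrite setTI.
have : [set Y : set (measurableTypeR R) | measurable Y] Y by [].
(* Second induction, over the open rays that generate the Borel sets of the line. *)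
rewrite [measurable](@RGenOInfty.measurableE R).
move: Y {mY'}; apply: smallest_sub; first split.
- by rewrite preimage_set0; apply: dyadic_approx_set; exists 0%N.
- move=> Y hY; rewrite setTD preimage_setC; exact: dyadic_approxC.
- by move=> G hG; rewrite preimage_bigcup; exact: dyadic_approx_bigcup.
move=> _ [a ->].
(* Rounding goes downwards with an error below 2^-k, so x_i > a exactly when some rounding exceeds
   a; at level [k] this condition only sees the cube of [x]. *)
rewrite (_ : _ @^-1` _ = \bigcup_k [set x | (a < round k x 0 i)%R]).
  apply: dyadic_approx_bigcup => k; apply: dyadic_approx_set; exists k => x y xy /=.
  by rewrite /round xy.
apply/seteqP; split=> x /=; rewrite in_itv/= andbT.
  move=> ax; have : ((2 ^+ k)^-1 : R)%R @[k --> \oo] --> (0 : R)%R.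
    rewrite (_ : (fun _ => _) = GRing.exp 2^-1)%R.
      by apply: cvg_expr; rewrite ger0_norm ?invf_lt1 ?ltr1n.
    by apply/funext => k; rewrite exprVn.
  have e0 : (0 < x 0%R i - a)%R by rewrite subr_gt0.
  move=> /cvgrPdist_lt/(_ _ e0)[N _ /(_ N)/=]; rewrite leqnn => /(_ isT).
  rewrite sub0r normrN ger0_norm ?invr_ge0 ?exprn_ge0// => h.
  exists N => //=; have /andP[_] := round_itv N x i; lra.
by move=> [k _ /=] /lt_le_trans; apply; have /andP[] := round_itv k x i.
Qed.

End dyadic_approximation.

(** * Functions with nonnegative integrals over dyadic cubes *)

Section ae_ge0.
Context {R : realType} {n : nat}.
Local Open Scope ereal_scope.
Local Notation mu := (lebesgue_rV R n).
Local Notation cube k z := (@dyadic R n k @^-1` [set z]).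

Lemma lebesgue_rV_unit_cube (z : 'rV[int]_n) : mu (cube 0 z) < +oo.
Proof.
pose c : 'rV[R]_n := \row_i (z 0 i)%:~R.
apply: (@le_lt_trans _ _ (mu (ball c 2%R))); last first.
  by rewrite lebesgue_rV_ball// ltry.
apply: le_measure; rewrite ?inE; [exact: measurable_dyadic_preimage|exact: measurable_ball_rV|].
move=> x /= xz; rewrite ball_rVE//= => i; rewrite in_itv/= mxE -xz mxE expr0 mul1r.
have := floor_le (x 0%R i); have := floorD1_gt (x 0%R i); rewrite intrD mulr1z; lra.
Qed.

(** At the level of [D], a cube that meets [D] lies inside it, so countable additivity writes the
    integral as a sum of nonnegative terms. *)
Lemma integral_dyadic_ge0 (w : 'rV[R]_n -> R) (D : set 'rV[R]_n) :
  mu.-integrable D (EFin \o w) ->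
  (forall k z, 0 <= \int[mu]_(x in cube k z) (w x)%:E) ->
  dyadic_set D -> 0 <= \int[mu]_(x in D) (w x)%:E.
Proof.
move=> iw w0 [k Dk].
(* [pickle_inv] decodes each label from a single code, which keeps the pieces disjoint. *)
pose F m := if @pickle_inv 'rV[int]_n m is Some z then cube k z `&` D else set0.
have DE : D = \bigcup_m F m.
  apply/seteqP; split=> x.
    by move=> Dx; exists (pickle (dyadic k x)) => //; rewrite /F pickleK_inv.
  by move=> [m _]; rewrite /F; case: pickle_inv => // z [].
have mD : measurable D by apply: measurable_dyadic_set; exists k.
have mF m : measurable (F m).
  rewrite /F; case: pickle_inv => // z; apply: measurableI => //.
  exact: measurable_dyadic_preimage.
rewrite {1}DE integral_bigcup//; last by rewrite -DE.
  apply: nneseries_ge0 => m _ _; rewrite /F; case E : pickle_inv => [z|]; last by rewrite integral_set0.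
  have [->|/set0P[x [/= xz Dx]]] := eqVneq (cube k z `&` D) set0; first by rewrite integral_set0.
  rewrite setIidl// => y /= yz; apply: Dk Dx; by rewrite xz.
apply/trivIsetP => i j _ _ ij; apply/seteqP; split=> // x [].
rewrite /F; case Ei : pickle_inv => [z|//]; case Ej : pickle_inv => [z'|//] [/= xz _] [/= xz' _].
move: ij; have := @pickle_invK 'rV[int]_n i; have := @pickle_invK 'rV[int]_n j.
by rewrite Ei Ej /= => <- <-; rewrite -xz -xz' eqxx.
Qed.

(** In a unit cube [C], the set [A] where w < 0 is close in measure to a dyadic set, over which the
    integral is nonnegative. By absolute continuity the integral over [A] is nonnegative too, and as
    w < 0 there, [A] is null. *)
Lemma ae_ge0_dyadic (w : 'rV[R]_n -> R) :
  (forall k z, mu.-integrable (cube k z) (EFin \o w)) ->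
  (forall k z, 0 <= \int[mu]_(x in cube k z) (w x)%:E) ->
  {ae mu, forall x, (0 <= w x)%R}.
Proof.
move=> iw w0.
suff h (z : 'rV[int]_n) : mu (cube 0 z `&` [set x | (w x < 0)%R]) = 0 /\
    measurable (cube 0 z `&` [set x | (w x < 0)%R]).
  pose F m := if unpickle m is Some z then cube 0 z `&` [set x | (w x < 0)%R] else set0.
  suff : mu.-negligible (~` [set x | (0 <= w x)%R]) by [].
  apply: (@negligibleS _ _ _ _ (\bigcup_m F m)).
    move=> x /= /negP; rewrite -ltNge => wx.
    by exists (pickle (dyadic 0 x)) => //; rewrite /F pickleK.
  apply: negligible_bigcup => m; rewrite /F; case: unpickle => [z|].
    by have [h0 mz] := h z; exists (cube 0 z `&` [set x | (w x < 0)%R]); split.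
  exact: negligible_set0.
set C := cube 0 z; have mC : measurable C by exact: measurable_dyadic_preimage.
have Cfin : mu C < +oo by exact: lebesgue_rV_unit_cube.
have iC : mu.-integrable C (EFin \o w) by exact: iw.
have mw : measurable_fun C w by apply/measurable_EFinP; exact: measurable_int iC.
set A := C `&` _.
have mA : measurable A.
  rewrite (_ : A = C `&` w @^-1` `]-oo, 0%R[).
    by apply: mw => //; exact: measurable_itv.
  by apply/seteqP; split=> x /= []; rewrite in_itv/=.
split => //.
have AC : A `<=` C by move=> x [].
have iS S : measurable S -> S `<=` C -> mu.-integrable S (EFin \o w).
  by move=> mS SC; exact: integrableS iC.
pose wC : 'rV[R]_n -> R := (w \_ C)%R.
have iwC : mu.-integrable setT (EFin \o wC).
  by rewrite /wC -restrict_EFin; apply/integrable_restrict => //; rewrite setTI.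
have small (e : R) : (0 < e)%R -> exists2 d : R, (0 < d)%R & forall S, measurable S ->
    S `<=` C -> mu S < d%:E -> (`| \int[mu]_(x in S) w x | < e)%R.
  move=> /(integral_normr_continuous iwC)[d [d0 h]]; exists d => // S mS SC Sd.
  apply: le_lt_trans (h S mS Sd).
  apply: le_trans (le_normr_Rintegral _ _) _ => //; first exact: iS.
  rewrite [leLHS](_ : _ = \int[mu]_(x in S) `|wC x|)%R//.
  apply: eq_Rintegral => x /set_mem Sx; rewrite /wC /patch mem_set//; exact: SC.
have RA : (0 <= \int[mu]_(x in A) w x)%R.
  apply/ler_addgt0Pr => e e0; have e2 : (0 < e / 2)%R by rewrite divr_gt0.
  have [d d0 hd] := small _ e2.
  have [D hD De] := (measurable_dyadic_approx mC Cfin mA).2 _ d0.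
  have mD := measurable_dyadic_set hD.
  have CD0 : (0 <= \int[mu]_(x in C `&` D) w x)%R.
    apply: fine_ge0; apply: integral_dyadic_ge0 => //.
      by apply: iS; [exact: measurableI|exact: subIsetl].
    move: hD => [k Dk]; exists k => x y xy [Cx Dx]; split; last exact: Dk Dx.
    by rewrite /C /= -Cx; apply/esym; exact: dyadicW xy.
  have spl S S' : measurable S -> measurable S' -> S `<=` C ->
      (\int[mu]_(x in S) w x = \int[mu]_(x in S `&` S') w x + \int[mu]_(x in S `\` S') w x)%R.
    move=> mS mS' SC; rewrite -Rintegral_setU//.
    - by rewrite setUIDK.
    - exact: measurableI.
    - exact: measurableD.
    - by rewrite setUIDK; exact: iS.
    - by apply/disj_setPS => x [[_ ?] [_ ?]].
  have mCD : measurable (C `&` D) by exact: measurableI.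
  have sm S : measurable S -> S `<=` C `&` (A `+` D) -> (`| \int[mu]_(x in S) w x | < e / 2)%R.
    move=> mS SE; apply: hd => //; first by move=> x /SE[].
    apply: le_lt_trans De; apply: le_measure; rewrite ?inE//.
    by apply: measurableI => //; apply: measurableU; exact: measurableD.
  have h1 : (`| \int[mu]_(x in A `\` D) w x | < e / 2)%R.
    apply: sm; first exact: measurableD.
    by move=> x [Ax nD]; split; [exact: AC|left].
  have h2 : (`| \int[mu]_(x in (C `&` D) `\` A) w x | < e / 2)%R.
    apply: sm; first exact: measurableD.
    by move=> x [[Cx Dx] nA]; split => //; right.
  (* The integrals over [A] and over the intersection of [C] and [D] share a common part, and what
     remains of each is below e/2 in absolute value. *)
  have s1 := spl A D mA mD AC.
  have := spl (C `&` D) A mCD mA (@subIsetl _ _ _).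
  rewrite (_ : C `&` D `&` A = A `&` D); last first.
    by apply/seteqP; split=> x /= []; [move=> [? ?] ?|move=> Ax Dx; have := AC _ Ax].
  move: h1 h2; rewrite !ltr_norml => /andP[? ?] /andP[? ?] s2; lra.
(* On [A] one has |w| = -w, whose integral is at most 0 by [RA]. *)
have : \int[mu]_(x in A) `|(w x)%:E| = 0.
  have iA : mu.-integrable A (EFin \o w) by exact: iS.
  rewrite (eq_integral (fun x => - (w x)%:E)); last first.
    move=> x /set_mem [_ /= wx]; rewrite ltr0_norm//.
  rewrite integralN/=; last first.
    apply: integrable_add_def => //; exact: iA.
  apply/eqP; rewrite eq_le; apply/andP; split.
    by rewrite leeNl oppe0 -(fineK (integrable_fin_num _ iA))// lee_fin.
  rewrite leeNr oppe0; rewrite -[leRHS]oppe0 leeNr.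
  rewrite -integralN; last by apply: integrable_add_def.
  by apply: integral_ge0 => x [_ /= wx]; rewrite lee_fin oppr_ge0 ltW.
move=> /ae_eq_integral_abs; case=> //; first exact: measurable_int (iS _ mA AC).
move=> N [mN N0 h]; apply/eqP; rewrite eq_le measure_ge0 andbT -N0.
apply: le_measure; rewrite ?inE// => x Ax; apply: h => /= /(_ Ax) [].
by case: Ax => _ /= /lt_eqF/eqP.
Qed.

End ae_ge0.

(** * A smooth function flat at the origin *)

Section flat_exponential.
Context {R : realType}.
Implicit Types (P : {poly R}) (x : R).

(* [P (1/x) exp (-1/x)] for [x > 0], extended by 0: a family stable under
   differentiation. *)
Definition flat_exp P x : R := if 0 < x then P.[x^-1] * expR (- x^-1) else 0.

(** With y = 1/x one has y' = -y^2, so the derivative of P(y) exp(-y) is y^2 (P - P')(y) exp(-y). *)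
Definition flat_deriv P : {poly R} := 'X^2 * (P - P^`()).

(** Each monomial is estimated by [expR_monomial_le]; the factorial is shifted by 2 to leave room
    for a further factor x^-2. *)
Definition flat_bound P : R := \sum_(i < size P) `|P`_i| * (i.+2)`!%:R.

(** The single term u^k / k! of the exponential series is at most exp u. *)
Lemma expR_monomial_le k (u : R) : 0 <= u -> u ^+ k * expR (- u) <= k`!%:R.
Proof.
move=> u0; rewrite expRN ler_pdivrMr ?expR_gt0//.
case: k => [|k]; first by rewrite expr0 fact0 mul1r -expR0 ler_expR.
have := expR_ge1Dxn k u0.
have f0 : 0 < (k.+1)`!%:R :> R by rewrite ltr0n fact_gt0.
rewrite mulrC => h; rewrite mulrC -ler_pdivrMr// mulrC; apply: le_trans h.
by rewrite mulrC lerDr.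
Qed.

Lemma flat_exp_le j P x : (j <= 2)%N -> 0 < x ->
  `|flat_exp P x| * x^-1 ^+ j <= flat_bound P.
Proof.
move=> j2 x0; rewrite /flat_exp x0 horner_coef mulr_suml.
have xV0 : 0 <= x^-1 by rewrite invr_ge0 ltW.
rewrite -(ger0_norm (exprn_ge0 j xV0)) -normrM mulr_suml.
apply: le_trans (ler_norm_sum _ _ _) _; apply: ler_sum => i _.
set y := x^-1 in xV0 *.
have -> : P`_i * y ^+ i * expR (- y) * y ^+ j = P`_i * (y ^+ (i + j) * expR (- y)).
  by rewrite exprD; ring.
rewrite normrM ler_wpM2l// ger0_norm; last by rewrite mulr_ge0 ?exprn_ge0// expR_ge0.
apply: le_trans (expR_monomial_le _ xV0) _.
by rewrite ler_nat; apply: leq_fact; rewrite -addn2 leq_add2l.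
Qed.

Lemma flat_bound_ge0 P : 0 <= flat_bound P.
Proof. by apply: sumr_ge0 => i _; rewrite mulr_ge0. Qed.

Lemma flat_exp_bounded P x : `|flat_exp P x| <= flat_bound P.
Proof.
have [x0|x0] := ltP 0 x; first by have := @flat_exp_le 0 P x isT x0; rewrite expr0 mulr1.
by rewrite /flat_exp ltNge x0/= normr0 flat_bound_ge0.
Qed.

(** Quadratic smallness makes the difference quotient at 0 at most of order |h|, hence the
    derivative 0 there. *)
Lemma flat_exp_small P x : `|flat_exp P x| <= flat_bound P * x ^+ 2.
Proof.
have [x0|x0] := ltP 0 x.
  by rewrite -ler_pdivrMr ?exprn_gt0// -exprVn flat_exp_le.
by rewrite /flat_exp ltNge x0/= normr0 mulr_ge0 ?flat_bound_ge0// sqr_ge0.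
Qed.

Lemma is_derive_flat_exp P x :
  is_derive x (1 : R) (flat_exp P) (flat_exp (flat_deriv P) x).
Proof.
have [x0|x0|<-] := ltgtP 0 x.
- apply: (@near_eq_is_derive _ _ _ (fun y : R => P.[y^-1] * expR (- y^-1) : R)).
    near=> y; rewrite /flat_exp ifT//; near: y; exact: lt_nbhsr.
  have dV : is_derive x (1 : R) (fun y : R => y^-1) (- x^-1 ^+ 2).
    apply: is_derive_eq; first by apply: is_deriveV; rewrite gt_eqF.
    by rewrite -exprVn /GRing.scale/= mulr1.
  have d1 : is_derive x (1 : R) (fun y : R => P.[y^-1]) (- x^-1 ^+ 2 * P^`().[x^-1]).
    rewrite mulrC; apply: (@is_derive1_comp _ (horner P) (fun y : R => y^-1)).
  have d2 : is_derive x (1 : R) (fun y : R => expR (- y^-1)) (x^-1 ^+ 2 * expR (- x^-1)).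
    rewrite mulrC -[X in _ * X]opprK.
    apply: (@is_derive1_comp _ expR (fun y : R => - y^-1)).
  apply: is_derive_eq; rewrite /flat_exp x0 /flat_deriv !hornerE /GRing.scale/=; ring.
- apply: (@near_eq_is_derive _ _ _ (cst 0 : R -> R)).
    near=> y; rewrite /flat_exp ifF//; apply/negbTE; rewrite -leNgt.
    by apply/ltW; near: y; exact: (@lt_nbhsl R).
  by rewrite /flat_exp ltNge ltW//=; exact: is_derive_cst.
- rewrite /flat_exp ltxx.
  have h : h^-1 *: (flat_exp P (h *: (1 : R) + 0) - flat_exp P 0) @[h --> 0^'] --> (0 : R).
    apply: norm_cvg0.
    apply: (@squeeze_cvgr _ _ _ _ (cst 0) (fun h : R => flat_bound P * `|h|)).
    + near=> h; rewrite /= normr_ge0/= addr0 [h *: 1]mulr1.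
      rewrite [flat_exp P 0]/flat_exp ltxx subr0 normrM normfV.
      have h0 : h != 0 by near: h; exact: nbhs_dnbhs_neq.
      rewrite ler_pdivrMl ?normr_gt0//; apply: le_trans (flat_exp_small _ _) _.
      by rewrite -real_normK ?num_real// expr2 mulrCA.
    + exact: cvg_cst.
    + rewrite -[X in _ --> X](mulr0 (flat_bound P)); apply: cvgMl_tmp.
      by rewrite -[X in _ --> X](@normr0 _ R); apply: cvg_norm; exact: cvg_within.
  by apply: DeriveDef; [apply/cvg_ex; exists 0|exact/cvg_lim].
Unshelve. all: by end_near. Qed.

Lemma continuous_flat_exp P : continuous (flat_exp P).
Proof.
move=> x; have /derivable1_diffP := @ex_derive _ _ _ _ _ _ _ (is_derive_flat_exp P x).
exact: differentiable_continuous.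
Qed.

End flat_exponential.

(** * Stability of smooth functions under algebraic operations *)

Section Ck_closed.
Context {R : realType} {n : nat}.
Implicit Types u w phi : 'rV[R]_n -> R.

Lemma CkW k phi : Ck k.+1 phi -> Ck k phi.
Proof.
elim: k phi => [|k IH] phi; first by case.
case=> cphi h; split=> // i; have [dphi hi] := h i; split=> //; exact: IH.
Qed.

Lemma Ck_cst k (c : R) : Ck k (cst c : 'rV[R]_n -> R).
Proof.
elim: k c => [|k IH] c; first by split=> //; exact: cst_continuous.
split=> [|i]; first exact: cst_continuous.
split=> [x|]; first exact: derivable_cst.
by rewrite (_ : (fun x => _) = cst 0) //; apply/funext => x; rewrite derive_cst.
Qed.

Lemma CkD k u w : Ck k u -> Ck k w -> Ck k (fun x => u x + w x).
Proof.
elim: k u w => [|k IH] u w.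
  by move=> [cu _] [cw _]; split=> // x; exact: (cvgD (cu x) (cw x)).
move=> [cu hu] [cw hw]; split=> [x|i]; first exact: (cvgD (cu x) (cw x)).
have [du hui] := hu i; have [dw hwi] := hw i.
split=> [x|]; first exact: derivableD.
rewrite (_ : (fun x => _) = fun x => 'D_(delta_mx 0 i) u x + 'D_(delta_mx 0 i) w x).
  exact: IH.
by apply/funext => x; rewrite -deriveD.
Qed.

Lemma CkM k u w : Ck k u -> Ck k w -> Ck k (fun x => u x * w x).
Proof.
elim: k u w => [|k IH] u w.
  by move=> [cu _] [cw _]; split=> // x; exact: (cvgM (cu x) (cw x)).
move=> hu hw; have [cu du] := hu; have [cw dw] := hw; split=> [x|i]; first exact: (cvgM (cu x) (cw x)).
have [dui hui] := du i; have [dwi hwi] := dw i.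
split=> [x|]; first exact: derivableM.
rewrite (_ : (fun x => _) = fun x => u x * 'D_(delta_mx 0 i) w x + w x * 'D_(delta_mx 0 i) u x).
  by apply: CkD; apply: IH => //; exact: CkW.
by apply/funext => x; rewrite deriveM.
Qed.

(** On the line x + h v the coordinate is affine in h, so the one-variable chain rule applies. *)
Lemma is_derive_comp_coord (g : R -> R) dg i (a c : R) (x v : 'rV[R]_n) :
  is_derive (a + c * x 0 i) (1 : R) g dg ->
  is_derive x v (fun y : 'rV[R]_n => g (a + c * y 0 i)) (c * v 0 i * dg).
Proof.
move=> dg'.
have h1 : is_derive (0 : R) (1 : R) (fun h : R => g (a + c * (h * v 0 i + x 0 i))) (dg * (c * v 0 i)).
  apply: (@is_derive1_comp _ g (fun h : R => a + c * (h * v 0 i + x 0 i))).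
    by rewrite mul0r add0r.
  apply: is_derive_eq; rewrite /GRing.scale/= !(mulr0, mulr1, mul0r, addr0, add0r, mul1r).
  done.
have e h : h^-1 *: (g (a + c * (h *: v + x) 0 i) - g (a + c * x 0 i)) =
  h^-1 *: ((fun h : R => g (a + c * (h * v 0 i + x 0 i))) (h *: (1 : R) + 0) -
    (fun h : R => g (a + c * (h * v 0 i + x 0 i))) 0).
  by rewrite !mxE addr0 [h *: 1]mulr1 mul0r add0r.
have [d1 d2] := h1.
apply: DeriveDef.
  by rewrite /derivable; under eq_fun do rewrite e; exact: d1.
rewrite /derive; under eq_fun do rewrite e.
by rewrite [RHS]mulrC; exact: d2.
Qed.

(** The induction runs over all [P] at once, because differentiation replaces [P] by
    [flat_deriv P]. *)
Lemma Ck_flat_exp k P i (a c : R) :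
  Ck k (fun x : 'rV[R]_n => flat_exp P (a + c * x 0 i)).
Proof.
have cont Q : continuous (fun x : 'rV[R]_n => flat_exp Q (a + c * x 0 i)).
  move=> x; apply: (@continuous_comp _ _ _ (fun x : 'rV[R]_n => a + c * x 0 i) (flat_exp Q)).
    have hx : {for x, continuous (fun y : 'rV[R]_n => y 0 i)} by exact: coord_continuous.
    exact: (cvgD (cvg_cst a) (cvgM (cvg_cst c) hx)).
  exact: continuous_flat_exp.
elim: k P => [|k IH] P; split=> // j.
have D (x : 'rV[R]_n) := is_derive_comp_coord (delta_mx 0 j) (is_derive_flat_exp P (a + c * x 0 i)).
split=> [x|]; first by have [] := D x.
rewrite (_ : 'D_ _ _ =
  fun x : 'rV[R]_n => cst (c * (delta_mx 0 j : 'rV[R]_n) 0 i) x * flat_exp (flat_deriv P) (a + c * x 0 i)).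
  by apply: CkM => //; exact: Ck_cst.
by apply/funext => x; have [_ ->] := D x.
Qed.

(* [dphi] is the gradient of [phi], given with its linearity in the direction. *)
Definition smooth_bounded phi := [/\ forall k, Ck k phi,
  exists B, forall x, `|phi x| <= B &
  exists dphi : 'rV[R]_n -> 'rV[R]_n,
    (forall x v, is_derive x v phi (dot (dphi x) v)) /\
    exists B, forall x i, `|dphi x 0 i| <= B].

Lemma smooth_bounded_cst c : smooth_bounded (cst c).
Proof.
split; first by move=> k; exact: Ck_cst.
  by exists `|c|.
exists (cst 0); split=> [x v|]; last by exists 0 => x i; rewrite mxE normr0.
by rewrite /dot big1 => [|i _]; [exact: is_derive_cst|rewrite mxE mul0r].
Qed.

Lemma smooth_boundedM u w : smooth_bounded u -> smooth_bounded w ->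
  smooth_bounded (fun x => u x * w x).
Proof.
move=> [Cu [Bu ub] [du [dud [Bdu dub]]]] [Cw [Bw wb] [dw [dwd [Bdw dwb]]]].
split; first by move=> k; exact: CkM.
  by exists (Bu * Bw) => x; rewrite normrM ler_pM.
exists (fun x => u x *: dw x + w x *: du x); split.
  move=> x v; apply: is_derive_eq; rewrite /dot /GRing.scale/= !mulr_sumr -big_split/=.
  by apply: eq_bigr => i _; rewrite !mxE mulrDl !mulrA.
exists (Bu * Bdw + Bw * Bdu) => x i; rewrite !mxE; apply: le_trans (ler_normD _ _) _.
by rewrite !normrM lerD// ler_pM.
Qed.

Lemma smooth_bounded_flat_exp P i (a c : R) :
  smooth_bounded (fun x : 'rV[R]_n => flat_exp P (a + c * x 0 i)).
Proof.
split; first by move=> k; exact: Ck_flat_exp.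
  by exists (flat_bound P) => x; exact: flat_exp_bounded.
exists (fun x => (c * flat_exp (flat_deriv P) (a + c * x 0 i)) *: delta_mx 0 i); split.
  move=> x v; rewrite (_ : dot _ _ = c * v 0 i * flat_exp (flat_deriv P) (a + c * x 0 i)).
    exact/is_derive_comp_coord/is_derive_flat_exp.
  rewrite /dot (bigD1 i)//= big1 ?addr0 => [|j ji]; rewrite !mxE !eqxx/=.
    by rewrite mulr1 mulrAC.
  by rewrite (negbTE ji) mulr0 mul0r.
exists (`|c| * flat_bound (flat_deriv P)) => x j; rewrite !mxE eqxx/= !normrM.
rewrite -[leRHS]mulr1; apply: ler_pM => //.
  by rewrite ler_wpM2l// flat_exp_bounded.
by case: (_ == _); rewrite ?normr1 ?normr0.
Qed.

Lemma smooth_bounded_prod (I : Type) (r : seq I) (F : I -> 'rV[R]_n -> R) :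
  (forall i, smooth_bounded (F i)) -> smooth_bounded (fun x => \prod_(i <- r) F i x).
Proof.
move=> h; elim: r => [|i r IH].
  by rewrite (_ : (fun x => _) = cst 1); [exact: smooth_bounded_cst|apply/funext => x; rewrite big_nil].
rewrite (_ : (fun x => _) = fun x => F i x * \prod_(i <- r) F i x).
  exact: smooth_boundedM.
by apply/funext => x; rewrite big_cons.
Qed.

End Ck_closed.

(** * Smooth bumps on boxes *)

Section bump.
Context {R : realType} {n : nat}.
Implicit Types (m : R) (a b x v : 'rV[R]_n).

(** [m] is a steepness: for t > 0, [flat_exp 1 (m * t)] tends to 1 as [m] grows, so the bump
    approaches the indicator of the box between [a] and [b]. *)
Definition bumpfun m a b x : R :=
  \prod_(i < n) (flat_exp 1 (m * (x 0 i - a 0 i)) * flat_exp 1 (m * (b 0 i - x 0 i))).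

Lemma flat_exp1E (t : R) : flat_exp 1 t = if 0 < t then expR (- t^-1) else 0.
Proof. by rewrite /flat_exp hornerC mul1r. Qed.

Lemma flat_exp1_ge0 (t : R) : 0 <= flat_exp 1 t.
Proof. by rewrite flat_exp1E; case: ifP => // _; exact: expR_ge0. Qed.

Lemma flat_exp1_le1 (t : R) : flat_exp 1 t <= 1.
Proof.
by rewrite flat_exp1E; case: ifP => // t0; rewrite expR_le1 oppr_le0 invr_ge0 ltW.
Qed.

Lemma smooth_bounded_bump m a b : smooth_bounded (bumpfun m a b).
Proof.
apply: smooth_bounded_prod => i; apply: smooth_boundedM.
  rewrite (_ : (fun x => _) = fun x : 'rV[R]_n => flat_exp 1 (- (m * a 0 i) + m * x 0 i)).
    exact: smooth_bounded_flat_exp.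
  by apply/funext => x; congr flat_exp; ring.
rewrite (_ : (fun x => _) = fun x : 'rV[R]_n => flat_exp 1 (m * b 0 i + (- m) * x 0 i)).
  exact: smooth_bounded_flat_exp.
by apply/funext => x; congr flat_exp; ring.
Qed.

Lemma bump_ge0 m a b x : 0 <= bumpfun m a b x.
Proof. by apply: prodr_ge0 => i _; rewrite mulr_ge0 ?flat_exp1_ge0. Qed.

Lemma bump_le1 m a b x : bumpfun m a b x <= 1.
Proof.
apply: prodr_ile1 => i _; rewrite mulr_ge0 ?flat_exp1_ge0//=.
by rewrite mulr_ile1 ?flat_exp1_ge0 ?flat_exp1_le1.
Qed.

Lemma bump_gt0 m a b x : 0 < m -> (forall i, a 0 i < x 0 i < b 0 i) -> 0 < bumpfun m a b x.
Proof.
move=> m0 h; apply: prodr_gt0 => i _; have /andP[h1 h2] := h i.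
by rewrite !flat_exp1E !ifT ?mulr_gt0 ?expR_gt0 ?subr_gt0.
Qed.

Lemma bump_neq0 m a b x i : 0 < m -> bumpfun m a b x != 0 -> a 0 i < x 0 i < b 0 i.
Proof.
move=> m0; rewrite /bumpfun (bigD1 i)//= !mulf_eq0 !negb_or !flat_exp1E => /andP[/andP[]].
by case: ifP; case: ifP; rewrite ?eqxx// !pmulr_rgt0// !subr_gt0 => -> ->.
Qed.

Lemma bump_translate m a b x v : bumpfun m a b (x + v) = bumpfun m (a - v) (b - v) x.
Proof.
by apply: eq_bigr => i _; rewrite !mxE; congr (flat_exp _ _ * flat_exp _ _); ring.
Qed.

Lemma continuous_bump m a b : continuous (bumpfun m a b).
Proof. by have [/(_ 0%N)[]] := smooth_bounded_bump m a b. Qed.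

Lemma compact_box a b : compact [set x : 'rV[R]_n | forall i, x 0 i \in `[a 0 i, b 0 i]].
Proof.
by apply: (@rV_compact _ _ (fun i => `[a 0 i, b 0 i]%classic)) => i; exact: segment_compact.
Qed.

Lemma test_function_bump m a b : 0 < m -> test_function (bumpfun m a b).
Proof.
move=> m0; split; first by have [] := smooth_bounded_bump m a b.
apply: (subclosed_compact (@closed_closure _ _) (@compact_box a b)).
have /closure_id -> := compact_closed (@norm_hausdorff _ _) (@compact_box a b).
apply: closure_subset => x /= h i; rewrite in_itv/=.
by have /andP[/ltW -> /ltW ->] := bump_neq0 i m0 h.
Qed.

End bump.

(** * Integrals of products and of finite sums *)

Section integral_lemmas.
Context d (T : measurableType d) (R : realType) (mu : {measure set T -> \bar R}).

Lemma integrableM_bounded (D : set T) (u w : T -> R) (B : R) : measurable D ->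
  mu.-integrable D (EFin \o u) -> measurable_fun D w ->
  (forall x, D x -> `|w x| <= B) ->
  mu.-integrable D (EFin \o (fun x => u x * w x)).
Proof.
move=> mD iu mw wB.
apply: (@le_integrable _ _ _ _ _ mD _ (fun x => B%:E * (EFin \o u) x)%E).
- apply/measurable_EFinP; apply: measurable_funM => //.
  by apply/measurable_EFinP; exact: measurable_int iu.
- move=> x Dx /=; rewrite lee_fin !normrM mulrC ler_wpM2r//.
  by apply: le_trans (wB _ Dx) _; exact: ler_norm.
- exact: integrableZl.
Qed.

Lemma RintegralM_le (D : set T) (u w : T -> R) (c : R) : measurable D -> 0 <= c ->
  measurable_fun D u -> {ae mu, forall x, `|u x| <= c} -> (forall x, 0 <= w x) ->
  mu.-integrable D (EFin \o w) -> mu.-integrable D (EFin \o (fun x => u x * w x)) ->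
  `|\int[mu]_(x in D) (u x * w x)| <= c * \int[mu]_(x in D) w x.
Proof.
move=> mD c0 mu_ uc w0 iw iuw.
have icw : mu.-integrable D (EFin \o (fun x => c * w x)).
  rewrite (_ : EFin \o _ = fun x => c%:E * (EFin \o w) x)%E//; exact: integrableZl.
have mw : measurable_fun D w by apply/measurable_EFinP; exact: measurable_int iw.
have le : {ae mu, forall x, D x -> (`|(u x * w x)%:E| <= (c * w x)%:E)%E}.
  by apply: filterS uc => x ux _; rewrite /= lee_fin normrM (ger0_norm (w0 x)) ler_wpM2r.
apply: le_trans (le_normr_Rintegral mD iuw) _.
rewrite -RintegralZl//; apply: fine_le.
- by apply: integrable_fin_num => //; exact: integrable_abse iuw.
- exact: integrable_fin_num.
apply: ae_ge0_le_integral => //.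
- by apply/measurable_EFinP; apply: measurableT_comp => //; exact: measurable_funM.
- by move=> x Dx; rewrite lee_fin mulr_ge0.
- exact: measurable_int icw.
Qed.

Lemma integrableZR (D : set T) (c : R) (u : T -> R) : measurable D ->
  mu.-integrable D (EFin \o u) -> mu.-integrable D (EFin \o (fun x => c * u x)).
Proof. by move=> mD iu; exact: (integrableZl mD c iu). Qed.

Lemma integrableBR (D : set T) (u w : T -> R) : measurable D ->
  mu.-integrable D (EFin \o u) -> mu.-integrable D (EFin \o w) ->
  mu.-integrable D (EFin \o (fun x => u x - w x)).
Proof. by move=> mD iu iw; exact: (integrableB mD iu iw). Qed.

Lemma integrable_sumR (D : set T) (I : Type) (r : seq I) (F : I -> T -> R) : measurable D ->
  (forall i, mu.-integrable D (EFin \o F i)) ->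
  mu.-integrable D (EFin \o (fun x => \sum_(i <- r) F i x)).
Proof.
move=> mD iF; rewrite (_ : EFin \o _ = fun x => \sum_(i <- r) (EFin \o F i) x)%E.
  exact: integrable_sum.
by apply/funext => x; rewrite /= sumEFin.
Qed.

Lemma Rintegral_sum (D : set T) (I : Type) (r : seq I) (F : I -> T -> R) : measurable D ->
  (forall i, mu.-integrable D (EFin \o F i)) ->
  \int[mu]_(x in D) (\sum_(i <- r) F i x) = \sum_(i <- r) \int[mu]_(x in D) F i x.
Proof.
move=> mD iF; elim: r => [|i r IH].
  rewrite big_nil -[RHS](mul0r (fine (mu D))) -Rintegral_cst//.
  by apply: eq_Rintegral => x _; rewrite big_nil.
rewrite big_cons -IH -RintegralD//; last exact: integrable_sumR.
by apply: eq_Rintegral => x _; rewrite big_cons.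
Qed.

End integral_lemmas.

(** * Bumps converging to indicators of boxes *)

Section bump_limit.
Context {R : realType} {n : nat}.
Local Notation mu := (lebesgue_rV R n).
Implicit Types a b x : 'rV[R]_n.

Definition box a b : set 'rV[R]_n := [set x | forall i, a 0 i <= x 0 i < b 0 i].

Lemma measurable_box a b : measurable (box a b).
Proof.
rewrite (_ : box a b = \bigcap_(i in [set: 'I_n])
    ((fun y : 'rV[R]_n => y 0 i) @^-1` `[a 0 i, b 0 i[%classic)).
  apply: fin_bigcap_measurable => // i _.
  rewrite -[X in measurable X]setTI.
  by apply: measurable_coord => //; exact: measurable_itv.
by apply/seteqP; split=> y h i; [move=> _ /=; rewrite in_itv/=; exact: h
  |have := h i I; rewrite /= in_itv].
Qed.

Lemma lebesgue_rV_box_fin a b : (mu (box a b) < +oo)%E.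
Proof.
rewrite (_ : box a b = [set x | forall i, `[a 0 i, b 0 i[%classic (x 0 i)]); last first.
  by apply/seteqP; split=> x h i; have := h i; rewrite /= in_itv.
rewrite (lebesgue_rV_box (A := fun i => `[a 0 i, b 0 i[%classic)); last first.
  by move=> i; exact: measurable_itv.
rewrite (eq_bigr (fun i => (Num.max 0 (b 0 i - a 0 i))%:E)); last first.
  move=> i _; rewrite lebesgue_measure_itv/= lte_fin; case: ltP => h.
    by rewrite -EFinB max_r// subr_ge0 ltW.
  by rewrite max_l// subr_le0.
by rewrite prodEFin ltry.
Qed.

(* The bumps are slightly shifted to the left, so that their limit is the
   indicator of the half-open box. *)
Definition bump_seq a b (j : nat) : 'rV[R]_n -> R :=
  bumpfun (j.+1%:R ^+ 2) (a - const_mx j.+1%:R^-1) b.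

(** Squeeze with exp(-1/u) >= 1 - 1/u, where u is at least (j + 1) e. *)
Lemma cvg_flat_exp1 (u : nat -> R) (e : R) : 0 < e ->
  (forall j, j.+1%:R * e <= u j) -> flat_exp 1 (u j) @[j --> \oo] --> (1 : R).
Proof.
move=> e0 ue; apply: (@squeeze_cvgr _ _ _ _ (fun j => 1 - e^-1 * j.+1%:R^-1) (cst 1)).
- near=> j; rewrite flat_exp1_le1 andbT.
  have je0 : 0 < j.+1%:R * e by rewrite mulr_gt0.
  have u0 : 0 < u j by exact: lt_le_trans (ue j).
  rewrite flat_exp1E u0; apply: le_trans (expR_ge1Dx _).
  by rewrite lerD2l lerN2 -invfM mulrC lef_pV2 ?posrE// mulrC.
- rewrite -[X in _ --> X]subr0; apply: cvgB; first exact: cvg_cst.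
  rewrite -[X in _ --> X](mulr0 e^-1); apply: cvgM; first exact: cvg_cst.
  exact: cvg_harmonic.
- exact: cvg_cst.
Unshelve. all: by end_near. Qed.

Lemma cvg_prod (I : Type) (r : seq I) (F : I -> nat -> R) (l : I -> R) :
  (forall i, F i j @[j --> \oo] --> l i) ->
  \prod_(i <- r) F i j @[j --> \oo] --> \prod_(i <- r) l i.
Proof.
move=> h; elim: r => [|i r IH].
  by rewrite big_nil (_ : (fun j => _) = cst 1);
    [exact: cvg_cst|apply/funext => j; rewrite big_nil].
rewrite big_cons (_ : (fun j => _) = fun j => F i j * \prod_(i <- r) F i j).
  exact: (cvgM (h i) IH).
by apply/funext => j; rewrite big_cons.
Qed.

Lemma cvg_bump_seq a b x : bump_seq a b j x @[j --> \oo] --> (\1_(box a b) x : R).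
Proof.
pose l i : R := ((a 0 i <= x 0 i) && (x 0 i < b 0 i))%:R.
have -> : \1_(box a b) x = \prod_(i < n) l i :> R.
  rewrite indicE; have [/set_mem h|/negP h] := boolP (x \in box a b).
    by rewrite big1// => i _; rewrite /l h.
  have [i hi] : exists i, ~~ (a 0 i <= x 0 i < b 0 i).
    apply: contrapT => /forallNP h'; apply: h; apply/mem_set => i.
    by have /negP := h' i; rewrite negbK.
  by rewrite (bigD1 i)//= /l (negbTE hi) mul0r.
apply: cvg_prod => i; rewrite /l -mulnb natrM; apply: cvgM.
  have [ax|ax] := leP (a 0 i) (x 0 i).
    (* The steepness (j + 1)^2 times the shift 1/(j + 1) leaves at least j + 1 even when x_i = a_i;
       this is why the steepness is a square. *)
    apply: (@cvg_flat_exp1 _ 1) => // j; rewrite !mxE mulr1 opprB addrCA.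
    rewrite mulrDr expr2 -[X in X + _]mulrA mulfV ?pnatr_eq0// mulr1 lerDl.
    by rewrite !mulr_ge0// subr_ge0.
  (* Here x_i < a_i: the shift is eventually at most a_i - x_i and the factor vanishes. *)
  apply: cvg_near_cst; near=> j; rewrite flat_exp1E ifF//; apply/negbTE; rewrite -leNgt.
  rewrite pmulr_rle0 ?exprn_gt0// !mxE subr_le0 lerBrDr -lerBrDl.
  rewrite -[_^-1]ger0_norm// -normrN -sub0r; near: j.
  have e0 : 0 < a 0 i - x 0 i by rewrite subr_gt0.
  by have /cvgrPdist_le/(_ _ e0) := @cvg_harmonic R.
have [xb|xb] := ltP (x 0 i) (b 0 i).
  apply: (@cvg_flat_exp1 _ (b 0 i - x 0 i)); first by rewrite subr_gt0.
  move=> j; apply: ler_wpM2r; first by rewrite subr_ge0 ltW.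
  by rewrite expr2 ler_peMl// ler1n.
rewrite (_ : (fun j => _) = cst 0); first exact: cvg_cst.
apply/funext => j; rewrite flat_exp1E ifF//; apply/negbTE; rewrite -leNgt.
by rewrite pmulr_rle0 ?exprn_gt0// subr_le0.
Unshelve. all: by end_near. Qed.

Lemma bump_le_indic m a b x : 0 < m -> bumpfun m a b x <= \1_(box a b) x.
Proof.
move=> m0; rewrite indicE; have [->|h] := eqVneq (bumpfun m a b x) 0; first by [].
rewrite mem_set ?bump_le1// => i; have /andP[h1 h2] := bump_neq0 i m0 h.
by rewrite h2 ltW.
Qed.

Lemma integrable_bump m a b : 0 < m -> mu.-integrable setT (EFin \o bumpfun m a b).
Proof.
move=> m0; apply/integrableP; split.
  by apply/measurable_EFinP; apply: continuous_measurable_rV; exact: continuous_bump.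
apply: le_lt_trans (lebesgue_rV_box_fin a b).
rewrite -[X in (_ <= mu X)%E]setIT -integral_indic//; last exact: measurable_box.
apply: ge0_le_integral_nomeas => // x _ /=.
by rewrite lee_fin ger0_norm ?bump_ge0// bump_le_indic.
Qed.

(** By continuity the bump stays above half of its positive central value on a small ball. *)
Lemma integral_bump_gt0 m a b : 0 < m -> (forall i, a 0 i < b 0 i) ->
  0 < \int[mu]_x bumpfun m a b x.
Proof.
move=> m0 ab; pose c := 2^-1 *: (a + b).
have c0 : 0 < bumpfun m a b c.
  by apply: bump_gt0 => // i; rewrite !mxE; have := ab i; lra.
have /cvgrPdist_lt/(_ _ (divr_gt0 c0 (ltr0n R 2))) /nbhs_ballP[e /= e0 eb] :=
  @continuous_bump R n m a b c.
rewrite fine_gt0//; apply/andP; split; last first.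
  have := integrable_fin_num measurableT (integrable_bump a b m0).
  rewrite ge0_fin_numE//; apply: integral_ge0 => x _.
  by rewrite /= lee_fin bump_ge0.
apply: (@lt_le_trans _ _ ((bumpfun m a b c / 2)%:E * mu (ball c e))%E).
  by rewrite lebesgue_rV_ball// -EFinM lte_fin mulr_gt0 ?divr_gt0// exprn_gt0// mulrn_wgt0.
apply: ge0_integral_lb => //.
- exact: measurable_ball_rV.
- by rewrite divr_ge0// bump_ge0.
- by move=> x _; rewrite lee_fin bump_ge0.
- move=> x /eb /=; rewrite ltr_norml lee_fin => /andP[_]; lra.
Qed.

End bump_limit.

(** * Weak derivatives in a direction *)

Section directional_derivative.
Context {R : realType} {n : nat}.
Local Notation mu := (lebesgue_rV R n).
Variables (f : 'rV[R]_n -> R) (G : 'rV[R]_n -> 'rV[R]_n).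
Hypothesis cf : continuous f.
Hypothesis intf : mu.-integrable setT (EFin \o f).
Hypothesis intG : forall i, mu.-integrable setT (EFin \o (fun x => G x 0 i)).
Hypothesis wG : forall phi i, test_function phi ->
  \int[mu]_x (f x * 'D_(delta_mx 0 i) phi x) = - \int[mu]_x (G x 0 i * phi x).
Implicit Types (xi : 'rV[R]_n) (phi : 'rV[R]_n -> R).

Lemma integrable_dot xi : mu.-integrable setT (EFin \o (fun x => dot (G x) xi)).
Proof.
apply: integrable_sumR => // i.
apply: (@integrableM_bounded _ _ _ _ _ _ (cst (xi 0 i)) `|xi 0 i|) => //.
Qed.

Lemma measurable_dot xi : measurable_fun setT (fun x => dot (G x) xi).
Proof. by apply/measurable_EFinP; exact: measurable_int (integrable_dot xi). Qed.

Lemma smooth_bounded_integrable phi : smooth_bounded phi ->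
  mu.-integrable setT (EFin \o (fun x => f x * phi x)) /\
  forall xi, mu.-integrable setT (EFin \o (fun x => dot (G x) xi * phi x)).
Proof.
move=> [/(_ 0%N)[cphi _] [B phiB] _].
split=> [|xi]; apply: (@integrableM_bounded _ _ _ _ _ _ _ B) => //;
  by [exact: continuous_measurable_rV|exact: integrable_dot].
Qed.

Lemma continuous_partial phi i : (forall k, Ck k phi) ->
  continuous (fun x => 'D_(delta_mx 0 i) phi x).
Proof. by move=> /(_ 1%N)[_ /(_ i)[_ []]]. Qed.

Lemma dot_delta (x : 'rV[R]_n) i : dot x (delta_mx 0 i) = x 0 i.
Proof.
rewrite /dot (bigD1 i)//= big1 ?addr0 => [|j ji]; rewrite !mxE eqxx/=.
  by rewrite eqxx mulr1.
by rewrite (negbTE ji) mulr0.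
Qed.

(** Sum of the coordinate identities [wG] with weights [xi 0 i]. *)
Lemma weak_gradient_dir phi dphi xi : test_function phi -> smooth_bounded phi ->
  (forall x v, is_derive x v phi (dot (dphi x) v)) ->
  (exists B, forall x i, `|dphi x 0 i| <= B) ->
  \int[mu]_x (f x * dot (dphi x) xi) = - \int[mu]_x (dot (G x) xi * phi x).
Proof.
move=> tphi sphi dphiE [B dB].
have dE x i : dphi x 0 i = 'D_(delta_mx 0 i) phi x.
  by rewrite -dot_delta; have [_ ->] := dphiE x (delta_mx 0 i).
have [sC [Bp pB] _] := sphi.
have mphi : measurable_fun setT phi.
  by apply: continuous_measurable_rV; have [] := sC 0%N.
have i1 i : mu.-integrable setT (EFin \o (fun x => f x * dphi x 0 i)).
  apply: (@integrableM_bounded _ _ _ _ _ _ _ B) => //.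
  under eq_fun do rewrite dE; apply: continuous_measurable_rV; exact: continuous_partial.
have i2 i : mu.-integrable setT (EFin \o (fun x => G x 0 i * phi x)).
  exact: (@integrableM_bounded _ _ _ _ _ _ _ Bp).
have iZ (u : 'rV[R]_n -> R) (c : R) : mu.-integrable setT (EFin \o u) ->
    mu.-integrable setT (EFin \o (fun x => u x * c)).
  by move=> iu; apply: (@integrableM_bounded _ _ _ _ _ _ (cst c) `|c|).
transitivity (\sum_(i < n) \int[mu]_x (f x * dphi x 0 i * xi 0 i)).
  rewrite -Rintegral_sum//; last by move=> i; exact: iZ.
  by apply: eq_Rintegral => x _; rewrite mulr_sumr; apply: eq_bigr => i _; rewrite mulrA.
transitivity (- \sum_(i < n) \int[mu]_x (G x 0 i * phi x * xi 0 i)).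
  rewrite -sumrN; apply: eq_bigr => i _; rewrite !RintegralZr// -mulNr -wG//.
  by congr (_ * _); apply: eq_Rintegral => x _; rewrite dE.
rewrite -Rintegral_sum//; last by move=> i; exact: iZ.
congr (- _).
by apply: eq_Rintegral => x _; rewrite mulr_suml; apply: eq_bigr => i _; rewrite mulrAC.
Qed.

Lemma is_derive_line phi (l t : R) (x v : 'rV[R]_n) :
  is_derive (x + t *: v) v phi l ->
  is_derive t (1 : R) (fun s : R => phi (x + s *: v)) l.
Proof.
have e h : h^-1 *: (phi (h *: v + (x + t *: v)) - phi (x + t *: v)) =
   h^-1 *: ((fun s : R => phi (x + s *: v)) (h *: (1 : R) + t) -
            (fun s : R => phi (x + s *: v)) t).
  by rewrite [h *: 1]mulr1 addrCA -scalerDl.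
move=> [d1 d2]; apply: DeriveDef.
  by rewrite /derivable; under eq_fun do rewrite -e; exact: d1.
by rewrite /derive; under eq_fun do rewrite -e; exact: d2.
Qed.

(** Differentiation under the integral sign, dominated by |f| times a bound on the derivative of
    [phi] along [xi]. *)
Lemma is_derive_convolution phi dphi xi (t : R) : smooth_bounded phi ->
  (forall x v, is_derive x v phi (dot (dphi x) v)) ->
  (exists B, forall x i, `|dphi x 0 i| <= B) ->
  is_derive t (1 : R) (fun s : R => \int[mu]_y (f y * phi (y + s *: xi)))
    (\int[mu]_y (f y * dot (dphi (y + t *: xi)) xi)).
Proof.
move=> sphi dphiE [B dB]; have [sC [Bp pB] _] := sphi.
have cphi : continuous phi by have [] := sC 0%N.
pose F (s : R) y := f y * phi (y + s *: xi).
have dF s y : is_derive s (1 : R) (F ^~ y) (f y * dot (dphi (y + s *: xi)) xi).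
  have h : is_derive s (1 : R) (fun s : R => phi (y + s *: xi)) (dot (dphi (y + s *: xi)) xi).
    exact: is_derive_line.
  exact: is_deriveZ.
pose M := B * \sum_(i < n) `|xi 0 i|.
have dM y : `|dot (dphi y) xi| <= M.
  rewrite /dot /M mulr_sumr; apply: le_trans (ler_norm_sum _ _ _) _.
  by apply: ler_sum => i _; rewrite normrM ler_wpM2r.
have iF s : `]t - 1, t + 1[%classic s -> mu.-integrable setT (EFin \o F s).
  move=> _; apply: (@integrableM_bounded _ _ _ _ _ _ _ Bp) => //.
  apply: measurableT_comp; first exact: continuous_measurable_rV.
  exact: measurable_translate.
have M0 : 0 <= M by apply: le_trans (dM 0).
pose Gd y := `|f y| * M.
have iG : mu.-integrable setT (EFin \o Gd).
  apply: (@integrableM_bounded _ _ _ _ _ _ (cst M) M) => //.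
    exact: integrable_norm.
  by move=> x _; rewrite ger0_norm.
have tI : `]t - 1, t + 1[%classic t by rewrite /= in_itv/=; lra.
have dder s y : `]t - 1, t + 1[%classic s -> [set: 'rV[R]_n] y -> derivable (F ^~ y) s 1.
  by move=> _ _; have [] := dF s y.
have Gd0 y : 0 <= Gd y by rewrite mulr_ge0.
have dub s y : `]t - 1, t + 1[%classic s -> [set: 'rV[R]_n] y -> `|partial1of2 F s y| <= Gd y.
  move=> _ _; rewrite partial1of2E; have [_ ->] := dF s y.
  by rewrite normrM ler_wpM2l.
have D := cvg_differentiation_under_integral measurableT tI iF dder Gd0 iG dub.
apply: DeriveDef.
  exact: (derivable_under_integral measurableT tI iF dder Gd0 iG dub).
have := differentiation_under_integral measurableT tI iF dder Gd0 iG dub.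
rewrite derive1E => ->; apply: eq_Rintegral => y _.
by rewrite partial1of2E; have [_ ->] := dF t y.
Qed.

End directional_derivative.

(** * Directional Lipschitz bounds and bounds on the weak gradient *)

Section lipschitz_gradient.
Context {R : realType} {n : nat}.
Local Notation mu := (lebesgue_rV R n).
Variables (f : 'rV[R]_n -> R) (G : 'rV[R]_n -> 'rV[R]_n).
Hypothesis cf : continuous f.
Hypothesis intf : mu.-integrable setT (EFin \o f).
Hypothesis intG : forall i, mu.-integrable setT (EFin \o (fun x => G x 0 i)).
Hypothesis wG : forall phi i, test_function phi ->
  \int[mu]_x (f x * 'D_(delta_mx 0 i) phi x) = - \int[mu]_x (G x 0 i * phi x).
Implicit Types (xi x a b : 'rV[R]_n).

Let mf : measurable_fun setT f. Proof. exact: continuous_measurable_rV. Qed.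

Let mbump m a b : measurable_fun setT (@bumpfun R n m a b).
Proof. by apply: continuous_measurable_rV; exact: continuous_bump. Qed.

Let mM (u w : 'rV[R]_n -> R) : measurable_fun setT u -> measurable_fun setT w ->
  measurable_fun setT (EFin \o (fun x => u x * w x)).
Proof. by move=> mu' mw; apply/measurable_EFinP; exact: measurable_funM. Qed.

(** A function with two readings: with the shift on the bump it can be differentiated in [s], with
    the shift on [f] (see [conv_shift]) its increments average those of [f]. *)
Let conv m a b xi (s : R) := \int[mu]_y (f y * bumpfun m a b (y + s *: xi)).

Let bump_shift m a b xi (s : R) :
  \int[mu]_y bumpfun m a b (y + s *: xi) = \int[mu]_y bumpfun m a b y.
Proof.
apply: (congr1 fine).
by rewrite (integral_translate (s *: xi) (f := EFin \o bumpfun m a b))//; exact/measurable_EFinP.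
Qed.

Let conv_shift m a b xi (s : R) :
  conv m a b xi s = \int[mu]_y (f (y - s *: xi) * bumpfun m a b y).
Proof.
apply: (congr1 fine).
rewrite -(integral_translate (s *: xi) (f := fun y => (f (y - s *: xi) * bumpfun m a b y)%:E)).
  by apply: eq_integral => y _; rewrite addrK.
apply: mM => //; apply: measurableT_comp => //; exact: (measurable_translate (- (s *: xi))).
Qed.

Let integrable_shift_bump m a b xi (s : R) :
  mu.-integrable setT (EFin \o (fun y => f (y + s *: xi) * bumpfun m a b y)).
Proof.
apply: (@integrableM_bounded _ _ _ _ _ _ _ 1) => //.
  exact: (integrable_translate (s *: xi) intf).
by move=> x _; rewrite ger0_norm ?bump_ge0 ?bump_le1.
Qed.

(** The derivative falls on the bump, whose translate is again a bump and hence a test function; the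
    weak gradient then takes it over. *)
Let conv_derive m a b xi (t : R) : 0 < m ->
  is_derive t (1 : R) (conv m a b xi)
    (- \int[mu]_y (dot (G y) xi * bumpfun m a b (y + t *: xi))).
Proof.
move=> m0; have sb := smooth_bounded_bump m a b.
have [_ _ [dphi [dE dB]]] := sb.
have D := is_derive_convolution intf xi t sb dE dB.
apply: is_derive_eq.
have E : (fun y => bumpfun m a b (y + t *: xi)) = bumpfun m (a - t *: xi) (b - t *: xi).
  by apply/funext => y; rewrite bump_translate.
apply: (weak_gradient_dir intf intG wG (phi := fun y => bumpfun m a b (y + t *: xi))
  (dphi := fun y => dphi (y + t *: xi))).
- by rewrite E; exact: test_function_bump.
- by rewrite E; exact: smooth_bounded_bump.
- move=> x v; have [d1 d2] := dE (x + t *: xi) v.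
  have e h : h^-1 *: (bumpfun m a b (h *: v + (x + t *: xi)) - bumpfun m a b (x + t *: xi)) =
    h^-1 *: ((fun y => bumpfun m a b (y + t *: xi)) (h *: v + x) -
      (fun y => bumpfun m a b (y + t *: xi)) x) by rewrite addrA.
  apply: DeriveDef.
    by rewrite /derivable; under eq_fun do rewrite -e; exact: d1.
  by rewrite /derive; under eq_fun do rewrite -e; exact: d2.
- by have [B hB] := dB; exists B => y i; exact: hB.
Qed.

Let integrable_dot_bump m a b xi : 0 < m ->
  mu.-integrable setT (EFin \o (fun y => dot (G y) xi * bumpfun m a b y)).
Proof.
move=> m0.
by have [_] := smooth_bounded_integrable intf intG (smooth_bounded_bump m a b); exact.
Qed.

(** If the bound failed at a point, it would fail by a fixed amount on the support of a bump around
    it. The averaged increment would then be too large for the mean value theorem, as the derivative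
    of [conv] is at most c times the integral of the bump. *)
Lemma lip_le_of_grad_le xi (c : R) : 0 <= c ->
  {ae mu, forall x, `|dot (G x) xi| <= c} ->
  forall x (t : R), 0 < t -> `|f (x + t *: xi) - f x| <= c * t.
Proof.
(* The one-sided bound for -xi, started at the other end of the segment, gives the other side. *)
suff h xi' : 0 <= c -> {ae mu, forall x, `|dot (G x) xi'| <= c} ->
    forall x (t : R), 0 < t -> f (x + t *: xi') - f x <= c * t.
  move=> c0 Gc x t t0; rewrite ler_norml; apply/andP; split; last exact: h.
  have := h (- xi) c0 _ (x + t *: xi) t t0.
  rewrite scalerN addrK => h'; rewrite lerNl opprB; apply: h'.
  apply: filterS Gc => y; rewrite (_ : dot _ (- xi) = - dot (G y) xi) ?normrN//.
  by rewrite /dot -sumrN; apply: eq_bigr => i _; rewrite mxE mulrN.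
move=> c0 Gc x0 t t0; rewrite leNgt; apply/negP => lt.
(* Half of the excess; the other half is spent on continuity. *)
pose e := (f (x0 + t *: xi') - f x0 - c * t) / 2.
have e0 : 0 < e by rewrite divr_gt0// subr_gt0.
have cD : continuous (fun x => f (x + t *: xi') - f x).
  move=> x; have h1 : {for x, continuous (fun x : 'rV[R]_n => f (x + t *: xi'))}.
    apply: (@continuous_comp _ _ _ (fun x : 'rV[R]_n => x + t *: xi') f); last exact: cf.
    exact: (cvgD cvg_id (cvg_cst _)).
  by apply: continuousB => //; exact: cf.
have /cvgrPdist_lt/(_ _ e0) /nbhs_ballP[d /= d0 db] := cD x0.
pose a := x0 - const_mx d; pose b := x0 + const_mx d.
have D : forall y, e + c * t <= f (y + t *: xi') - f y \/ bumpfun 1 a b y = 0.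
  move=> y; have [->|h] := eqVneq (bumpfun 1 a b y) 0; [by right|left].
  have : ball x0 d y.
    rewrite ball_rVE// => i /=; rewrite in_itv/=.
    by have := bump_neq0 i ltr01 h; rewrite !mxE.
  by move=> /db/=; rewrite /e ltr_norml => /andP[_]; lra.
have B0 : 0 < \int[mu]_y bumpfun 1 a b y.
  by apply: integral_bump_gt0 => // i; rewrite !mxE; lra.
have iB : mu.-integrable setT (EFin \o bumpfun 1 a b) by exact: integrable_bump.
pose df (s : R) := - \int[mu]_y (dot (G y) xi' * bumpfun 1 a b (y + s *: xi')).
have dfb s : `|df s| <= c * \int[mu]_y bumpfun 1 a b y.
  rewrite /df normrN -(bump_shift 1 a b xi' s).
  have E : (fun y => bumpfun 1 a b (y + s *: xi')) = bumpfun 1 (a - s *: xi') (b - s *: xi').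
    by apply/funext => y; rewrite bump_translate.
  rewrite [X in `|X|](_ : _ = \int[mu]_y (dot (G y) xi' * bumpfun 1 (a - s *: xi') (b - s *: xi') y)); last first.
    by apply: eq_Rintegral => y _; rewrite -E.
  rewrite E; apply: RintegralM_le => //.
  - exact: measurable_dot.
  - by move=> y; exact: bump_ge0.
  - exact: integrable_bump.
  - exact: integrable_dot_bump.
have nt0 : - t < 0 by rewrite oppr_lt0.
(* The interval is [-t, 0] because [conv] at s averages f(y - s xi'). *)
have [z _] : exists2 z, z \in `]- t, 0[ & conv 1 a b xi' 0 - conv 1 a b xi' (- t) = df z * (0 - - t).
  apply: (MVT nt0) => [z _|]; first exact: conv_derive.
  apply: derivable_within_continuous => z _.
  by have [] := conv_derive a b xi' z ltr01.
rewrite sub0r opprK => Ez.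
have : (e + c * t) * \int[mu]_y bumpfun 1 a b y <= conv 1 a b xi' (- t) - conv 1 a b xi' 0.
  rewrite !conv_shift scale0r scaleNr opprK oppr0.
  rewrite [X in _ <= _ - X](_ : _ = \int[mu]_y (f y * bumpfun 1 a b y)); last first.
    by apply: eq_Rintegral => y _; rewrite addr0.
  rewrite -RintegralB//; last first.
    have := integrable_shift_bump 1 a b xi' 0; rewrite scale0r.
    by under eq_fun do rewrite addr0.
  rewrite -RintegralZl//; apply: le_Rintegral => //.
  - exact: integrableZR.
  - apply: integrableBR => //.
    have := integrable_shift_bump 1 a b xi' 0; rewrite scale0r.
    by under eq_fun do rewrite addr0.
  - move=> y _; rewrite -mulrBl; have [h|->] := D y; last by rewrite !mulr0.
    by rewrite ler_wpM2r// bump_ge0.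
rewrite -opprB Ez => h2; have := dfb z; rewrite ler_norml => /andP[h1 _].
move: h2; rewrite -mulNr mulrDl.
have : - df z * t <= c * (\int[mu]_y bumpfun 1 a b y) * t.
  by apply: ler_wpM2r; [exact: ltW|rewrite lerNl].
have : 0 < e * \int[mu]_y bumpfun 1 a b y by rewrite mulr_gt0.
move=> eI h2 h3; have := le_trans h3 h2.
by rewrite (mulrAC c t) gerDr leNgt eI.
Qed.

(** Up to sign, the integral is the derivative of [conv] at 0, a limit of averages of difference
    quotients of [f] that are all bounded by [c]. *)
Lemma grad_bump_le m a b xi (c : R) : 0 < m -> 0 <= c ->
  (forall x (t : R), 0 < t -> `|f (x + t *: xi) - f x| <= c * t) ->
  `|\int[mu]_y (dot (G y) xi * bumpfun m a b y)| <= c * \int[mu]_y bumpfun m a b y.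
Proof.
move=> m0 c0 lip.
have iB : mu.-integrable setT (EFin \o bumpfun m a b) by exact: integrable_bump.
have B0 : 0 <= \int[mu]_y bumpfun m a b y by apply: Rintegral_ge0 => y _; exact: bump_ge0.
have := conv_derive a b xi 0 m0.
under eq_Rintegral do rewrite scale0r addr0.
set I := \int[mu]_y _ => -[dF dE].
have hc : h^-1 *: (conv m a b xi (h *: (1 : R) + 0) - conv m a b xi 0) @[h --> 0^'] --> - I.
  by move: dF => /cvg_ex[l hl]; rewrite -dE /derive (cvg_lim _ hl).
rewrite -normrN; move: hc => /cvg_norm hc.
apply: (ler_cvg_to hc (cvg_cst (c * \int[mu]_y bumpfun m a b y))).
near=> h; rewrite /= [h *: 1]mulr1 addr0.
have h0 : h != 0 by near: h; exact: nbhs_dnbhs_neq.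
rewrite [_ *: _]/GRing.scale/= normrM normfV ler_pdivrMl ?normr_gt0//.
rewrite !conv_shift scale0r oppr0.
under [X in `|_ - X|]eq_Rintegral do rewrite addr0.
have i0 : mu.-integrable setT (EFin \o (fun y => f y * bumpfun m a b y)).
  have := integrable_shift_bump m a b xi 0; rewrite scale0r.
  by under eq_fun do rewrite addr0.
have ih : mu.-integrable setT (EFin \o (fun y => f (y - h *: xi) * bumpfun m a b y)).
  by rewrite -scaleNr; exact: integrable_shift_bump.
rewrite -RintegralB// mulrCA mulrA.
rewrite [X in `|X|](_ : _ = \int[mu]_y ((f (y - h *: xi) - f y) * bumpfun m a b y)); last first.
  by apply: eq_Rintegral => y _; rewrite mulrBl.
have lip' y : `|f (y - h *: xi) - f y| <= c * `|h|.
  have [hp|hn|hz] := ltgtP 0 h; last by rewrite -hz eqxx in h0.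
    rewrite distrC (gtr0_norm hp); have := lip (y - h *: xi) h hp; by rewrite subrK.
  rewrite -scaleNr (ltr0_norm hn); apply: lip; by rewrite oppr_gt0.
apply: RintegralM_le => //.
- by rewrite mulr_ge0.
- apply: measurable_funB => //; apply: measurableT_comp => //.
  exact: (measurable_translate (- (h *: xi))).
- by apply: aeW => y; exact: lip'.
- by move=> y; exact: bump_ge0.
- by under eq_fun do rewrite mulrBl; exact: integrableBR.
Unshelve. all: by end_near. Qed.

Lemma dyadic_cubeE k (z : 'rV[int]_n) :
  @dyadic R n k @^-1` [set z] =
  box (\row_i ((z 0 i)%:~R / 2 ^+ k)) (\row_i ((z 0 i + 1)%:~R / 2 ^+ k)).
Proof.
apply/seteqP; split=> x /=.
  move=> <- i; rewrite !mxE ler_pdivrMr ?exprn_gt0// ltr_pdivlMr ?exprn_gt0// mulrC.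
  by rewrite -floor_eq.
move=> h; apply/rowP => i; rewrite mxE; apply/eqP; rewrite floor_eq.
have := h i; rewrite !mxE ler_pdivrMr ?exprn_gt0// ltr_pdivlMr ?exprn_gt0//.
by rewrite mulrC.
Qed.

(** [ae_ge0_dyadic] is applied to c - sg <G, xi> for both signs [sg]. The integral over a cube is
    the limit of integrals against [bump_seq], which are nonnegative by [grad_bump_le]. *)
Lemma grad_le_of_lip_le xi (c : R) : 0 <= c ->
  (forall x (t : R), 0 < t -> `|f (x + t *: xi) - f x| <= c * t) ->
  {ae mu, forall x, `|dot (G x) xi| <= c}.
Proof.
move=> c0 lip.
suff h (sg : R) : `|sg| = 1 -> {ae mu, forall x, 0 <= c - sg * dot (G x) xi}.
  have h1 := h 1 (normr1 _); have h2 := h (-1) (etrans (normrN _) (normr1 _)).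
  near=> x; rewrite ler_norml.
  have : 0 <= c - 1 * dot (G x) xi by near: x.
  have : 0 <= c - -1 * dot (G x) xi by near: x.
  by move=> u1 u2; apply/andP; split; lra.
move=> sg1; pose w x := c - sg * dot (G x) xi.
have iw A : measurable A -> (mu A < +oo)%E -> mu.-integrable A (EFin \o w).
  move=> mA Afin.
  have i1 : mu.-integrable A (EFin \o (cst c : 'rV[R]_n -> R)).
    apply/integrableP; split; first exact/measurable_EFinP.
    by rewrite /= integral_cst// lte_mul_pinfty.
  have i2 : mu.-integrable A (EFin \o (fun x => dot (G x) xi * sg)).
    apply: (integrableS measurableT mA) => //.
    apply: (@integrableM_bounded _ _ _ _ _ _ (cst sg) `|sg|) => //.
    exact: integrable_dot.
  rewrite (_ : w = fun x => cst c x - dot (G x) xi * sg); first exact: integrableBR.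
  by apply/funext => x; rewrite /w mulrC.
apply: ae_ge0_dyadic => k z; rewrite dyadic_cubeE; set a := \row_i _; set b := \row_i _.
  by apply: iw; [exact: measurable_box|exact: lebesgue_rV_box_fin].
(* Constants are integrable only on sets of finite measure, so one works in a bounded box containing
   the supports of all the bumps, whose shifts are at most 1. *)
pose a' := a - const_mx 1.
pose B := box a' b.
have mB : measurable B by exact: measurable_box.
have iwB : mu.-integrable B (EFin \o w) by apply: iw => //; exact: lebesgue_rV_box_fin.
have supp j x : ~ B x -> bump_seq a b j x = 0.
  move=> nB; apply: contrapT => /eqP h; apply: nB => i.
  have j0 : 0 < j.+1%:R ^+ 2 :> R by rewrite exprn_gt0.
  have /andP[h1 ->] := bump_neq0 i j0 h; rewrite andbT; apply/ltW; apply: le_lt_trans h1.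
  by rewrite !mxE lerD2l lerN2 invf_le1// ler1n.
have sub : box a b `<=` B.
  move=> x h i; have /andP[h1 ->] := h i; rewrite andbT; apply: le_trans h1.
  by rewrite !mxE; lra.
have mw : measurable_fun B w by apply/measurable_EFinP; exact: measurable_int iwB.
have bs0 j x : 0 <= bump_seq a b j x by exact: bump_ge0.
have mbs j : measurable_fun setT (bump_seq a b j) by exact: mbump.
have ibs j : mu.-integrable setT (EFin \o bump_seq a b j).
  by apply: integrable_bump; rewrite exprn_gt0.
have pos j : (0 <= \int[mu]_(x in B) (w x * bump_seq a b j x)%:E)%E.
  have iwb : mu.-integrable B (EFin \o (fun x => w x * bump_seq a b j x)).
    apply: (@integrableM_bounded _ _ _ _ _ _ _ 1) => //; first exact: measurable_funTS.
    by move=> x _; rewrite ger0_norm ?bump_ge0 ?bump_le1.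
  have j0 : 0 < j.+1%:R ^+ 2 :> R by rewrite exprn_gt0.
  have idb := integrable_dot_bump (a - const_mx j.+1%:R^-1) b xi j0.
  (* The bump vanishes outside [B], so the integral extends to the whole space, where [grad_bump_le]
     applies. *)
  rewrite integral_mkcond (eq_integral (fun x => (c * bump_seq a b j x -
      sg * (dot (G x) xi * bump_seq a b j x))%:E)); last first.
    move=> x _; rewrite /patch; case: ifPn => [_|/negP xB].
      by rewrite /w mulrBl mulrA.
    by rewrite supp ?mulr0 ?subr0 ?mulr0//; move/mem_set.
  have i1 : mu.-integrable setT (EFin \o (fun x => c * bump_seq a b j x)).
    exact: integrableZR.
  have i2 : mu.-integrable setT (EFin \o (fun x => sg * (dot (G x) xi * bump_seq a b j x))).
    exact: integrableZR.
  have i3 : mu.-integrable setT (EFin \o (fun x => c * bump_seq a b j x - sg * (dot (G x) xi * bump_seq a b j x))).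
    exact: integrableBR.
  rewrite -(fineK (integrable_fin_num measurableT i3)) lee_fin.
  rewrite [leRHS](_ : _ = \int[mu]_x (c * bump_seq a b j x - sg * (dot (G x) xi * bump_seq a b j x)))//.
  rewrite RintegralB// RintegralZl// RintegralZl//.
  have := grad_bump_le (a - const_mx j.+1%:R^-1) b j0 c0 lip.
  rewrite subr_ge0 => h; apply: le_trans h; apply: le_trans (ler_norm _) _.
  by rewrite normrM sg1 mul1r.
have lim : (\int[mu]_(x in B) (w x * bump_seq a b j x)%:E)%E @[j --> \oo] -->
    (\int[mu]_(x in B) (w x * \1_(box a b) x)%:E)%E.
  apply: (@dominated_cvg _ _ _ _ _ mB _ _ (fun x => `|w x|%:E)%E).
  - move=> j; apply/measurable_EFinP; apply: measurable_funM => //; exact: measurable_funTS.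
  - move=> x Bx; apply: cvg_EFin; first exact: nearW.
    apply: cvgM; [exact: cvg_cst|exact: cvg_bump_seq].
  - by [].
  - exact: integrable_norm.
  - move=> j x Bx; rewrite /= lee_fin normrM ler_piMr// ger0_norm ?bump_ge0 ?bump_le1//.
rewrite [leRHS](_ : _ = \int[mu]_(x in B) (w x * \1_(box a b) x)%:E)%E; last first.
  rewrite integral_mkcond [RHS]integral_mkcond; apply: eq_integral => x _.
  rewrite /patch indicE; have [xb|xb] := boolP (x \in box a b).
    by rewrite mem_set ?mulr1//; apply: sub; exact: set_mem.
  by rewrite mulr0; case: ifP.
rewrite -(cvg_lim _ lim)//; apply: lime_ge; first by apply/cvg_ex; eexists; exact: lim.
by near=> j; exact: pos.
Unshelve. all: by end_near. Qed.

End lipschitz_gradient.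

(** * Gauges of sets given by homogeneous functions *)

Section gauge_of_unit_ball.
Context {R : realType} {n : nat}.
Local Open Scope ereal_scope.

(** By homogeneity [xi] lies in the dilate by l exactly when N xi <= l, so the gauge is the infimum
    of the positive reals l above N xi; with no such l it is +oo, as is N xi. *)
Lemma gauge_unit_ball (N : 'rV[R]_n -> \bar R) xi :
  (forall x, 0 <= N x) ->
  (forall (c : R) x, (0 < c)%R -> N (c *: x)%R = c%:E * N x) ->
  gauge [set x | N x <= 1] xi = N xi.
Proof.
move=> N0 Nh; rewrite /gauge.
rewrite (_ : [set l : R | _] = [set l : R | (0 < l)%R /\ N xi <= l%:E]); last first.
  apply/seteqP; split=> l /= [l0].
    move=> [y Ny <-]; split=> //; rewrite Nh// -[leRHS]mule1 lee_pmul2l//.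
  move=> Nl; split=> //; exists (l^-1 *: xi)%R; last first.
    by rewrite scalerA mulfV ?gt_eqF// scale1r.
  rewrite /= Nh ?invr_gt0//.
  by rewrite -(@lee_pmul2l _ l%:E)// muleA -EFinM mulfV ?gt_eqF// mul1e mule1.
apply/eqP; rewrite eq_le; apply/andP; split; last first.
  by apply: le_ereal_inf_tmp => _ [l [_ Nl] <-].
have := N0 xi; case: (N xi) => [a| |]; rewrite ?leey// => a0.
(* The slack [e] keeps the dilation positive when N xi = 0. *)
apply/lee_addgt0Pr => e e0; apply: ereal_inf_lbound; exists (a + e)%R => //; split.
  by move: a0; rewrite lee_fin => a0; rewrite ltr_wpDl.
by rewrite lee_fin lerDl ltW.
Qed.

End gauge_of_unit_ball.

(** * Dilations of the half-line *)

Section lebesgue_dilation.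
Context {R : realType}.
Local Open Scope ereal_scope.
Local Notation leb := (@lebesgue_measure R).

Lemma lebesgue_measure_dilate (c : R) (A : set R) : (0 < c)%R -> measurable A ->
  c%:E * leb ((fun t : R => c * t)%R @^-1` A) = leb A.
Proof.
move=> c0 mA.
have mf : measurable_fun setT (fun t : measurableTypeR R => c * t : measurableTypeR R)%R.
  exact: measurable_funM.
pose F : {mfun measurableTypeR R >-> measurableTypeR R} :=
  HB.pack (fun t : measurableTypeR R => c * t : measurableTypeR R)%R
  (isMeasurableFun.Build _ _ _ _ _ mf).
pose cn : {nonneg R} := NngNum (ltW c0).
apply/esym/(lebesgue_measure_unique (mu := mscale cn (pushforward leb F))) => //.
move=> _ [[a b]] _ <-.
transitivity (c%:E * leb `](a / c)%R, (b / c)%R]%classic).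
  rewrite !lebesgue_measure_itv/= !lte_fin ltr_pM2r ?invr_gt0//.
  case: ifP => _; last by rewrite mule0.
  by rewrite -!EFinB -EFinM -mulrBl mulrCA mulfV ?mulr1// gt_eqF.
rewrite /mscale /=; congr (_ * leb _).
apply/seteqP; split=> t /=; rewrite !in_itv/= ltr_pdivrMr// ler_pdivlMr//;
  by rewrite mulrC.
Qed.

Lemma ge0_integral_dilate (c : R) (g : R -> \bar R) : (0 < c)%R ->
  measurable_fun setT g -> (forall t, 0 <= g t) ->
  c%:E * \int[leb]_(t in `]0%R, +oo[) g (c * t)%R = \int[leb]_(t in `]0%R, +oo[) g t.
Proof.
move=> c0 mg g0.
have mf : measurable_fun setT (fun t : measurableTypeR R => c * t : measurableTypeR R)%R.
  exact: measurable_funM.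
pose F : {mfun measurableTypeR R >-> measurableTypeR R} :=
  HB.pack (fun t : measurableTypeR R => c * t : measurableTypeR R)%R
  (isMeasurableFun.Build _ _ _ _ _ mf).
pose cn : {nonneg R} := NngNum (ltW c0).
have mI : measurable (`]0%R, +oo[%classic : set (measurableTypeR R)) by exact: measurable_itv.
have S : \int[mscale cn (pushforward leb F)]_(t in `]0%R, +oo[) g t =
    c%:E * \int[pushforward leb F]_(t in `]0%R, +oo[) g t.
  by move=> m; rewrite ge0_integral_mscale//; exact: measurable_funTS.
have E := ge0_integral_pushforward mf leb mI (measurable_funTS mg).
rewrite [X in _ * X](_ : _ = \int[leb]_(t in (fun t : R => c * t)%R @^-1` `]0%R, +oo[%classic) (g \o (fun t => c * t)%R) t).
  rewrite -E//.
  rewrite -[LHS]S; apply: eq_measure_integral => A mA _.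
  by rewrite -[RHS](lebesgue_measure_dilate c0 mA).
congr (integral _ _ _).
by apply/seteqP; split=> t /=; rewrite !in_itv/= !andbT pmulr_rgt0.
Qed.

Lemma ge0_integral_dilateZ (c k : R) (g : R -> \bar R) : (0 < c)%R -> (0 <= k)%R ->
  measurable_fun setT g -> (forall t, 0 <= g t) ->
  k%:E * \int[leb]_(t in `]0%R, +oo[) g t =
  \int[leb]_(t in `]0%R, +oo[) ((k * c)%:E * g (c * t)%R).
Proof.
move=> c0 k0 mg g0; rewrite -(ge0_integral_dilate c0 mg g0) muleA -EFinM.
rewrite ge0_integralZl//; last by rewrite lee_fin mulr_ge0// ltW.
by apply: measurable_funTS; apply: measurableT_comp => //; exact: measurable_funM.
Qed.

End lebesgue_dilation.

(** * The radial function on the sphere *)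

Section radial_function.
Context {R : realType} {n : nat}.
Local Open Scope ereal_scope.
Variable K : set 'rV[R]_n.
Hypotheses (K_star : star_body K) (K_bounded : bounded_set K).
Implicit Types xi x : 'rV[R]_n.

(** On the sphere the radial function of [K] is finite because [K] is bounded, so [fine] loses
    nothing there (see [radialE]). *)
Definition rho xi : R := fine (radial K xi).

Lemma coord_le_norm x i : (`|x 0 i| <= `|x|)%R.
Proof.
by rewrite [leRHS]/Num.Def.normr /= mx_normrE; apply/bigmax_geP; right => /=; exists (ord0, i).
Qed.

Lemma sphere_neq0 xi : sphere n xi -> xi != 0%R.
Proof.
move=> h; apply/eqP => xi0; move: h; rewrite /sphere /= /enorm /dot xi0 big1.
  by rewrite sqrtr0 => /esym/eqP; rewrite oner_eq0.
by move=> i _; rewrite mxE mul0r.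
Qed.

Lemma sphere_dim_gt0 xi : sphere n xi -> (0 < n)%N.
Proof.
move=> /sphere_neq0/eqP xi0; have [i _] : exists i : 'I_n, True.
  by apply: contrapT => h; apply: xi0; apply/rowP => i; exfalso; apply: h; exists i.
exact: leq_ltn_trans (leq0n i) (ltn_ord i).
Qed.

(** Compares the sup norm, in which [K] is bounded, with the Euclidean one. The sharp constant is
    n^(-1/2); the smaller 1/n avoids roots. *)
Lemma sphere_norm_lb xi : sphere n xi -> (n%:R^-1 <= `|xi|)%R.
Proof.
move=> Sxi; have n0 := sphere_dim_gt0 Sxi; move: Sxi.
rewrite /sphere /= /enorm => h; rewrite leNgt; apply/negP => lt.
have n1 : (1 <= n%:R :> R)%R by rewrite ler1n.
have : (dot xi xi = 1)%R by rewrite -[LHS]sqr_sqrtr ?h ?expr1n//; apply: sumr_ge0 => i _; rewrite -expr2 sqr_ge0.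
suff : (dot xi xi < 1)%R by move=> /[swap] ->; rewrite ltxx.
apply: (@le_lt_trans _ _ (\sum_(i < n) `|xi| ^+ 2)%R).
  by apply: ler_sum => i _; rewrite -expr2 -real_normK ?num_real// lerXn2r ?nnegrE ?coord_le_norm.
rewrite sumr_const card_ord -[(_ *+ n)%R]mulr_natr.
have h1 : (`|xi| * n%:R < 1)%R by rewrite -ltr_pdivlMr ?mul1r ?(lt_le_trans ltr01).
have h2 : (`|xi| < 1)%R by apply: lt_le_trans lt _; rewrite invf_le1// (lt_le_trans ltr01).
rewrite expr2 -mulrA; apply: le_lt_trans h2.
by rewrite ler_piMr// ltW.
Qed.

Lemma radial_ub : exists2 C : R, (0 < C)%R &
  forall xi (l : R), sphere n xi -> (0 < l)%R -> K (l *: xi)%R -> (l <= C)%R.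
Proof.
have [M [_ hM]] := K_bounded.
pose C := (`|M| + 1)%R; have C0 : (0 < C)%R by rewrite ltr_wpDl.
have CM : (M < C)%R by rewrite /C; apply: le_lt_trans (ler_norm M) _; rewrite ltrDl.
exists (C * n.+1%:R)%R; first by rewrite mulr_gt0.
move=> xi l Sxi l0 /(hM C CM); rewrite /= normrZ gtr0_norm// => h.
have h2 := sphere_norm_lb Sxi.
have n0 := sphere_dim_gt0 Sxi.
have n0' : (0 < n%:R :> R)%R by rewrite ltr0n.
have : (l * n%:R^-1 <= C)%R by apply: le_trans h; rewrite ler_pM2l.
rewrite ler_pdivrMr// => /le_trans; apply; rewrite ler_pM2l// ler_nat//.
Qed.

Lemma radialE xi : sphere n xi -> radial K xi = (rho xi)%:E.
Proof.
move=> Sxi; have [C C0 hC] := radial_ub; rewrite /rho fineK//.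
have [_ /(_ xi (sphere_neq0 Sxi)) r0 _] := K_star.
rewrite gt0_fin_numE//; apply: (@le_lt_trans _ _ C%:E); last exact: ltry.
by apply: ub_ereal_sup => _ [->|[l [l0 Kl] <-]]; rewrite lee_fin ?(ltW C0)//; exact: hC Kl.
Qed.

Lemma rho_gt0 xi : sphere n xi -> (0 < rho xi)%R.
Proof.
move=> Sxi; have [_ /(_ xi (sphere_neq0 Sxi)) r0 _] := K_star.
by rewrite -lte_fin -radialE.
Qed.

Lemma rho_ub : exists2 C : R, (0 < C)%R & forall xi, sphere n xi -> (rho xi <= C)%R.
Proof.
have [C C0 hC] := radial_ub; exists C => // xi Sxi; rewrite -lee_fin -radialE//.
by apply: ub_ereal_sup => _ [->|[l [l0 Kl] <-]]; rewrite lee_fin ?(ltW C0)//; exact: hC Kl.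
Qed.

(** Passing from l to 1/l exchanges the dilations in the gauge with those in the radial function,
    and the infimum with the supremum. *)
Lemma gaugeE xi : sphere n xi -> gauge K xi = ((rho xi)^-1)%:E.
Proof.
move=> Sxi; have r0 := rho_gt0 Sxi.
apply/eqP; rewrite eq_le; apply/andP; split.
  apply/lee_addgt0Pr => e e0; pose c := ((rho xi)^-1 + e)%R.
  have c0 : (0 < c)%R by rewrite addr_gt0 ?invr_gt0.
  have : (c^-1)%:E < radial K xi.
    by rewrite radialE// lte_fin invf_plt ?posrE// /c ltrDl.
  move=> /ereal_sup_gt[_ [->|[l [l0 Kl] <-]]].
    by rewrite lte_fin invr_lt0 ltNge (ltW c0).
  rewrite lte_fin => cl; rewrite -EFinD -/c.
  apply: (@le_trans _ _ (l^-1)%:E); last first.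
    by rewrite lee_fin invf_ple ?posrE// ltW.
  apply: ereal_inf_lbound; exists l^-1%R => //; split; first by rewrite invr_gt0.
  by exists (l *: xi)%R => //; rewrite scalerA mulVf ?gt_eqF// scale1r.
apply: le_ereal_inf_tmp => _ [l [l0 [y Ky lyx]] <-]; rewrite lee_fin invf_ple ?posrE//.
rewrite -lee_fin -radialE//; apply: ereal_sup_ubound; right; exists l^-1%R => //; split.
  by rewrite invr_gt0.
by rewrite -lyx scalerA mulVf ?gt_eqF// scale1r.
Qed.

(** The punctured space is open, so continuity within it is continuity at [xi]. *)
Lemma continuous_rho xi : sphere n xi -> {for xi, continuous rho}.
Proof.
move=> Sxi; have [_ _ /subspace_continuousP /(_ xi (sphere_neq0 Sxi)) cr] := K_star.
have op : open [set x : 'rV[R]_n | x != 0%R].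
  rewrite (_ : [set x | _] = ~` [set 0%R]); last by apply/seteqP; split=> x /= /eqP.
  by apply: closed_openC; apply: accessible_closed_set1; apply: hausdorff_accessible; exact: norm_hausdorff.
move: cr; rewrite within_interior; last first.
  by apply: open_nbhs_nbhs; split=> //; exact: sphere_neq0.
move=> h; suff : radial K x @[x --> xi] --> (rho xi)%:E by move=> /fine_cvg.
by rewrite -radialE//; exact: h.
Qed.

End radial_function.

(** * Gauges of the polar projection bodies *)

Section polar_gauges.
Context {R : realType} {n : nat}.
Local Open Scope ereal_scope.
Local Notation mu := (lebesgue_rV R n).
Implicit Types (f : 'rV[R]_n -> R) (xi x : 'rV[R]_n) (s p c : R).

Lemma lebesgue_rVT_gt0 : 0 < mu setT.
Proof. by apply: (@lebesgue_rV_nbhs _ _ 0%R) => //; exact: filterT. Qed.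

Lemma dotZr x xi c : dot x (c *: xi)%R = (c * dot x xi)%R.
Proof. by rewrite /dot mulr_sumr; apply: eq_bigr => i _; rewrite mxE mulrCA. Qed.

Lemma powRVK (c a : R) : (0 < c)%R -> a != 0%R -> ((c `^ a) `^ a^-1 = c)%R.
Proof. by move=> c0 a0; rewrite -powRrM mulfV// powRr1// ltW. Qed.

Lemma poweRZVK (c a : R) (X : \bar R) : (0 < c)%R -> a != 0%R -> 0 <= X ->
  ((c `^ a)%:E * X) `^ a^-1 = c%:E * X `^ a^-1.
Proof.
move=> c0 a0 X0; rewrite poweRM ?lee_fin ?powR_ge0//.
by rewrite poweR_EFin powRVK.
Qed.

(** The power p s of [frac_polar_gauge], which is what remains under the integral of the dual mixed
    volume. *)
Definition frac_energy s p f xi : \bar R := (p * (1 - s))%:E *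
  \int[lebesgue_measure]_(t in `]0%R, +oo[)
    ((t `^ (- p * s - 1))%:E *
      \int[mu]_x (`|f (x + t *: xi)%R - f x| `^ p)%:E).

Lemma frac_energy_ge0 s p f xi : (0 <= p)%R -> (s <= 1)%R -> 0 <= frac_energy s p f xi.
Proof.
move=> p0 s1; rewrite /frac_energy mule_ge0//.
  by rewrite lee_fin mulr_ge0// subr_ge0.
apply: integral_ge0 => t _; rewrite mule_ge0 ?lee_fin ?powR_ge0//.
by apply: integral_ge0 => x _; rewrite lee_fin powR_ge0.
Qed.

Lemma measurable_translates f xi p : measurable_fun setT f ->
  measurable_fun setT (fun t : R => \int[mu]_x (`|f (x + t *: xi)%R - f x| `^ p)%:E).
Proof.
move=> mf.
pose g (z : R * 'rV[R]_n) := (`|f (z.2 + z.1 *: xi)%R - f z.2| `^ p)%:E.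
apply: (@measurable_fun_fubini_tonelli_F _ _ _ _ _ mu g).
  apply/measurable_EFinP.
  apply: (@measurableT_comp _ _ _ _ _ _ (fun r : R => r `^ p)%R).
    exact: measurable_powR.
  apply: measurableT_comp => //; apply: measurable_funB; last exact: measurableT_comp.
  apply: measurableT_comp => //; apply: measurable_fun_rVP => i.
  under eq_fun do rewrite !mxE.
  apply: measurable_funD.
    by apply: (@measurableT_comp _ _ _ _ _ _ (fun x : 'rV[R]_n => x 0%R i));
      [exact: measurable_coord|exact: measurable_snd].
  by apply: measurable_funM => //; exact: measurable_fst.
by move=> z; rewrite lee_fin powR_ge0.
Qed.

(** Substitution of c t for t: the weight t^(-p s - 1) dt is homogeneous of degree -p s. *)
Lemma frac_energyZ s p f xi c : measurable_fun setT f -> (0 < c)%R -> (0 <= p)%R -> (s <= 1)%R ->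
  frac_energy s p f (c *: xi)%R = (c `^ (p * s))%:E * frac_energy s p f xi.
Proof.
move=> mf c0 p0 s1; rewrite /frac_energy muleCA; congr (_ * _).
pose g (t : R) : \bar R := (t `^ (- p * s - 1))%:E *
  \int[mu]_x (`|f (x + t *: xi)%R - f x| `^ p)%:E.
have mg : measurable_fun setT g.
  apply: emeasurable_funM; last exact: measurable_translates.
  by apply/measurable_EFinP; exact: measurable_powR.
have g0 t : 0 <= g t.
  rewrite mule_ge0 ?lee_fin ?powR_ge0//.
  by apply: integral_ge0 => x _; rewrite lee_fin powR_ge0.
have mI : measurable (`]0%R, +oo[%classic : set (measurableTypeR R)) by exact: measurable_itv.
rewrite [RHS](ge0_integral_dilateZ c0 (powR_ge0 c (p * s)) mg g0).
apply: eq_integral => t; rewrite inE/= in_itv/= andbT => t0.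
have E : (t `^ (- p * s - 1) = c `^ (p * s) * c * (c * t) `^ (- p * s - 1))%R.
  rewrite powRM ?(ltW c0) ?(ltW t0)// mulrA -[X in (_ * X * _ * _)%R](powRr1 (ltW c0)).
  rewrite -powRD; last by rewrite (gt_eqF c0) implybT.
  rewrite -powRD; last by rewrite (gt_eqF c0) implybT.
  by rewrite (_ : (p * s + 1 + _)%R = 0%R) ?powRr0 ?mul1r//; ring.
by rewrite E EFinM -muleA scalerA (mulrC t c).
Qed.

Lemma frac_polar_gaugeE s p f xi :
  frac_polar_gauge s p f xi = frac_energy s p f xi `^ (p * s)^-1.
Proof. by []. Qed.

Lemma gauge_frac_polar s p f xi : measurable_fun setT f ->
  (0 < p)%R -> (0 < s)%R -> (s <= 1)%R ->
  gauge (frac_polar_projection s p f) xi = frac_energy s p f xi `^ (p * s)^-1.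
Proof.
move=> mf p0 s0 s1; rewrite /frac_polar_projection.
rewrite (gauge_unit_ball (N := frac_polar_gauge s p f)) ?frac_polar_gaugeE//.
  by move=> x; rewrite frac_polar_gaugeE; exact: poweR_ge0.
move=> c x c0; rewrite !frac_polar_gaugeE (frac_energyZ x mf c0 (ltW p0) s1).
rewrite poweRZVK//; last exact: frac_energy_ge0 (ltW p0) s1.
by rewrite gt_eqF// mulr_gt0.
Qed.

Definition polar_energy p f xi : \bar R :=
  \int[mu]_x (`|dot (grad f x) xi| `^ p)%:E.

Lemma gauge_polar p f xi : (forall xi, measurable_fun setT (fun x => dot (grad f x) xi)) ->
  (0 < p)%R -> gauge (polar_projection p f) xi = polar_energy p f xi `^ p^-1.
Proof.
move=> mG p0; rewrite /polar_projection.
rewrite (gauge_unit_ball (N := polar_gauge p f))//.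
  by move=> x; exact: poweR_ge0.
move=> c x c0; rewrite /polar_gauge.
rewrite -poweRZVK ?gt_eqF//; last by apply: integral_ge0 => y _; rewrite lee_fin powR_ge0.
rewrite -ge0_integralZl//.
- congr (_ `^ _); apply: eq_integral => y _.
  by rewrite dotZr normrM (gtr0_norm c0) powRM ?(ltW c0)// EFinM.
- apply/measurable_EFinP; apply: (@measurableT_comp _ _ _ _ _ _ (fun r : R => r `^ p)%R).
    exact: measurable_powR.
  exact: measurableT_comp.
- by rewrite lee_fin powR_ge0.
Qed.

Definition frac_sup s f xi : \bar R :=
  ereal_sup [set (z.2 `^ (- s) * `|f (z.1 + z.2 *: xi)%R - f z.1|)%:E |
              z in [set: 'rV[R]_n] `*` `]0%R, +oo[].

Lemma frac_sup_ge s f xi x t : (0 < t)%R ->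
  (t `^ (- s) * `|f (x + t *: xi)%R - f x|)%:E <= frac_sup s f xi.
Proof.
move=> t0; apply: ereal_sup_ubound; exists (x, t) => //; split => //=.
by rewrite in_itv/= andbT.
Qed.

Lemma frac_sup_ge0 s f xi : 0 <= frac_sup s f xi.
Proof.
apply: le_trans (frac_sup_ge s f xi 0 ltr01).
by rewrite lee_fin mulr_ge0 ?powR_ge0.
Qed.

Lemma frac_supZ s f xi c : (0 < c)%R ->
  frac_sup s f (c *: xi)%R = (c `^ s)%:E * frac_sup s f xi.
Proof.
(* One inequality for every factor suffices: applied with the inverse factor it gives the reverse
   one. *)
have le c' x : (0 < c')%R -> frac_sup s f (c' *: x)%R <= (c' `^ s)%:E * frac_sup s f x.
  move=> c0; apply: ub_ereal_sup => _ [[y t] [_ /= +] <-].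
  rewrite in_itv/= andbT => t0.
  apply: le_trans (lee_wpmul2l _ (frac_sup_ge s f x y (mulr_gt0 t0 c0))).
    rewrite -EFinM lee_fin scalerA mulrA ler_wpM2r// powRM ?(ltW c0) ?(ltW t0)// mulrCA -powRD.
      by rewrite subrr powRr0 mulr1.
    by rewrite (gt_eqF c0) implybT.
  by rewrite lee_fin powR_ge0.
move=> c0; apply/eqP; rewrite eq_le le//=.
have cV0 : (0 < c^-1)%R by rewrite invr_gt0.
have := le _ (c *: xi)%R cV0; rewrite scalerA mulVf ?gt_eqF// scale1r => h.
apply: le_trans (lee_wpmul2l _ h) _; first by rewrite lee_fin powR_ge0.
by rewrite muleA -EFinM -powRM ?(ltW c0)// ?(ltW cV0)// mulfV ?gt_eqF// powR1 mul1e.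
Qed.

Lemma frac_polar_gauge_ooE s f xi :
  frac_polar_gauge_oo s f xi = frac_sup s f xi `^ s^-1.
Proof. by []. Qed.

Lemma gauge_frac_polar_oo s f xi : (0 < s)%R ->
  gauge (frac_polar_projection_oo s f) xi = frac_sup s f xi `^ s^-1.
Proof.
move=> s0; rewrite /frac_polar_projection_oo.
rewrite (gauge_unit_ball (N := frac_polar_gauge_oo s f)) ?frac_polar_gauge_ooE//.
  by move=> x; rewrite frac_polar_gauge_ooE; exact: poweR_ge0.
move=> c x c0; rewrite !frac_polar_gauge_ooE.
by rewrite frac_supZ// poweRZVK// ?gt_eqF// frac_sup_ge0.
Qed.

Lemma gauge_polar_oo f xi : gauge (polar_projection_oo f) xi = polar_gauge_oo f xi.
Proof.
rewrite /polar_projection_oo (gauge_unit_ball (N := polar_gauge_oo f))//.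
  move=> x; apply: ess_sup_gee; first exact: lebesgue_rVT_gt0.
  by apply: aeW => y; rewrite lee_fin.
move=> c x c0; rewrite /polar_gauge_oo -ess_sup_pZl//; congr (ess_sup _ _).
by apply/funext => y; rewrite /= dotZr normrM (gtr0_norm c0) EFinM.
Qed.

End polar_gauges.

(** * Limits of powers and of p-th roots *)

Section real_limits.
Context {R : realType}.

Lemma cvge_real (T : Type) (F : set_system T) {FF : Filter F} (J : T -> \bar R) (M : R) :
  (forall e : R, 0 < e -> \forall x \near F, ((M - e)%:E <= J x <= (M + e)%:E)%E) ->
  J x @[x --> F] --> M%:E.
Proof.
move=> h; apply/fine_cvgP; split.
  near=> x; have : ((M - 1)%:E <= J x <= (M + 1)%:E)%E by near: x; exact: h.
  by case: (J x) => [a| |] //=; rewrite ?leye_eq ?leeNy_eq ?andbF.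
apply/cvgrPdist_le => e e0; near=> x.
have : ((M - e)%:E <= J x <= (M + e)%:E)%E by near: x; exact: h.
rewrite /=; case: (J x) => [a| |] //=; rewrite ?leye_eq ?leeNy_eq ?andbF ?lee_fin//.
by rewrite ler_distlC.
Unshelve. all: by end_near. Qed.

Lemma powR_ge_near (b C : R) : 1 < b -> \forall p \near +oo, C <= b `^ p.
Proof.
move=> b1; have l0 : 0 < ln b by rewrite ln_gt0.
apply: filterS (nbhs_pinfty_ge (num_real ((C - 1) / ln b))) => p.
rewrite ler_pdivrMr// => h; rewrite /powR gt_eqF ?(lt_trans ltr01)//.
by apply: le_trans (expR_ge1Dx _); rewrite -lerBlDl.
Qed.

Lemma ler_powR_near (a b C : R) : 0 < a -> a < b ->
  \forall p \near +oo, C * a `^ p <= b `^ p.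
Proof.
move=> a0 ab; have ba : 1 < b / a by rewrite ltr_pdivlMr ?mul1r.
apply: filterS (powR_ge_near C ba) => p h.
have -> : b `^ p = (b / a) `^ p * a `^ p.
  by rewrite -powRM ?divr_ge0 ?(ltW a0) ?(ltW (lt_trans a0 ab))// divfK ?gt_eqF.
by rewrite ler_wpM2r// powR_ge0.
Qed.

Lemma p_ler_powR_near (a b : R) : 0 < a -> a < b ->
  \forall p \near +oo, p * a `^ p <= b `^ p.
Proof.
move=> a0 ab; have ba : 1 < b / a by rewrite ltr_pdivlMr ?mul1r.
have l0 : 0 < ln (b / a) by rewrite ln_gt0.
near=> p.
have -> : b `^ p = (b / a) `^ p * a `^ p.
  by rewrite -powRM ?divr_ge0 ?(ltW a0) ?(ltW (lt_trans a0 ab))// divfK ?gt_eqF.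
rewrite ler_wpM2r// ?powR_ge0//.
have p0 : 0 < p by near: p; exact: nbhs_pinfty_gt.
rewrite /powR gt_eqF ?(lt_trans ltr01)//.
(* The quadratic term of the exponential series already outgrows p. *)
have := expR_ge1Dxn 1 (mulr_ge0 (ltW p0) (ltW l0)).
apply: le_trans; rewrite -[leLHS]add0r lerD// ler_pdivlMr//.
have -> : (p * ln (b / a)) ^+ 2 = p * (p * ln (b / a) ^+ 2) by ring.
rewrite ler_wpM2l ?(ltW p0)// -ler_pdivrMr ?exprn_gt0//.
Unshelve. all: by end_near. Qed.

(* The bounds with constants [C] and [c] disappear after taking [p]-th roots. *)
Lemma cvg_root (J : R -> \bar R) (M : R) : 0 <= M ->
  (\forall p \near +oo, (0 <= J p)%E) ->
  (forall a, M < a -> exists C : R, \forall p \near +oo, (J p <= (C * p * a `^ p)%:E)%E) ->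
  (forall a, 0 < a < M -> exists2 c : R, 0 < c & \forall p \near +oo, ((c * a `^ p)%:E <= J p)%E) ->
  (J p `^ p^-1)%E @[p --> +oo] --> M%:E.
Proof.
move=> M0 J0 ub lb; apply: cvge_real => e e0.
have rootK (b p : R) : 0 <= b -> 0 < p -> ((b `^ p)%:E `^ p^-1)%E = b%:E.
  by move=> b0 p0; rewrite poweR_EFin -powRrM mulfV ?gt_eqF// powRr1.
have mono (p : R) (x y : \bar R) : 0 < p -> (0 <= x)%E -> (x <= y)%E -> (x `^ p^-1 <= y `^ p^-1)%E.
  move=> p0 x0 xy; apply: gt0_ler_poweR; rewrite ?invr_ge0 ?(ltW p0)//.
    by rewrite in_itv/= x0 leey.
  by rewrite in_itv/= (le_trans x0 xy) leey.
have U : \forall p \near +oo, (J p `^ p^-1 <= (M + e)%:E)%E.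
  (* The room above M is used in three parts: M + e/3 enters the hypothesis, the passage to M + e/2
     absorbs the factor p, and the passage to M + e absorbs the constant. *)
  have [C hC] : exists C : R, \forall p \near +oo, (J p <= (C * p * (M + e / 3) `^ p)%:E)%E.
    by apply: ub; rewrite ltrDl divr_gt0.
  near=> p; have p0 : 0 < p by near: p; exact: nbhs_pinfty_gt.
  rewrite -(rootK (M + e) p) ?addr_ge0 ?(ltW e0)//; apply: mono => //; first by near: p.
  apply: (@le_trans _ _ (C * p * (M + e / 3) `^ p)%:E); first by near: p.
  rewrite lee_fin -mulrA; apply: (@le_trans _ _ (`|C| * (M + e / 2) `^ p)).
    apply: (@le_trans _ _ (`|C| * (p * (M + e / 3) `^ p))).
      by rewrite ler_wpM2r ?ler_norm// mulr_ge0 ?powR_ge0 ?ltW.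
    rewrite ler_wpM2l//; near: p; apply: p_ler_powR_near; lra.
  by near: p; apply: ler_powR_near; lra.
have L : \forall p \near +oo, ((M - e)%:E <= J p `^ p^-1)%E.
  (* The lower bounds are assumed for positive bases only; if M - e <= 0, nonnegativity of the root
     is enough. *)
  have [Me|Me] := leP (M - e) 0.
    by near=> p; apply: le_trans (poweR_ge0 _ _); rewrite lee_fin.
  have [c c0 hc] : exists2 c : R, 0 < c & \forall p \near +oo, ((c * (M - e / 2) `^ p)%:E <= J p)%E.
    by apply: lb; lra.
  near=> p; have p0 : 0 < p by near: p; exact: nbhs_pinfty_gt.
  rewrite -(rootK (M - e) p) ?(ltW Me)//; apply: mono => //.
    by rewrite lee_fin powR_ge0.
  apply: (@le_trans _ _ (c * (M - e / 2) `^ p)%:E); last by near: p.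
  rewrite lee_fin -ler_pdivrMl//; near: p; apply: ler_powR_near; lra.
by near=> p; apply/andP; split; near: p.
Unshelve. all: by end_near. Qed.

Lemma continuous_powR_base (a s : R) : 0 < a -> {for a, continuous (fun b : R => b `^ s)}.
Proof.
move=> a0; apply: differentiable_continuous; apply/derivable1_diffP.
by have [] := is_derive1_powR s a0.
Qed.

Lemma continuous_powR_exp (a : R) : 0 < a -> continuous (fun s : R => a `^ s).
Proof.
move=> a0 s; rewrite (_ : (fun s : R => a `^ s) = fun s => expR (s * ln a)).
  apply: (@continuous_comp _ _ _ (fun s : R => s * ln a) expR); last exact: continuous_expR.
  by apply: cvgM; [exact: cvg_id|exact: cvg_cst].
by apply/funext => t; rewrite /powR gt_eqF.
Qed.

Lemma epow_pos (x : \bar R) (a : R) : 0 <= a -> epow x a = (x `^ a)%E.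
Proof. by rewrite /epow => ->. Qed.

Lemma epow_inv (r a : R) : 0 < r -> 0 < a -> epow (r^-1)%:E (- a) = (r `^ a)%:E.
Proof.
move=> r0 a0; rewrite /epow ifF; last by rewrite oppr_ge0 leNgt a0.
rewrite opprK poweR_EFin inver gt_eqF ?powR_gt0 ?invr_gt0//.
by congr EFin; rewrite -powRN -powR_inv1 ?(ltW r0)// -powRrM mulN1r opprK.
Qed.

End real_limits.

(** * The Euclidean sphere and its surface measure *)

Section sphere_surface.
Context {R : realType} {n : nat}.
Local Open Scope ereal_scope.
Local Notation mu := (lebesgue_rV R n).
Local Notation sigma := (surface_measure R n).
Implicit Types xi x : 'rV[R]_n.

Lemma dot_ge0 x : (0 <= dot x x)%R.
Proof. by apply: sumr_ge0 => i _; rewrite -expr2 sqr_ge0. Qed.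

Lemma enormZ (c : R) x : enorm (c *: x)%R = (`|c| * enorm x)%R.
Proof.
rewrite /enorm (_ : dot _ _ = c ^+ 2 * dot x x)%R; last first.
  by rewrite /dot mulr_sumr; apply: eq_bigr => i _; rewrite !mxE; ring.
by rewrite sqrtrM ?sqr_ge0// sqrtr_sqr.
Qed.

Lemma coord_le_enorm x i : (`|x 0 i| <= enorm x)%R.
Proof.
rewrite /enorm -sqrtr_sqr ler_sqrt ?dot_ge0// /dot (bigD1 i)//= -expr2 lerDl.
by apply: sumr_ge0 => j _; rewrite -expr2 sqr_ge0.
Qed.

Lemma continuous_enorm : continuous (@enorm R n).
Proof.
move=> x; apply: (@continuous_comp _ _ _ (fun x : 'rV[R]_n => dot x x) Num.sqrt); last exact: sqrt_continuous.
suff h (r : seq 'I_n) : {for x, continuous (fun y : 'rV[R]_n => \sum_(i <- r) y 0 i * y 0 i)%R}.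
  exact: h.
elim: r => [|i r IH].
  rewrite (_ : (fun y : 'rV[R]_n => _) = cst 0%R); first exact: cst_continuous.
  by apply/funext => y; rewrite big_nil.
have hx : {for x, continuous (fun y : 'rV[R]_n => y 0%R i)} by exact: coord_continuous.
rewrite (_ : (fun y : 'rV[R]_n => _) = fun y => (y 0 i * y 0 i + \sum_(i <- r) y 0 i * y 0 i)%R).
  exact: (cvgD (cvgM hx hx) IH).
by apply/funext => y; rewrite big_cons.
Qed.

Lemma measurable_sphere : measurable (@sphere R n).
Proof.
rewrite (_ : sphere n = @enorm R n @^-1` [set 1%R])//.
rewrite -[X in measurable X]setTI; apply: measurable_enorm => //; exact: measurable_set1.
Qed.

Lemma surface_measure_sphere_fin : sigma (sphere n) < +oo.
Proof.
rewrite /surface_measure /mscale /=; apply: lte_mul_pinfty => //.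
rewrite /cone_measure /pushforward /mrestr.
apply: (@le_lt_trans _ _ (mu (ball (0%R : 'rV[R]_n) 2%R))); last by rewrite lebesgue_rV_ball// ltry.
apply: le_measure; rewrite ?inE.
- apply: measurableI; last exact: measurable_punctured_ball.
  rewrite -[X in measurable X]setTI; apply: measurable_normalize => //; exact: measurable_sphere.
- exact: measurable_ball_rV.
- move=> x [_ /= /andP[_ x1]]; rewrite ball_rVE//= => i; rewrite in_itv/= mxE.
  by have := le_trans (coord_le_enorm x i) x1; rewrite ler_norml => /andP[? ?]; lra.
Qed.

Lemma enorm_normalize x : (0 < enorm x)%R -> sphere n (normalize x).
Proof.
move=> x0; rewrite /sphere /= /normalize enormZ ger0_norm ?invr_ge0 ?(ltW x0)//.
by rewrite mulVf// gt_eqF.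
Qed.

Lemma continuous_normalize xi : (0 < enorm xi)%R -> {for xi, continuous (@normalize R n)}.
Proof.
move=> xi0; have e0 : (enorm xi != 0)%R by rewrite gt_eqF.
exact: (cvgZ (cvgV e0 (@continuous_enorm xi)) cvg_id).
Qed.

(** The cone over a neighbourhood of [xi] in the sphere contains a neighbourhood of xi/2, a point
    well inside the punctured ball, and so has positive volume. *)
Lemma surface_measure_nbhs xi (A : set 'rV[R]_n) : sphere n xi -> nbhs xi A ->
  exists E : set 'rV[R]_n, [/\ measurable E, E `<=` sphere n, E `<=` A &
    0 < sigma E].
Proof.
move=> Sxi /nbhs_ballP[e /= e0 eA]; have n0 := sphere_dim_gt0 Sxi.
exists (ball xi e `&` sphere n); split.
- by apply: measurableI; [exact: measurable_ball_rV|exact: measurable_sphere].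
- by move=> x [].
- by move=> x [/eA].
rewrite /surface_measure /mscale /= mule_gt0//; first by rewrite lte_fin ltr0n.
rewrite /cone_measure /pushforward /mrestr.
pose y := (2^-1 *: xi)%R.
have ey : enorm y = 2^-1%R by rewrite enormZ Sxi mulr1 ger0_norm.
have ny : normalize y = xi by rewrite /normalize ey invrK scalerA mulfV ?scale1r.
apply: (@lebesgue_rV_nbhs _ _ y).
  apply: measurableI; last exact: measurable_punctured_ball.
  rewrite -[X in measurable X]setTI; apply: measurable_normalize => //.
  by apply: measurableI; [exact: measurable_ball_rV|exact: measurable_sphere].
have h1 : \forall x \near y, (2^-1 - 4^-1 < enorm x < 2^-1 + 4^-1)%R.
  have e4 : (0 < 4^-1 :> R)%R by [].
  have /cvgrPdist_lt/(_ _ e4) := @continuous_enorm y.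
  by apply: filterS => x; rewrite ey ltr_distlC.
have h2 : \forall x \near y, ball xi e (normalize x).
  have /cvg_ballP : normalize x @[x --> y] --> xi.
    by rewrite -[X in _ --> X]ny; apply: continuous_normalize; rewrite ey.
  exact.
near=> x.
have /andP[x1 x2] : (2^-1 - 4^-1 < enorm x < 2^-1 + 4^-1)%R by near: x; exact: h1.
have x0 : (0 < enorm x)%R by lra.
split; first split.
- by near: x; exact: h2.
- exact: enorm_normalize.
- by rewrite /punctured_ball/= x0/=; lra.
Unshelve. all: by end_near. Qed.

End sphere_surface.

(** * Difference quotients weighted by the radial function *)

Section difference_quotients.
Context {R : realType} {n : nat}.
Variables (f : 'rV[R]_n -> R) (K : set 'rV[R]_n) (B L : R).
Hypothesis n_gt0 : (0 < n)%N.
Hypotheses (B0 : 0 < B) (L0 : 0 < L).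
Hypothesis fB : forall x y, `|f x - f y| <= B.
Hypothesis fL : forall x y, `|f x - f y| <= L * `|x - y|.
Hypotheses (K_star : star_body K) (K_bounded : bounded_set K).
Implicit Types (xi x : 'rV[R]_n) (s t : R).

Let rho_gt0 xi : sphere n xi -> 0 < rho K xi. Proof. exact: rho_gt0. Qed.

(** The q_s of the overview, with supremum [quot_sup]. *)
Definition quot s xi x t : R := (rho K xi / t) `^ s * `|f (x + t *: xi) - f x|.

Definition quot_sup s : \bar R := ereal_sup
  [set y | exists xi x t, [/\ sphere n xi, 0 < t & y = (quot s xi x t)%:E]].

Lemma quot_ge0 s xi x t : 0 <= quot s xi x t.
Proof. by rewrite mulr_ge0 ?powR_ge0. Qed.

Lemma powR_div (a b s : R) : 0 < a -> 0 < b -> (a / b) `^ s = a `^ s * b `^ (- s).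
Proof.
move=> a0 b0; rewrite powRM ?invr_ge0 ?(ltW a0) ?(ltW b0)//; congr (_ * _).
by rewrite -powR_inv1 ?(ltW b0)// -powRrM mulN1r.
Qed.

Lemma sphere_norm_le1 xi : sphere n xi -> `|xi| <= 1.
Proof.
move=> Sxi; rewrite [leLHS]/Num.Def.normr /= mx_normrE; apply/bigmax_leP; split => //= i _.
by rewrite [i.1]ord1; apply: le_trans (coord_le_enorm xi i.2) _; rewrite Sxi.
Qed.

Lemma diff_le_lip xi x t : sphere n xi -> 0 < t -> `|f (x + t *: xi) - f x| <= L * t.
Proof.
move=> Sxi t0; apply: le_trans (fL _ _) _; rewrite addrAC subrr add0r normrZ gtr0_norm//.
rewrite ler_pM2l// -[leRHS]mulr1 ler_pM2l//; exact: sphere_norm_le1.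
Qed.

(** The positive factor rho(xi)^s moves inside the supremum over (x, t) and merges with t^(-s),
    leaving a single supremum over (xi, x, t). *)
Lemma dilation_frac s : 0 < s ->
  dilation_factor s K (frac_polar_projection_oo s f) = quot_sup s.
Proof.
move=> s0; rewrite /dilation_factor.
have E xi : sphere n xi -> (epow (gauge K xi) (- s) *
    epow (gauge (frac_polar_projection_oo s f) xi) s =
    (rho K xi `^ s)%:E * frac_sup s f xi)%E.
  move=> Sxi; rewrite gaugeE// epow_inv ?rho_gt0// epow_pos ?(ltW s0)//.
  by rewrite gauge_frac_polar_oo// -poweRrM mulVf ?gt_eqF// poweRe1// frac_sup_ge0.
apply/eqP; rewrite eq_le; apply/andP; split; apply: ub_ereal_sup.
  move=> _ [xi Sxi <-]; rewrite E//.
  have r0 : 0 < rho K xi `^ s by rewrite powR_gt0 ?rho_gt0.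
  rewrite -lee_pdivlMl//; apply: ub_ereal_sup => _ [[x t] [_ /= +] <-].
  rewrite in_itv/= andbT => t0; rewrite lee_pdivlMl// -EFinM mulrA -powR_div ?rho_gt0//.
  by apply: ereal_sup_ubound; exists xi, x, t; split.
move=> _ [xi [x [t [Sxi t0 ->]]]].
apply: (@le_trans _ _ ((rho K xi `^ s)%:E * frac_sup s f xi)%E); last first.
  by rewrite -E//; apply: ereal_sup_ubound; exists xi.
rewrite /quot powR_div ?rho_gt0// -mulrA EFinM lee_wpmul2l//.
  by rewrite lee_fin powR_ge0.
exact: frac_sup_ge.
Qed.

Lemma sphere_neq_empty : exists xi : 'rV[R]_n, sphere n xi.
Proof.
exists (delta_mx 0 (Ordinal n_gt0)); rewrite /sphere /= /enorm dot_delta mxE !eqxx.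
by rewrite sqrtr1.
Qed.

Lemma quot_sup_ge0 s : (0 <= quot_sup s)%E.
Proof.
have [xi Sxi] := sphere_neq_empty.
apply: (@le_trans _ _ (quot s xi 0 1)%:E); first by rewrite lee_fin quot_ge0.
by apply: ereal_sup_ubound; exists xi, 0, 1; split.
Qed.

(** Writes the increment D as D^s D^(1 - s) and bounds the second factor by B^(1 - s). *)
Lemma quot_interp s xi x t : 0 < s <= 1 -> sphere n xi -> 0 < t ->
  quot s xi x t <= (quot 1 xi x t) `^ s * B `^ (1 - s).
Proof.
move=> /andP[s0 s1] Sxi t0; rewrite /quot.
have r0 : 0 <= rho K xi / t by rewrite divr_ge0 ?(ltW t0)// ltW// rho_gt0.
rewrite powRr1// (powRM s r0 (normr_ge0 _)) -mulrA ler_wpM2l ?powR_ge0//.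
have := normr_ge0 (f (x + t *: xi) - f x); have := fB (x + t *: xi) x.
move: `|_| => D DB D0.
have {1}-> : D = D `^ s * D `^ (1 - s).
  rewrite -powRD; last by rewrite addrC subrK oner_eq0.
  by rewrite addrC subrK powRr1.
by rewrite ler_wpM2l ?powR_ge0// ge0_ler_powR ?subr_ge0 ?nnegrE ?(ltW B0).
Qed.

Lemma quot1_ub : exists2 C : R, 0 < C & forall xi x t, sphere n xi -> 0 < t -> quot 1 xi x t <= C.
Proof.
have [C C0 hC] := rho_ub K_star K_bounded; exists (C * L); first by rewrite mulr_gt0.
move=> xi x t Sxi t0; rewrite /quot powRr1; last by rewrite divr_ge0 ?(ltW t0)// ltW// rho_gt0.
rewrite mulrAC ler_pdivrMr// -mulrA ler_pM//.
- by rewrite ltW// rho_gt0.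
- exact: hC.
- exact: diff_le_lip.
Qed.

Lemma quot_sup_fin s : 0 < s <= 1 -> exists2 M : R, 0 <= M & quot_sup s = M%:E.
Proof.
move=> s01; have [C C0 hC] := quot1_ub.
have : (quot_sup s <= (C `^ s * B `^ (1 - s))%:E)%E.
  apply: ub_ereal_sup => _ [xi [x [t [Sxi t0 ->]]]]; rewrite lee_fin.
  apply: le_trans (quot_interp x s01 Sxi t0) _; rewrite ler_wpM2r ?powR_ge0//.
  have /andP[s0 _] := s01.
  by apply: ge0_ler_powR; rewrite ?nnegrE ?quot_ge0 ?(ltW s0) ?(ltW C0)//; exact: hC.
have := quot_sup_ge0 s; case: (quot_sup s) => // M; rewrite lee_fin => M0 _.
by exists M.
Qed.

Lemma quot_le_sup s M xi x t : quot_sup s = M%:E -> sphere n xi -> 0 < t ->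
  quot s xi x t <= M.
Proof.
move=> EM Sxi t0; rewrite -lee_fin -EM; apply: ereal_sup_ubound.
by exists xi, x, t; split.
Qed.

Lemma quot_sup_gt s M (a : R) : quot_sup s = M%:E -> a < M ->
  exists xi x t, [/\ sphere n xi, 0 < t & a < quot s xi x t].
Proof.
move=> EM aM; have : (a%:E < quot_sup s)%E by rewrite EM lte_fin.
by move=> /ereal_sup_gt[_ [xi [x [t [Sxi t0 ->]]]]]; exists xi, x, t.
Qed.

Lemma near_at_left (x : R) (P : set R) :
  (\forall s \near x, P s) -> \forall s \near x^'-, P s.
Proof. by move=> h; change (nbhs x (fun u => u < x -> P u)); apply: filterS h => u Pu _. Qed.

Lemma quot_sup_cvg1 : quot_sup s @[s --> 1^'-] --> quot_sup 1.
Proof.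
have [M M0 EM] := @quot_sup_fin 1 (introT andP (conj ltr01 (lexx _))).
rewrite EM; apply: cvge_real => e e0.
have s1 : \forall s \near (1 : R)^'-, 0 < s <= 1.
  near=> s; apply/andP; split; near: s; [exact: nbhs_left_gt|exact: nbhs_left_le].
(* The base is M + e/2 and not M, which may be 0, where the power is not continuous in its
   exponent. *)
have up : \forall s \near (1 : R)^'-, (M + e / 2) `^ s * B `^ (1 - s) <= M + e.
  have c : (M + e / 2) `^ s * B `^ (1 - s) @[s --> (1 : R)] --> M + e / 2.
    have Me : 0 < M + e / 2 by rewrite ltr_wpDl// divr_gt0.
    have E : M + e / 2 = (M + e / 2) `^ 1 * B `^ (1 - 1).
      by rewrite subrr powRr0 mulr1 powRr1// ltW.
    rewrite [X in _ --> X]E.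
    apply: cvgM; first exact: continuous_powR_exp.
    apply: (@continuous_comp _ _ _ (fun s : R => 1 - s) (fun s => B `^ s)); last exact: continuous_powR_exp.
    have h : (fun s : R => 1 - s) s @[s --> (1 : R)] --> (1 - 1 : R).
      by apply: cvgB; [exact: cvg_cst|exact: cvg_id].
    exact: h.
  have lt : M + e / 2 < M + e by lra.
  exact: near_at_left (cvgr_le _ c _ lt).
have [xi [x [t [Sxi t0 aq]]]] : exists xi x t, [/\ sphere n xi, 0 < t & M - e < quot 1 xi x t].
  by apply: quot_sup_gt EM _; rewrite ltrBlDr ltrDl.
have lo : \forall s \near (1 : R)^'-, M - e <= quot s xi x t.
  have c : quot s xi x t @[s --> (1 : R)] --> quot 1 xi x t.
    apply: cvgM; last exact: cvg_cst.
    by apply: continuous_powR_exp; rewrite divr_gt0 ?rho_gt0.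
  exact: near_at_left (cvgr_ge _ c _ aq).
near=> s; apply/andP; split.
  apply: (@le_trans _ _ (quot s xi x t)%:E); first by rewrite lee_fin; near: s.
  by apply: ereal_sup_ubound; exists xi, x, t; split.
apply: ub_ereal_sup => _ [xi' [x' [t' [Sxi' t0' ->]]]]; rewrite lee_fin.
have s01 : 0 < s <= 1 by near: s.
apply: le_trans (quot_interp x' s01 Sxi' t0') _.
apply: (@le_trans _ _ ((M + e / 2) `^ s * B `^ (1 - s))); last by near: s.
rewrite ler_wpM2r ?powR_ge0//; have /andP[s0 _] := s01.
apply: ge0_ler_powR; rewrite ?nnegrE ?quot_ge0 ?(ltW s0)//.
  by rewrite addr_ge0// divr_ge0// ltW.
apply: le_trans (quot_le_sup x' EM Sxi' t0') _.
by rewrite lerDl divr_ge0// ltW.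
Unshelve. all: by end_near. Qed.

End difference_quotients.

(** * Limit of the fractional energies *)

Section fractional_energy_limit.
Context {R : realType} {n : nat}.
Local Notation mu := (lebesgue_rV R n).
Local Notation leb := (@lebesgue_measure R).
Local Notation sigma := (surface_measure R n).
Variables (f : 'rV[R]_n -> R) (K : set 'rV[R]_n) (B L : R).
Hypothesis n_gt0 : (0 < n)%N.
Hypothesis cf : continuous f.
Hypothesis intf : mu.-integrable setT (EFin \o f).
Hypotheses (B0 : 0 < B) (L0 : 0 < L).
Hypothesis fB : forall x y, `|f x - f y| <= B.
Hypothesis fL : forall x y, `|f x - f y| <= L * `|x - y|.
Hypotheses (K_star : star_body K) (K_bounded : bounded_set K).
Implicit Types (xi x : 'rV[R]_n) (s t p : R).

Let rho_gt0 xi : sphere n xi -> 0 < rho K xi. Proof. exact: rho_gt0. Qed.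

(** Translation invariance makes the bound uniform in [v]: N is twice the L^1 norm of [f]. *)
Lemma integral_diff_le : exists2 N : R, 0 <= N & forall v : 'rV[R]_n,
  (\int[mu]_x (`|f (x + v)%R - f x|)%:E <= N%:E)%E.
Proof.
have [mf f_fin] := integrableP _ _ _ intf.
have N0 : (0 <= \int[mu]_x `|(f x)%:E|)%E by exact: integral_ge0.
exists (fine (\int[mu]_x `|(f x)%:E|)%E *+ 2); first by rewrite mulrn_wge0// fine_ge0.
move=> v; have mfr : measurable_fun setT f by exact: continuous_measurable_rV.
have mfv : measurable_fun setT (fun x => f (x + v)).
  by apply: measurableT_comp => //; exact: measurable_translate.
apply: (@le_trans _ _ (\int[mu]_x (`|(f (x + v)%R)%:E| + `|(f x)%:E|))%E).
  apply: ge0_le_integral_nomeas => x _; rewrite ?lee_fin//.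
  exact: ler_normB.
rewrite ge0_integralD//.
- rewrite (@ge0_integral_translate _ _ v (fun x => `|(f x)%:E|)%E)//.
    rewrite mulr2n EFinD fineK// ge0_fin_numE//.
  by apply: measurableT_comp => //.
- by apply: measurableT_comp => //; exact/measurable_EFinP.
- by apply: measurableT_comp => //.
Qed.

(** For t <= 1 the Lipschitz bound leaves the exponent p0 (1 - s) - 2 >= 0; for t > 1 the bound [B]
    leaves the weight, with exponent -p0 s - 1 <= -2. The factor 2 is from 1 + t^2 <= 2 max(1,
    t^2). *)
Lemma diff_tail_ub s p0 xi x t : 0 < s < 1 -> 2 <= p0 * (1 - s) -> 1 <= p0 * s ->
  sphere n xi -> 0 < t ->
  t `^ (- p0 * s - 1) * `|f (x + t *: xi) - f x| `^ (p0 - 1) <=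
  2 * (L `^ (p0 - 1) + B `^ (p0 - 1)) * (oneDsqr t)^-1.
Proof.
move=> /andP[s0 s1] h1 h2 Sxi t0.
have p1 : 1 <= p0 by nra.
have p10 : 0 <= p0 - 1 by lra.
have o0 : 0 < oneDsqr t by rewrite /oneDsqr ltr_pwDl// sqr_ge0.
rewrite ler_pdivlMr//.
have [t1|t1] := leP t 1.
  apply: (@le_trans _ _ (t `^ (- p0 * s - 1) * (L * t) `^ (p0 - 1) * 2)).
    rewrite ler_pM ?mulr_ge0 ?powR_ge0 ?(ltW o0)//; last by rewrite /oneDsqr; nra.
    rewrite ler_wpM2l ?powR_ge0// ge0_ler_powR ?nnegrE ?mulr_ge0 ?(ltW L0) ?(ltW t0)//.
    exact: diff_le_lip.
  rewrite powRM ?(ltW L0) ?(ltW t0)// mulrCA -powRD; last by rewrite (gt_eqF t0) implybT.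
  rewrite mulrC ler_pM2l//.
  apply: (@le_trans _ _ (L `^ (p0 - 1))); last by rewrite lerDl powR_ge0.
  rewrite ler_piMr ?powR_ge0//.
  have e0 : 0 <= - p0 * s - 1 + (p0 - 1) by lra.
  have := @ge0_ler_powR _ _ e0 t 1; rewrite powR1; apply => //.
    by rewrite nnegrE ltW.
  by rewrite nnegrE.
have t2 : t `^ (- p0 * s - 1) <= t ^- 2.
  have -> : t ^- 2 = t `^ (- 2%:R) by rewrite -powR_mulrn ?(ltW t0)// powRN.
  by apply: ler_powR; lra.
apply: (@le_trans _ _ (t ^- 2 * B `^ (p0 - 1) * (2 * t ^+ 2))).
  rewrite ler_pM ?mulr_ge0 ?powR_ge0 ?(ltW o0)//; last by rewrite /oneDsqr; nra.
  rewrite ler_pM ?powR_ge0// ge0_ler_powR ?nnegrE ?(ltW B0)//.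
have -> : t ^- 2 * B `^ (p0 - 1) * (2 * t ^+ 2) = 2 * B `^ (p0 - 1).
  rewrite mulrACA mulrCA mulrA; field.
  by rewrite gt_eqF.
by rewrite ler_pM2l// lerDr powR_ge0.
Qed.

(** The power D^p is split as D^(p - p0) D^(p0 - 1) D. The first factor is bounded through D <= (a /
    rho^s) t^s, the second is the tail above, and the last is left for the integral in x. *)
Lemma diff_powR_ub s a p0 p xi x t : 0 < s < 1 -> 2 <= p0 * (1 - s) -> 1 <= p0 * s ->
  0 < a -> quot f K s xi x t <= a -> p0 <= p -> sphere n xi -> 0 < t ->
  t `^ (- p * s - 1) * `|f (x + t *: xi) - f x| `^ p <=
  (a / rho K xi `^ s) `^ (p - p0) * (2 * (L `^ (p0 - 1) + B `^ (p0 - 1))) *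
    (oneDsqr t)^-1 * `|f (x + t *: xi) - f x|.
Proof.
move=> s01 h1 h2 a0 qa p0p Sxi t0; have tail := diff_tail_ub x s01 h1 h2 Sxi t0.
move: s01 => /andP[s0 s1].
have p1 : 1 <= p0 by nra.
move: qa tail; rewrite /quot; have := normr_ge0 (f (x + t *: xi) - f x).
move: `|_| => D D0 qa tail.
have r0 := rho_gt0 Sxi.
have [->|Dn] := eqVneq D 0.
  by rewrite powR0 ?mulr0// gt_eqF//; lra.
have Dp : 0 < D by rewrite lt_neqAle eq_sym Dn.
have qa' : D <= a / rho K xi `^ s * t `^ s.
  move: qa; rewrite powR_div// powRN => qa.
  rewrite mulrAC ler_pdivlMr ?powR_gt0//.
  by move: qa; rewrite mulrAC ler_pdivrMr ?powR_gt0// mulrC.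
have -> : D `^ p = D `^ (p - p0) * D `^ (p0 - 1) * D.
  rewrite -[X in _ * X]powRr1// -!powRD ?(gt_eqF Dp) ?implybT//; congr (_ `^ _); lra.
have -> : t `^ (- p * s - 1) = t `^ (- s * (p - p0)) * t `^ (- p0 * s - 1).
  rewrite -powRD ?(gt_eqF t0) ?implybT//; congr (_ `^ _); lra.
have -> : t `^ (- s * (p - p0)) * t `^ (- p0 * s - 1) * (D `^ (p - p0) * D `^ (p0 - 1) * D) =
  (t `^ (- s * (p - p0)) * D `^ (p - p0)) * (t `^ (- p0 * s - 1) * D `^ (p0 - 1)) * D by ring.
rewrite -[X in _ <= X * D]mulrA ler_wpM2r//; apply: ler_pM tail; rewrite ?mulr_ge0 ?powR_ge0//.
rewrite [leLHS]mulrC.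
apply: (@le_trans _ _ ((a / rho K xi `^ s * t `^ s) `^ (p - p0) * t `^ (- s * (p - p0)))).
  rewrite ler_wpM2r ?powR_ge0// ge0_ler_powR ?nnegrE ?subr_ge0//.
  by rewrite mulr_ge0 ?divr_ge0 ?powR_ge0 ?(ltW a0).
rewrite powRM ?divr_ge0 ?powR_ge0 ?(ltW a0)// -powRrM -mulrA -powRD ?(gt_eqF t0) ?implybT//.
by rewrite mulNr subrr powRr0 mulr1.
Qed.

Lemma frac_energy_ub s a p0 : 0 < s < 1 -> 2 <= p0 * (1 - s) -> 1 <= p0 * s ->
  0 < a -> (quot_sup f K s <= a%:E)%E ->
  exists2 C : R, 0 <= C & forall p xi, p0 <= p -> sphere n xi ->
    (frac_energy s p f xi <= (C * p * (a / rho K xi `^ s) `^ (p - p0))%:E)%E.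
Proof.
move=> s01 h1 h2 a0 qa; have [N N0 hN] := integral_diff_le.
set C2 := 2 * (L `^ (p0 - 1) + B `^ (p0 - 1)).
have C20 : 0 <= C2 by rewrite mulr_ge0 ?addr_ge0 ?powR_ge0.
have /andP[s0 s1] := s01.
have p1 : 1 <= p0 by nra.
have pi20 : 0 <= (pi : R) / 2 by exact: divr_ge0 (pi_ge0 R) (ler0n _ _).
have CNp : 0 <= C2 * N * (pi / 2) := mulr_ge0 (mulr_ge0 C20 N0) pi20.
(* [C2] is the tail constant, [N] bounds the integral in x, and pi/2 is the integral of 1/(1 + t^2)
   over the half-line. *)
exists (C2 * N * (pi / 2)) => //.
move=> p xi p0p Sxi; set c := (a / rho K xi `^ s) `^ (p - p0).
have c0 : 0 <= c by exact: powR_ge0.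
rewrite /frac_energy.
have pp : 0 <= p by lra.
have oV0 t : 0 <= (oneDsqr t)^-1 :> R by rewrite invr_ge0 /oneDsqr addr_ge0// sqr_ge0.
have moV : measurable_fun setT (fun t : R => ((oneDsqr t)^-1)%:E).
  by apply/measurable_EFinP; apply: continuous_measurable_fun; exact: continuous_oneDsqrV.
have mD v : measurable_fun setT (fun x => `|f (x + v) - f x|).
  apply: measurableT_comp => //; apply: measurable_funB; last exact: continuous_measurable_rV.
  by apply: measurableT_comp; [exact: continuous_measurable_rV|exact: measurable_translate].
have I : (\int[leb]_(t in `]0%R, +oo[)
    ((t `^ (- p * s - 1))%:E *
      \int[mu]_x (`|f (x + t *: xi)%R - f x| `^ p)%:E) <= (c * C2 * N * (pi / 2))%:E)%E.
  apply: (@le_trans _ _ (\int[leb]_(t in `[0%R, +oo[) ((c * C2 * N)%:E * ((oneDsqr t)^-1)%:E))%E); last first.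
    rewrite ge0_integralZl//.
    - by rewrite integral0y_oneDsqr -EFinM.
    - exact: measurable_funTS moV.
    - by rewrite lee_fin; exact: mulr_ge0 (mulr_ge0 c0 C20) N0.
  apply: (@le_trans _ _ (\int[leb]_(t in `]0%R, +oo[) ((c * C2 * N)%:E * ((oneDsqr t)^-1)%:E))%E); last first.
    apply: ge0_subset_integral => //.
    - by apply: measurable_funTS; exact: emeasurable_funM.
    - move=> t _; rewrite -EFinM lee_fin mulr_ge0//; exact: mulr_ge0 (mulr_ge0 c0 C20) N0.
    - by move=> t /=; rewrite !in_itv/= !andbT => /ltW.
  apply: ge0_le_integral_nomeas => t; rewrite /= in_itv/= andbT => t0.
    rewrite mule_ge0 ?lee_fin ?powR_ge0//.
    by apply: integral_ge0 => x _; rewrite lee_fin powR_ge0.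
  rewrite -ge0_integralZl//.
  - apply: (@le_trans _ _ (\int[mu]_x ((c * C2 * (oneDsqr t)^-1)%:E * (`|f (x + t *: xi) - f x|)%:E))%E).
      apply: ge0_le_integral_nomeas => x _.
        by rewrite -EFinM lee_fin mulr_ge0 ?powR_ge0.
      rewrite -!EFinM lee_fin; apply: diff_powR_ub => //.
      by rewrite -lee_fin; apply: le_trans qa; apply: ereal_sup_ubound; exists xi, x, t.
    rewrite ge0_integralZl//.
    - rewrite (_ : (c * C2 * N)%:E * _ = (c * C2 * (oneDsqr t)^-1)%:E * N%:E)%E; last first.
        by rewrite -!EFinM mulrAC.
      by rewrite lee_wpmul2l// lee_fin; exact: mulr_ge0 (mulr_ge0 c0 C20) (oV0 t).
    - exact/measurable_EFinP.
    - by rewrite lee_fin; exact: mulr_ge0 (mulr_ge0 c0 C20) (oV0 t).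
  - apply/measurable_EFinP; apply: (@measurableT_comp _ _ _ _ _ _ (fun r : R => r `^ p)) => //.
  - by rewrite lee_fin powR_ge0.
apply: (@le_trans _ _ ((p * (1 - s))%:E * (c * C2 * N * (pi / 2))%:E)%E).
  by rewrite lee_wpmul2l// lee_fin mulr_ge0// subr_ge0 ltW.
rewrite -EFinM lee_fin.
have -> : p * (1 - s) * (c * C2 * N * (pi / 2)) = (1 - s) * (C2 * N * (pi / 2) * p * c) by ring.
rewrite ler_piMl//; last lra.
exact: mulr_ge0 (mulr_ge0 CNp pp) c0.
Qed.

(** Joint continuity at t0 > 0. The bounds on [t] and [rho] keep 1/t and the powers of [rho] away
    from 0 on the neighbourhood. *)
Lemma quot_near s a xi0 x0 t0 : sphere n xi0 -> 0 < t0 -> a < quot f K s xi0 x0 t0 ->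
  exists2 d : R, 0 < d & forall xi x t, ball xi0 d xi -> ball x0 d x -> ball t0 d t ->
    [/\ t0 / 2 <= t, t <= 2 * t0, rho K xi0 / 2 <= rho K xi & a < quot f K s xi x t].
Proof.
move=> Sxi0 t00 aq.
have r0 := rho_gt0 Sxi0.
have c1 : rho K z.1 @[z --> ((xi0, (t0, x0)) : 'rV[R]_n * (R * 'rV[R]_n))] --> rho K xi0.
  by apply: cvg_comp; [exact: cvg_fst|exact: continuous_rho].
have ct : z.2.1 @[z --> ((xi0, (t0, x0)) : 'rV[R]_n * (R * 'rV[R]_n))] --> t0.
  by apply: (cvg_comp _ _ cvg_snd); exact: cvg_fst.
have cx : z.2.2 @[z --> ((xi0, (t0, x0)) : 'rV[R]_n * (R * 'rV[R]_n))] --> x0.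
  by apply: (cvg_comp _ _ cvg_snd); exact: cvg_snd.
have cxi : z.1 @[z --> ((xi0, (t0, x0)) : 'rV[R]_n * (R * 'rV[R]_n))] --> xi0.
  exact: cvg_fst.
have cr : rho K z.1 / z.2.1 @[z --> ((xi0, (t0, x0)) : 'rV[R]_n * (R * 'rV[R]_n))] --> rho K xi0 / t0.
  have tn : t0 != 0 by rewrite gt_eqF.
  exact: (cvgM c1 (cvgV tn ct)).
have crs : (rho K z.1 / z.2.1) `^ s @[z --> ((xi0, (t0, x0)) : 'rV[R]_n * (R * 'rV[R]_n))] --> (rho K xi0 / t0) `^ s.
  apply: (cvg_comp (fun z : 'rV[R]_n * (R * 'rV[R]_n) => rho K z.1 / z.2.1) (fun r => r `^ s) cr).
  by apply: continuous_powR_base; rewrite divr_gt0.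
have cv : z.2.2 + z.2.1 *: z.1 @[z --> ((xi0, (t0, x0)) : 'rV[R]_n * (R * 'rV[R]_n))] --> x0 + t0 *: xi0.
  exact: (cvgD cx (cvgZ ct cxi)).
have cfv : f (z.2.2 + z.2.1 *: z.1) @[z --> ((xi0, (t0, x0)) : 'rV[R]_n * (R * 'rV[R]_n))] --> f (x0 + t0 *: xi0).
  by apply: (cvg_comp _ f cv); exact: cf.
have cfx : f z.2.2 @[z --> ((xi0, (t0, x0)) : 'rV[R]_n * (R * 'rV[R]_n))] --> f x0.
  by apply: (cvg_comp _ f cx); exact: cf.
have cq : quot f K s z.1 z.2.2 z.2.1 @[z --> ((xi0, (t0, x0)) : 'rV[R]_n * (R * 'rV[R]_n))]
    --> quot f K s xi0 x0 t0.
  exact: (cvgM crs (cvg_norm (cvgB cfv cfx))).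
have nr : \forall z \near ((xi0, (t0, x0)) : 'rV[R]_n * (R * 'rV[R]_n)),
   [/\ t0 / 2 <= z.2.1, z.2.1 <= 2 * t0, rho K xi0 / 2 <= rho K z.1 & a < quot f K s z.1 z.2.2 z.2.1].
  near=> z; split; near: z.
  - by apply: (cvgr_ge _ ct); lra.
  - by apply: (cvgr_le _ ct); lra.
  - by apply: (cvgr_ge _ c1); lra.
  - exact: (cvgr_gt _ cq).
have /nbhs_ballP[d /= d0 hd] := nr.
exists d => // xi x t h1 h2 h3; exact: (hd (xi, (t, x))).
Unshelve. all: by end_near. Qed.

(** On the neighbourhood of [quot_near] the increment exceeds (a / rho^s) t^s, so its p-th power
    cancels the weight down to 1/t. *)
Lemma frac_energy_lb s a xi0 x0 t0 : 0 < s < 1 -> 0 < a -> sphere n xi0 -> 0 < t0 ->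
  a < quot f K s xi0 x0 t0 ->
  exists2 c : R, 0 < c & exists2 A, nbhs xi0 A & forall p xi, 1 <= p -> A xi -> sphere n xi ->
    rho K xi0 / 2 <= rho K xi /\
    ((c * (a / rho K xi `^ s) `^ p)%:E <= frac_energy s p f xi)%E.
Proof.
move=> /andP[s0 s1] a0 Sxi0 t00 aq; have [d d0 hd] := quot_near Sxi0 t00 aq.
have mB : measurable (ball t0 d : set (measurableTypeR R)).
  by rewrite ball_itv; exact: measurable_itv.
have lB : leb (ball t0 d) = (d *+ 2)%:E by rewrite lebesgue_measure_ball// ltW.
have mX := measurable_ball_rV x0 d.
have lX := lebesgue_rV_ball x0 d0.
set m := ((d *+ 2) ^+ n) in lX; have m0 : 0 < m by rewrite exprn_gt0// mulrn_wgt0.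
have t02 : 0 < 2 * t0 by rewrite mulr_gt0.
(* 1/(2 t0) is a lower bound for 1/t, and [m] and 2d are the measures of the balls in x and t; the
   prefactor p is estimated below by 1. *)
exists ((1 - s) * ((2 * t0)^-1 * m * (d *+ 2))).
  by rewrite !mulr_gt0 ?invr_gt0 ?subr_gt0// mulrn_wgt0.
exists (ball xi0 d); first exact: nbhsx_ballx.
move=> p xi p1 Axi Sxi.
have [_ _ hr _] := hd xi x0 t0 Axi (ballxx _ d0) (ballxx _ d0); split => //.
have r0 := rho_gt0 Sxi; have p0 : 0 < p by lra.
set c := (a / rho K xi `^ s) `^ p; have c0 : 0 <= c by exact: powR_ge0.
rewrite /frac_energy.
have lb t : ball t0 d t -> (((2 * t0)^-1 * m * c)%:E <=
    (t `^ (- p * s - 1))%:E * \int[mu]_x (`|f (x + t *: xi)%R - f x| `^ p)%:E)%E.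
  move=> Bt; have [th1 th2 _ _] := hd xi x0 t Axi (ballxx _ d0) Bt.
  have t_gt0 : 0 < t by lra.
  apply: (@le_trans _ _ ((t `^ (- p * s - 1))%:E * ((c * t `^ (s * p))%:E * mu (ball x0 d)))%E).
    rewrite lX -!EFinM lee_fin.
    have -> : t `^ (- p * s - 1) * (c * t `^ (s * p) * m) = t^-1 * m * c.
      rewrite mulrCA -!mulrA; rewrite (_ : t `^ _ * _ = (t `^ (- p * s - 1) * t `^ (s * p)) * m); last ring.
      rewrite -powRD ?(gt_eqF t_gt0) ?implybT// (_ : _ + _ = -1); last ring.
      by rewrite powR_inv1 ?(ltW t_gt0)//; ring.
    by rewrite !ler_wpM2r// ?(ltW m0)// lef_pV2 ?posrE.
  rewrite lee_wpmul2l ?lee_fin ?powR_ge0//; apply: ge0_integral_lb => //.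
    by rewrite mulr_ge0// powR_ge0.
  move=> x Bx; rewrite lee_fin powRrM /c -powRM ?powR_ge0 ?divr_ge0 ?powR_ge0 ?(ltW a0)//.
  rewrite ge0_ler_powR ?nnegrE ?mulr_ge0 ?invr_ge0 ?powR_ge0 ?(ltW p0) ?(ltW a0)//.
  have [_ _ _ /ltW] := hd xi x t Axi Bx Bt.
  rewrite /quot powR_div// powRN => h.
  rewrite mulrAC ler_pdivrMr ?powR_gt0//.
  by move: h; rewrite mulrAC ler_pdivlMr ?powR_gt0// [leRHS]mulrC.
have := @ge0_integral_lb _ _ _ leb `]0%R, +oo[%classic (ball t0 d)
   (fun t => (t `^ (- p * s - 1))%:E * \int[mu]_x (`|f (x + t *: xi)%R - f x| `^ p)%:E)%E
   _ mB.
move=> /(_ ((2 * t0)^-1 * m * c)) h.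
apply: (@le_trans _ _ ((p * (1 - s))%:E * (((2 * t0)^-1 * m * c)%:E * leb (ball t0 d)))%E).
  rewrite lB -!EFinM lee_fin.
  have -> : (1 - s) * ((2 * t0)^-1 * m * (d *+ 2)) * c =
    1 * ((1 - s) * ((2 * t0)^-1 * m * c * (d *+ 2))) by ring.
  rewrite -[leRHS]mulrA ler_wpM2r//; apply: mulr_ge0; first by rewrite subr_ge0 ltW.
  by rewrite !mulr_ge0 ?invr_ge0 ?mulrn_wge0// ?(ltW t02) ?(ltW d0) ?(ltW m0).
rewrite lee_wpmul2l ?lee_fin ?mulr_ge0 ?subr_ge0 ?(ltW p0) ?(ltW s1)//; apply: h => //.
- move=> t /(hd xi x0 t Axi (ballxx _ d0))[th1 th2 _ _] /=.
  by rewrite in_itv/= andbT; lra.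
- by rewrite !mulr_ge0 ?invr_ge0//; lra.
- move=> t _; rewrite mule_ge0 ?lee_fin ?powR_ge0//.
  by apply: integral_ge0 => x _; rewrite lee_fin powR_ge0.
Qed.

Lemma frac_energy_root s : 0 < s < 1 ->
  (((n%:R^-1)%:E * \int[sigma]_(xi in sphere n)
      ((rho K xi `^ (n%:R + s * p))%:E * frac_energy s p f xi)) `^ p^-1)%E
    @[p --> +oo] --> quot_sup f K s.
Proof.
move=> s01; have /andP[s0 s1] := s01.
have s01' : 0 < s <= 1 by rewrite s0 ltW.
have [M M0 EM] := quot_sup_fin n_gt0 B0 L0 fB fL K_star K_bounded s01'.
have nV : 0 < n%:R^-1 :> R by rewrite invr_gt0 ltr0n.
have FE0 p xi : 0 <= p -> (0 <= (rho K xi `^ (n%:R + s * p))%:E * frac_energy s p f xi)%E.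
  by move=> p0; rewrite mule_ge0 ?lee_fin ?powR_ge0// frac_energy_ge0// ltW.
rewrite EM; apply: cvg_root => //.
- near=> p; have p0 : 0 <= p by near: p; exact: nbhs_pinfty_ge.
  by rewrite mule_ge0 ?lee_fin ?(ltW nV)//; apply: integral_ge0 => xi _; exact: FE0.
- move=> a Ma; have a0 : 0 < a := le_lt_trans M0 Ma.
  (* The sum of the smallest exponents allowed by the two conditions [h1] and [h2]. *)
  pose p0 := 2 / (1 - s) + 1 / s.
  have s1' : 0 < 1 - s by rewrite subr_gt0.
  have h1 : 2 <= p0 * (1 - s).
    by rewrite /p0 mulrDl divfK ?gt_eqF// lerDl !mulr_ge0 ?invr_ge0 ?(ltW s0) ?(ltW s1').
  have h2 : 1 <= p0 * s.
    by rewrite /p0 mulrDl divfK ?gt_eqF// lerDr !mulr_ge0 ?invr_ge0 ?(ltW s0) ?(ltW s1').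
  have [C C0 hC] : exists2 C : R, 0 <= C & forall p xi, p0 <= p -> sphere n xi ->
    (frac_energy s p f xi <= (C * p * (a / rho K xi `^ s) `^ (p - p0))%:E)%E.
    by apply: frac_energy_ub => //; rewrite EM lee_fin ltW.
  have [D D0 hD] := rho_ub K_star K_bounded.
  have := @surface_measure_sphere_fin R n.
  have : (0 <= sigma (sphere n))%E by [].
  case E : (sigma (sphere n)) => [S| |]// S0 _; rewrite lee_fin in S0.
  (* The powers of [rho] combine to rho^(n + s p0), free of p and at most D^(n + s p0); those of [a]
     to a^(-p0) a^p. *)
  exists (n%:R^-1 * (D `^ (n%:R + s * p0) * C * a `^ (- p0) * S)).
  near=> p.
  have p0p : p0 <= p by near: p; apply: nbhs_pinfty_ge; exact: num_real.
  have pp : 0 <= p by near: p; exact: nbhs_pinfty_ge.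
  have : (\int[sigma]_(xi in sphere n)
      ((rho K xi `^ (n%:R + s * p))%:E * frac_energy s p f xi) <=
      (D `^ (n%:R + s * p0) * C * a `^ (- p0) * p * a `^ p)%:E * sigma (sphere n))%E.
    apply: ge0_integral_ub; first exact: measurable_sphere.
      by move=> xi _; exact: FE0.
    move=> xi Sxi; have r0 := rho_gt0 Sxi.
    apply: (@le_trans _ _ ((rho K xi `^ (n%:R + s * p))%:E * (C * p * (a / rho K xi `^ s) `^ (p - p0))%:E)%E).
      by rewrite lee_wpmul2l ?lee_fin ?powR_ge0//; exact: hC.
    rewrite -EFinM lee_fin.
    have -> : (a / rho K xi `^ s) `^ (p - p0) = a `^ (- p0) * a `^ p * rho K xi `^ (- s * (p - p0)).
      rewrite powR_div ?powR_gt0// -powRrM -powRD ?(gt_eqF a0) ?implybT//.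
      by congr (_ `^ _ * _ `^ _); ring.
    have -> : rho K xi `^ (n%:R + s * p) = rho K xi `^ (n%:R + s * p0) * rho K xi `^ (s * (p - p0)).
      by rewrite -powRD ?(gt_eqF r0) ?implybT//; congr (_ `^ _); ring.
    have -> : forall u v w z : R, u * v * (C * p * (w * z * rho K xi `^ (- s * (p - p0)))) =
       (v * rho K xi `^ (- s * (p - p0))) * (u * C * w * p * z) by move=> *; ring.
    rewrite -powRD ?(gt_eqF r0) ?implybT// (_ : s * (p - p0) + _ = 0); last ring.
    rewrite powRr0 mul1r !ler_wpM2r ?powR_ge0//.
    rewrite ge0_ler_powR ?nnegrE ?(ltW r0) ?(ltW D0)//; last exact: hD.
    by rewrite addr_ge0// mulr_ge0 ?(ltW s0)//; nra.
  rewrite E -EFinM => h.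
  apply: le_trans (lee_wpmul2l _ h) _; first by rewrite lee_fin ltW.
  by rewrite -EFinM lee_fin le_eqVlt; apply/orP; left; apply/eqP; ring.
- move=> a /andP[a0 aM].
  have [xi0 [x0 [t0 [Sxi0 t00 aq]]]] := quot_sup_gt EM aM.
  have [c c0 [A nA hA]] := frac_energy_lb s01 a0 Sxi0 t00 aq.
  have [E [mE ES EA sE]] := surface_measure_nbhs Sxi0 nA.
  have r0 := rho_gt0 Sxi0.
  have : (sigma E < +oo)%E.
    apply: le_lt_trans (@surface_measure_sphere_fin R n); apply: le_measure; rewrite ?inE//.
    exact: measurable_sphere.
  move: sE; case EE : (sigma E) => [S| |]//; rewrite lte_fin => S0 _.
  (* The powers of [rho] cancel down to rho^n, and rho is at least half of its value at [xi0] on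
     [E]; [S] is the measure of [E]. *)
  exists (n%:R^-1 * ((rho K xi0 / 2) `^ n%:R * c * S)).
    by rewrite !mulr_gt0// powR_gt0// divr_gt0.
  near=> p; have p1 : 1 <= p by near: p; exact: nbhs_pinfty_ge.
  have pp : 0 <= p by lra.
  have h : ((((rho K xi0 / 2) `^ n%:R * c * a `^ p)%:E * sigma E) <=
     \int[sigma]_(xi in sphere n)
      ((rho K xi `^ (n%:R + s * p))%:E * frac_energy s p f xi))%E.
    apply: ge0_integral_lb => //.
    - by rewrite !mulr_ge0 ?powR_ge0// ltW.
    - by move=> xi _; exact: FE0.
    move=> xi Exi; have Sxi := ES _ Exi; have [hr hc] := hA p xi p1 (EA _ Exi) Sxi.
    have rx0 := rho_gt0 Sxi.
    apply: le_trans (lee_wpmul2l _ hc); last by rewrite lee_fin powR_ge0.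
    rewrite -EFinM lee_fin (powR_div p a0 (powR_gt0 s rx0)) -(powRrM (rho K xi)).
    rewrite powRD ?(gt_eqF rx0) ?implybT//.
    have -> : rho K xi `^ n%:R * rho K xi `^ (s * p) * (c * (a `^ p * rho K xi `^ (s * - p))) =
      rho K xi `^ n%:R * c * a `^ p * (rho K xi `^ (s * p) * rho K xi `^ (s * - p)) by ring.
    rewrite -powRD ?(gt_eqF rx0) ?implybT// (_ : s * p + _ = 0); last ring.
    rewrite powRr0 mulr1 !ler_wpM2r ?powR_ge0 ?(ltW c0)//.
    by rewrite ge0_ler_powR ?nnegrE ?ler0n ?divr_ge0 ?(ltW r0) ?(ltW rx0).
  apply: le_trans (lee_wpmul2l _ h); last by rewrite lee_fin ltW.
  rewrite EE -!EFinM lee_fin le_eqVlt; apply/orP; left; apply/eqP; ring.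
Unshelve. all: by end_near. Qed.

End fractional_energy_limit.

(** * Limit of the gradient energies *)

Section polar_energy_limit.
Context {R : realType} {n : nat}.
Local Notation mu := (lebesgue_rV R n).
Local Notation sigma := (surface_measure R n).
Variables (f : 'rV[R]_n -> R) (K : set 'rV[R]_n) (B L : R).
Hypothesis n_gt0 : (0 < n)%N.
Hypothesis cf : continuous f.
Hypothesis intf : mu.-integrable setT (EFin \o f).
Hypothesis intG : forall i, mu.-integrable setT (EFin \o (fun x => grad f x 0 i)).
Hypothesis wG : forall phi i, test_function phi ->
  \int[mu]_x (f x * 'D_(delta_mx 0 i) phi x) = - \int[mu]_x (grad f x 0 i * phi x).
Hypotheses (B0 : 0 < B) (L0 : 0 < L).
Hypothesis fB : forall x y, `|f x - f y| <= B.
Hypothesis fL : forall x y, `|f x - f y| <= L * `|x - y|.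
Hypotheses (K_star : star_body K) (K_bounded : bounded_set K).
Implicit Types (xi x : 'rV[R]_n) (t p a : R).

Let rho_gt0 xi : sphere n xi -> 0 < rho K xi. Proof. exact: rho_gt0. Qed.

Let mG xi : measurable_fun setT (fun x => dot (grad f x) xi).
Proof. exact: (measurable_dot intG). Qed.

Let mGp xi p : measurable_fun setT (fun x => (`|dot (grad f x) xi| `^ p)%:E).
Proof.
apply/measurable_EFinP; apply: (@measurableT_comp _ _ _ _ _ _ (fun r : R => r `^ p)).
  exact: measurable_powR.
exact: measurableT_comp.
Qed.

Lemma grad_le_of_quot_le a xi : 0 <= a -> sphere n xi ->
  (forall x t, 0 < t -> quot f K 1 xi x t <= a) ->
  {ae mu, forall x, `|dot (grad f x) xi| <= a / rho K xi}.
Proof.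
move=> a0 Sxi qa; have r0 := rho_gt0 Sxi.
apply: (grad_le_of_lip_le cf intf intG wG); first by rewrite divr_ge0 ?(ltW r0).
move=> x t t0; have := qa x t t0.
rewrite /quot powRr1 ?divr_ge0 ?(ltW r0) ?(ltW t0)//.
by rewrite mulrAC ler_pdivrMr// mulrC -ler_pdivlMr// mulrAC.
Qed.

Lemma quot_le_of_grad_le a xi : 0 <= a -> sphere n xi ->
  {ae mu, forall x, `|dot (grad f x) xi| <= a / rho K xi} ->
  forall x t, 0 < t -> quot f K 1 xi x t <= a.
Proof.
move=> a0 Sxi Ga x t t0; have r0 := rho_gt0 Sxi.
have ar0 : 0 <= a / rho K xi by rewrite divr_ge0 ?(ltW r0).
have := lip_le_of_grad_le cf intf intG wG ar0 Ga x t0.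
rewrite /quot powRr1 ?divr_ge0 ?(ltW r0) ?(ltW t0)// => h.
by rewrite mulrAC ler_pdivrMr// mulrC -ler_pdivlMr// mulrAC.
Qed.

(** In each direction, after scaling by [rho], the gradient and the difference quotients have the
    same upper bounds. Finiteness of the supremum makes it a real bound to which this equivalence
    applies. *)
Lemma dilation_polar : dilation_factor 1 K (polar_projection_oo f) = quot_sup f K 1.
Proof.
have [M M0 EM] := quot_sup_fin n_gt0 B0 L0 fB fL K_star K_bounded (introT andP (conj ltr01 (lexx (1 : R)))).
rewrite /dilation_factor.
have E xi : sphere n xi -> (epow (gauge K xi) (- 1) * epow (gauge (polar_projection_oo f) xi) 1 =
    (rho K xi)%:E * polar_gauge_oo f xi)%E.
  move=> Sxi; rewrite gaugeE// epow_inv ?rho_gt0// epow_pos// powRr1 ?(ltW (rho_gt0 Sxi))//.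
  by rewrite gauge_polar_oo poweRe1//; apply: ess_sup_gee; [exact: lebesgue_rVT_gt0|apply: aeW => y; rewrite lee_fin].
apply/eqP; rewrite eq_le; apply/andP; split; apply: ub_ereal_sup.
  move=> _ [xi Sxi <-]; rewrite E// EM; have r0 := rho_gt0 Sxi.
  rewrite -lee_pdivlMl// -EFinM mulrC; apply/ess_supP.
  have := @grad_le_of_quot_le M xi M0 Sxi.
  move=> /(_ (fun x t => quot_le_sup x EM Sxi)).
  by apply: filterS => x; rewrite lee_fin.
move=> _ [xi [x [t [Sxi t0 ->]]]]; have r0 := rho_gt0 Sxi.
apply: (@le_trans _ _ ((rho K xi)%:E * polar_gauge_oo f xi)%E); last first.
  by rewrite -E//; apply: ereal_sup_ubound; exists xi.
have N0 : (0 <= polar_gauge_oo f xi)%E.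
  by apply: ess_sup_gee; [exact: lebesgue_rVT_gt0|apply: aeW => y; rewrite lee_fin].
case EN : (polar_gauge_oo f xi) N0 => [c| |]// c0; last first.
  by rewrite gt0_muley ?lte_fin ?leey.
rewrite lee_fin in c0.
rewrite -EFinM lee_fin; apply: quot_le_of_grad_le => //; first by rewrite mulr_ge0 ?(ltW r0).
have : (polar_gauge_oo f xi <= c%:E)%E by rewrite EN.
move=> /ess_supP; apply: filterS => y; rewrite lee_fin.
by rewrite mulrAC mulfV ?mul1r// gt_eqF.
Qed.

(** All but one of the p factors are bounded by [a]; the last is at most the sum of the |d_i f|,
    whose integral N does not depend on the direction. *)
Lemma polar_energy_ub : exists2 N : R, 0 <= N & forall a p xi, 1 <= p -> 0 <= a ->
  sphere n xi -> {ae mu, forall x, `|dot (grad f x) xi| <= a} ->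
  (polar_energy p f xi <= (a `^ (p - 1) * N)%:E)%E.
Proof.
pose S x : R := \sum_(i < n) `|grad f x 0 i|.
have iS : mu.-integrable setT (EFin \o S).
  apply: integrable_sumR => // i.
  by have := integrable_abse (intG i); apply: eq_integrable.
have IS0 : (0 <= \int[mu]_x (S x)%:E)%E.
  by apply: integral_ge0 => x _; rewrite lee_fin sumr_ge0.
exists (fine (\int[mu]_x (S x)%:E)); first exact: fine_ge0.
move=> a p xi p1 a0 Sxi ha.
rewrite /polar_energy EFinM fineK; last exact: integrable_fin_num.
rewrite -ge0_integralZl//; last 3 first.
- exact: measurable_int iS.
- by move=> x _; rewrite lee_fin sumr_ge0.
- by rewrite lee_fin powR_ge0.
apply: ae_ge0_le_integral => //.
- by move=> x _; rewrite mule_ge0 ?lee_fin ?powR_ge0 ?sumr_ge0.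
- by apply: emeasurable_funM => //; exact: measurable_int iS.
apply: filterS ha => x hx _; rewrite -EFinM lee_fin.
have DS : `|dot (grad f x) xi| <= S x.
  apply: le_trans (ler_norm_sum _ _ _) _; apply: ler_sum => i _.
  by rewrite normrM ler_piMr// -Sxi; exact: coord_le_enorm.
move: hx DS; have := normr_ge0 (dot (grad f x) xi); move: `|_| => D D0 Da DS.
have [->|Dn] := eqVneq D 0.
  by rewrite powR0 ?mulr_ge0 ?powR_ge0 ?sumr_ge0// gt_eqF//; lra.
have -> : D `^ p = D `^ (p - 1) * D.
  rewrite -[X in _ * X]powRr1// -powRD ?Dn ?implybT//; congr (_ `^ _); lra.
rewrite ler_pM ?powR_ge0// ge0_ler_powR ?nnegrE//; lra.
Qed.

(** On [E k] the derivative along [xi0] exceeds b / rho(xi0), and by truncation it varies by at most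
    k |xi0 - xi| when the direction changes. For [xi] near [xi0] it thus stays above a / rho(xi) on
    a fixed set of positive measure. *)
Lemma polar_energy_lb xi0 b a : sphere n xi0 -> 0 < a -> a < b ->
  ~ {ae mu, forall x, `|dot (grad f x) xi0| <= b / rho K xi0} ->
  exists2 c : R, 0 < c & exists2 A, nbhs xi0 A & forall p xi, 1 <= p -> A xi -> sphere n xi ->
    rho K xi0 / 2 <= rho K xi /\
    ((c * (a / rho K xi) `^ p)%:E <= polar_energy p f xi)%E.
Proof.
move=> Sxi0 a0 ab nb; have r0 := rho_gt0 Sxi0.
pose E k : set 'rV[R]_n := [set x | b / rho K xi0 < `|dot (grad f x) xi0| /\
   (\sum_(i < n) `|grad f x 0 i| <= k%:R)].
have mS : measurable_fun setT (fun x => \sum_(i < n) `|grad f x 0 i|).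
  apply: measurable_sum => i; apply: measurableT_comp => //.
  by apply/measurable_EFinP; exact: measurable_int (intG i).
have mE k : measurable (E k).
  rewrite (_ : E k = (fun x => `|dot (grad f x) xi0|) @^-1` `](b / rho K xi0), +oo[%classic `&`
     (fun x => \sum_(i < n) `|grad f x 0 i|) @^-1` `]-oo, k%:R]%classic); last first.
    by apply/seteqP; split=> x /=; rewrite !in_itv/= andbT.
  apply: measurableI.
    rewrite -[X in measurable X]setTI; apply: measurableT_comp => //; exact: measurable_itv.
  rewrite -[X in measurable X]setTI; apply: mS => //; exact: measurable_itv.
have [k Ek] : exists k, (0 < mu (E k))%E.
  apply: contrapT => h; apply: nb.
  have : mu.-negligible (\bigcup_k E k).
    apply: negligible_bigcup => k; exists (E k); split => //.
    apply/eqP; rewrite eq_le measure_ge0 andbT leNgt; apply/negP => Ek; apply: h; by exists k.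
  apply: negligibleS => x /= /negP; rewrite -ltNge => hx.
  have [k hk] : exists k : nat, \sum_(i < n) `|grad f x 0 i| <= k%:R.
    exists (Num.bound (\sum_(i < n) `|grad f x 0 i|)).
    by apply/ltW; apply: archi_boundP; exact: sumr_ge0.
  by exists k.
(* The measure of [E k] is an extended real; any positive real below it serves as the constant. *)
have [m m0 hm] : exists2 m : R, 0 < m & (m%:E <= mu (E k))%E.
  move: Ek; case: (mu (E k)) => [m| |]//; first by rewrite lte_fin => m0; exists m.
  by move=> _; exists 1 => //; rewrite leey.
exists m => //.
have c1 : rho K xi @[xi --> xi0] --> rho K xi0 by exact: continuous_rho.
(* The threshold for [xi], multiplied by rho(xi), tends to b > a. *)
have c2 : rho K xi * (b / rho K xi0 - k%:R * `|xi0 - xi|) @[xi --> xi0] --> b.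
  have E0 : b = rho K xi0 * (b / rho K xi0 - k%:R * `|xi0 - xi0|).
    by rewrite subrr normr0 mulr0 subr0 mulrCA mulfV ?mulr1// gt_eqF.
  rewrite [X in _ --> X]E0.
  apply: (cvgM c1); apply: cvgB; first exact: cvg_cst.
  apply: cvgM; first exact: cvg_cst.
  by apply: cvg_norm; apply: cvgB; [exact: cvg_cst|exact: cvg_id].
exists [set xi | rho K xi0 / 2 <= rho K xi /\ a < rho K xi * (b / rho K xi0 - k%:R * `|xi0 - xi|)].
  near=> xi; split; near: xi; last exact: (cvgr_gt _ c2).
  by apply: (cvgr_ge _ c1); lra.
move=> p xi p1 [hr ha] Sxi; split => //; have rx := rho_gt0 Sxi.
apply: (@le_trans _ _ (((a / rho K xi) `^ p)%:E * mu (E k))%E).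
  by rewrite mulrC EFinM lee_wpmul2l// lee_fin powR_ge0.
apply: ge0_integral_lb => //; first exact: powR_ge0.
move=> x [h1 h2]; rewrite lee_fin ge0_ler_powR ?nnegrE ?divr_ge0 ?(ltW a0) ?(ltW rx)//; first lra.
have h3 : a / rho K xi <= b / rho K xi0 - k%:R * `|xi0 - xi|.
  by rewrite ler_pdivrMr// mulrC ltW.
apply: le_trans h3 _.
have h4 : `|dot (grad f x) xi0| <= `|dot (grad f x) xi| + k%:R * `|xi0 - xi|.
  have -> : dot (grad f x) xi0 = dot (grad f x) xi + dot (grad f x) (xi0 - xi).
    by rewrite /dot -big_split/=; apply: eq_bigr => i _; rewrite !mxE; ring.
  apply: le_trans (ler_normD _ _) _; rewrite lerD2l.
  apply: le_trans (ler_norm_sum _ _ _) _.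
  apply: (@le_trans _ _ (\sum_(i < n) `|grad f x 0 i| * `|xi0 - xi|)).
    by apply: ler_sum => i _; rewrite normrM ler_wpM2l//; exact: coord_le_norm.
  by rewrite -mulr_suml ler_wpM2r.
lra.
Unshelve. all: by end_near. Qed.

Lemma polar_energy_root :
  (((n%:R^-1)%:E * \int[sigma]_(xi in sphere n)
      ((rho K xi `^ (n%:R + p))%:E * polar_energy p f xi)) `^ p^-1)%E
    @[p --> +oo] --> quot_sup f K 1.
Proof.
have [M M0 EM] := quot_sup_fin n_gt0 B0 L0 fB fL K_star K_bounded (introT andP (conj ltr01 (lexx (1 : R)))).
have nV : 0 < n%:R^-1 :> R by rewrite invr_gt0 ltr0n.
have FE0 p xi : (0 <= (rho K xi `^ (n%:R + p))%:E * polar_energy p f xi)%E.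
  rewrite mule_ge0 ?lee_fin ?powR_ge0//.
  by apply: integral_ge0 => x _; rewrite lee_fin powR_ge0.
rewrite EM; apply: cvg_root => //.
- near=> p.
  by rewrite mule_ge0 ?lee_fin ?(ltW nV)//; apply: integral_ge0 => xi _; exact: FE0.
- move=> a Ma; have a0 : 0 < a := le_lt_trans M0 Ma.
  have [N N0 hN] := polar_energy_ub.
  have [D D0 hD] := rho_ub K_star K_bounded.
  have := @surface_measure_sphere_fin R n.
  have : (0 <= sigma (sphere n))%E by [].
  case E : (sigma (sphere n)) => [S| |]// S0 _; rewrite lee_fin in S0.
  exists (n%:R^-1 * (D `^ (n%:R + 1) * a^-1 * N * S)).
  near=> p; have p1 : 1 <= p by near: p; exact: nbhs_pinfty_ge.
  have : (\int[sigma]_(xi in sphere n)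
      ((rho K xi `^ (n%:R + p))%:E * polar_energy p f xi) <=
      (D `^ (n%:R + 1) * a^-1 * N * a `^ p)%:E * sigma (sphere n))%E.
    apply: ge0_integral_ub; first exact: measurable_sphere.
      by move=> xi _; exact: FE0.
    move=> xi Sxi; have r0 := rho_gt0 Sxi.
    apply: (@le_trans _ _ ((rho K xi `^ (n%:R + p))%:E * ((a / rho K xi) `^ (p - 1) * N)%:E)%E).
      rewrite lee_wpmul2l ?lee_fin ?powR_ge0//; apply: hN => //.
        by rewrite divr_ge0 ?(ltW a0) ?(ltW r0).
      apply: grad_le_of_quot_le => //; first exact: ltW.
      by move=> x t t0; apply: le_trans (quot_le_sup x EM Sxi t0) (ltW Ma).
    rewrite -EFinM lee_fin (powR_div (p - 1) a0 r0).
    have -> : a `^ (p - 1) = a `^ p * a^-1.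
      by rewrite -[a^-1]powR_inv1 ?(ltW a0)// -powRD ?(gt_eqF a0) ?implybT.
    have -> : rho K xi `^ (n%:R + p) = rho K xi `^ (n%:R + 1) * rho K xi `^ (p - 1).
      by rewrite -powRD ?(gt_eqF r0) ?implybT//; congr (_ `^ _); ring.
    rewrite (_ : _ * (_ * _ * N) = (rho K xi `^ (p - 1) * rho K xi `^ (- (p - 1))) *
       (rho K xi `^ (n%:R + 1) * a^-1 * N * a `^ p)); last ring.
    rewrite -powRD ?(gt_eqF r0) ?implybT// subrr powRr0 mul1r.
    rewrite !ler_wpM2r ?powR_ge0// ?invr_ge0 ?(ltW a0)//.
    by rewrite ge0_ler_powR ?nnegrE ?(ltW r0) ?(ltW D0) ?addr_ge0 ?ler0n//; exact: hD.
  rewrite E -EFinM => h.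
  apply: le_trans (lee_wpmul2l _ h) _; first by rewrite lee_fin ltW.
  rewrite -EFinM lee_fin.
  (* The bound found has no factor p; p >= 1 lets one be inserted to match [cvg_root]. *)
  have h0 : 0 <= n%:R^-1 * (D `^ (n%:R + 1) * a^-1 * N * S) * a `^ p.
    by rewrite !mulr_ge0 ?powR_ge0 ?invr_ge0 ?ler0n// ltW.
  have := ler_wpM2l h0 p1; rewrite mulr1 => h1.
  rewrite (_ : n%:R^-1 * (D `^ (n%:R + 1) * a^-1 * N * a `^ p * S) =
    n%:R^-1 * (D `^ (n%:R + 1) * a^-1 * N * S) * a `^ p); last ring.
  by rewrite [leRHS]mulrAC.
(* The midpoint b leaves the gap a < b that is consumed when moving from one direction to its
   neighbours. *)
- move=> a /andP[a0 aM]; pose b := (a + M) / 2.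
  have ab : a < b by rewrite /b; lra.
  have bM : b < M by rewrite /b; lra.
  have [xi0 [x0 [t0 [Sxi0 t00 bq]]]] := quot_sup_gt EM bM.
  have nb : ~ {ae mu, forall x, `|dot (grad f x) xi0| <= b / rho K xi0}.
    move=> h; have b0 : 0 <= b by lra.
    by have := quot_le_of_grad_le b0 Sxi0 h x0 t00; rewrite leNgt bq.
  have [c c0 [A nA hA]] := polar_energy_lb Sxi0 a0 ab nb.
  have [E [mE ES EA sE]] := surface_measure_nbhs Sxi0 nA.
  have r0 := rho_gt0 Sxi0.
  have : (sigma E < +oo)%E.
    apply: le_lt_trans (@surface_measure_sphere_fin R n); apply: le_measure; rewrite ?inE//.
    exact: measurable_sphere.
  move: sE; case EE : (sigma E) => [S| |]//; rewrite lte_fin => S0 _.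
  exists (n%:R^-1 * ((rho K xi0 / 2) `^ n%:R * c * S)).
    by rewrite !mulr_gt0// powR_gt0// divr_gt0.
  near=> p; have p1 : 1 <= p by near: p; exact: nbhs_pinfty_ge.
  have h : ((((rho K xi0 / 2) `^ n%:R * c * a `^ p)%:E * sigma E) <=
     \int[sigma]_(xi in sphere n)
      ((rho K xi `^ (n%:R + p))%:E * polar_energy p f xi))%E.
    apply: ge0_integral_lb => //.
    - by rewrite !mulr_ge0 ?powR_ge0// ltW.
    move=> xi Exi; have Sxi := ES _ Exi; have [hr hc] := hA p xi p1 (EA _ Exi) Sxi.
    have rx0 := rho_gt0 Sxi.
    apply: le_trans (lee_wpmul2l _ hc); last by rewrite lee_fin powR_ge0.
    rewrite -EFinM lee_fin (powR_div p a0 rx0).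
    rewrite powRD ?(gt_eqF rx0) ?implybT//.
    have -> : rho K xi `^ n%:R * rho K xi `^ p * (c * (a `^ p * rho K xi `^ (- p))) =
      rho K xi `^ n%:R * c * a `^ p * (rho K xi `^ p * rho K xi `^ (- p)) by ring.
    rewrite -powRD ?(gt_eqF rx0) ?implybT// subrr powRr0 mulr1 !ler_wpM2r ?powR_ge0 ?(ltW c0)//.
    by rewrite ge0_ler_powR ?nnegrE ?ler0n ?divr_ge0 ?(ltW r0) ?(ltW rx0).
  apply: le_trans (lee_wpmul2l _ h); last by rewrite lee_fin ltW.
  rewrite EE -!EFinM lee_fin le_eqVlt; apply/orP; left; apply/eqP; ring.
Unshelve. all: by end_near. Qed.

End polar_energy_limit.

(** * Bounds and integrability from the Sobolev hypotheses *)

Section sobolev_functions.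
Context {R : realType} {n : nat}.
Local Notation mu := (lebesgue_rV R n).
Implicit Types f g : 'rV[R]_n -> R.

Lemma lipschitz_ub f : lipschitz (f : _ -> R^o) ->
  exists2 L : R, 0 < L & forall x y, `|f x - f y| <= L * `|x - y|.
Proof.
move=> [M [_ hM]]; exists (`|M| + 1) => [|x y]; first by rewrite ltr_wpDl.
have MM : M < `|M| + 1 by apply: le_lt_trans (ler_norm M) _; rewrite ltrDl.
exact: (hM _ MM (x, y)).
Qed.

Lemma lipschitz_continuous f (L : R) : 0 < L ->
  (forall x y, `|f x - f y| <= L * `|x - y|) -> continuous f.
Proof.
move=> L0 fL x.
apply: (proj2 (@cvgrPdist_le _ _ _ (nbhs x) (nbhs_filter x) f (f x))) => e e0; near=> y.
apply: le_trans (fL x y) _; rewrite -ler_pdivlMl//.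
near: y; apply: cvgr_dist_le; first exact: cvg_id.
by rewrite mulr_gt0 ?invr_gt0.
Unshelve. all: by end_near. Qed.

(** A value above the essential bound would persist on a neighbourhood, which a null set cannot
    contain. *)
Lemma Lfun_oo_continuous_bounded f : continuous f -> f \in Lfun mu +oo%E ->
  exists2 C : R, 0 < C & forall x, `|f x| <= C.
Proof.
move=> cf /andP[_]; rewrite inE /= /finite_norm unlock /Lnorm lebesgue_rVT_gt0 => fin.
have [C hC] : exists C : R, \forall x \ae mu, `|f x| <= C.
  exact: (@ess_supr_bounded _ _ _ mu (fun x => `|f x|)).
exists (`|C| + 1) => [|x]; first by rewrite ltr_wpDl.
rewrite leNgt; apply/negP => Cx.
have nA : \forall y \near x, `|C| + 1 < `|f y|.
  have c : `|f y| @[y --> x] --> `|f x|    by apply: (@continuous_comp _ _ _ f (fun r : R => `|r|)); [exact: cf|exact: norm_continuous].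
  exact: (cvgr_gt _ c).
have [y h1 h2] := ae_nbhs hC nA.
by have := ler_norm C; move: h1 h2 => /=; lra.
Qed.

Lemma sobolev_weak_gradient p f : sobolev p f -> weak_gradient f (grad f).
Proof. by move=> [_ /getPex]. Qed.

(** Integrability on the compact cubes [-k, k]^n gives measurability on each of them, and they
    exhaust the space. *)
Lemma loc_integrable_measurable g : loc_integrable g -> measurable_fun setT g.
Proof.
move=> lg; pose A (k : nat) : set 'rV[R]_n := [set x | forall i, x 0 i \in `[- k%:R, k%:R]].
have mA k : measurable (A k).
  rewrite (_ : A k = \bigcap_(i in [set: 'I_n]) ((fun x : 'rV[R]_n => x 0 i) @^-1` `[- k%:R, k%:R]%classic)).
    apply: fin_bigcap_measurable => // i _.
    rewrite -[X in measurable X]setTI; apply: measurable_coord => //; exact: measurable_itv.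
  by apply/seteqP; split=> x h i; [move=> _; exact: h|exact: (h i I)].
have -> : setT = \bigcup_k A k.
  apply/seteqP; split=> // x _.
  exists (Num.bound (\sum_(i < n) `|x 0 i|)) => // i.
  rewrite in_itv/= -ler_norml.
  apply: (@le_trans _ _ (\sum_(i < n) `|x 0 i|)).
    by rewrite (bigD1 i)//= lerDl sumr_ge0.
  by apply/ltW; apply: archi_boundP; exact: sumr_ge0.
apply/measurable_fun_bigcup => // k; apply/measurable_EFinP.
apply: measurable_int (lg (A k) _).
have := @compact_box R n (const_mx (- k%:R)) (const_mx k%:R).
by congr compact; apply/seteqP; split=> x /= h i; have := h i; rewrite !mxE.
Qed.

(** Each coordinate is dominated by the Euclidean norm of the gradient; its measurability comes from
    local integrability. *)
Lemma sobolev1_integrable_grad f : sobolev 1%E f ->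
  forall i, mu.-integrable setT (EFin \o (fun x => grad f x 0 i)).
Proof.
move=> Wf i; have [_ lG _] := sobolev_weak_gradient Wf.
have [_ _ /Lfun1_integrable iG] := Wf.
apply: le_integrable iG => //.
  by apply/measurable_EFinP; exact: loc_integrable_measurable.
move=> x _; rewrite /= lee_fin [leRHS]ger0_norm ?sqrtr_ge0//; exact: coord_le_enorm.
Qed.

End sobolev_functions.

(** * Assembly of the three limits *)

Theorem theorem4p4 (R : realType) (n : nat) (n_gt0 : (0 < n)%N)
    (f : 'rV[R]_n -> R) (K : set 'rV[R]_n)
    (f_W11 : sobolev 1%E f) (f_W1oo : sobolev +oo%E f)
    (f_lip : lipschitz (f : _ -> R^o)) (f_neq0 : exists x, f x != 0)
    (K_star : star_body K) (K_bounded : bounded_set K) :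
  [/\ forall s : R, 0 < s < 1 ->
        (dual_mixed_volume (- s * p) K (frac_polar_projection s p f)
           `^ p^-1)%E @[p --> +oo%R] -->
        dilation_factor s K (frac_polar_projection_oo s f),
      (dual_mixed_volume (- p) K (polar_projection p f)
         `^ p^-1)%E @[p --> +oo%R] -->
        dilation_factor 1 K (polar_projection_oo f) &
      dilation_factor s K (frac_polar_projection_oo s f) @[s --> 1^'-] -->
        dilation_factor 1 K (polar_projection_oo f)].

Proof.
have [L L0 fL] := lipschitz_ub f_lip.
have cf := lipschitz_continuous L0 fL.
have [f1 _ _] := f_W11; have intf := (Lfun1_integrable _ _).1 f1.
have [foo _ _] := f_W1oo; have [C C0 fC] := Lfun_oo_continuous_bounded cf foo.
have fB x y : `|f x - f y| <= C + C.
  exact: le_trans (ler_normB _ _) (lerD (fC x) (fC y)).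
have CC0 : 0 < C + C by rewrite addr_gt0.
have [_ _ wG] := sobolev_weak_gradient f_W11.
have intG := sobolev1_integrable_grad f_W11.
have mf : measurable_fun setT f by exact: continuous_measurable_rV.
have polarE := dilation_polar n_gt0 cf intf intG wG CC0 L0 fB fL K_star K_bounded.
split.
- move=> s s01; have /andP[s0 s1] := s01.
  rewrite (dilation_frac f K_star K_bounded s0).
  have := frac_energy_root n_gt0 cf intf CC0 L0 fB fL K_star K_bounded s01.
  apply: cvg_trans; apply: near_eq_cvg; near=> p.
  have p0 : 0 < p by near: p; exact: nbhs_pinfty_gt.
  have sp0 : 0 < s * p by rewrite mulr_gt0.
  (* For p > 0 the integrands agree on the sphere: the gauge of [K] gives rho^(n + s p), and the
     exponent s p undoes the root in the other gauge. *)
  rewrite /dual_mixed_volume; congr ((_ * _) `^ _)%E.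
  apply: eq_integral => xi; rewrite inE => Sxi.
  have -> : - n%:R + - s * p = - (n%:R + s * p) by ring.
  have -> : - (- s * p) = s * p by ring.
  rewrite gaugeE// epow_inv ?rho_gt0 ?ltr_wpDl ?ler0n//.
  rewrite epow_pos ?(ltW sp0)// gauge_frac_polar ?(ltW s1)// -poweRrM.
  rewrite (mulrC p) mulVf ?gt_eqF// poweRe1//.
  by apply: frac_energy_ge0; apply: ltW.
- rewrite polarE.
  have := polar_energy_root n_gt0 cf intf intG wG CC0 L0 fB fL K_star K_bounded.
  apply: cvg_trans; apply: near_eq_cvg; near=> p.
  have p0 : 0 < p by near: p; exact: nbhs_pinfty_gt.
  rewrite /dual_mixed_volume; congr ((_ * _) `^ _)%E.
  apply: eq_integral => xi; rewrite inE => Sxi.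
  rewrite opprK -opprD gaugeE// epow_inv ?rho_gt0 ?ltr_wpDl ?ler0n//.
  rewrite epow_pos ?(ltW p0)// gauge_polar//; last exact: (measurable_dot intG).
  rewrite -poweRrM mulVf ?gt_eqF// poweRe1//.
  by apply: integral_ge0 => x _; rewrite lee_fin powR_ge0.
- rewrite polarE.
  have := quot_sup_cvg1 n_gt0 CC0 L0 fB fL K_star K_bounded.
  apply: cvg_trans; apply: near_eq_cvg; near=> s.
  by rewrite dilation_frac//; near: s; exact: nbhs_left_gt.
Unshelve. all: by end_near. Qed.
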